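(* Let $X$ be a singular complex analytic vector field on a connected Riemann surface $M$, with singular set $\mathcal{S}$ and associated (possibly multivalued) function $\Psi_X$. The maximal univalence region for a nonstationary complex solution $z(t)$ of $X$ is $$\mathscr{D}_X=\{(z,\Psi_X(z))\ \vert\ z\in M\backslash\mathcal{S}\}.$$ Moreover, $\mathscr{D}_X$ is independent of the initial condition $z_{\tt o}\in M\backslash\mathcal{S}$.
   Context: $M$ is a connected, not necessarily compact, Riemann surface; conformal punctures of $M$ are regarded as points of $M$. A vector field $X=f(z)\frac{\partial}{\partial z}\not\equiv0$ on $M$ is *singular complex analytic* if it is analytic away from its singular set $\mathcal{S}$, which consists of zeros, poles, and essential singularities (possibly nonisolated, i.e. including accumulation points of singularities). Its 1-form of time is $\omega_X=dz/f(z)$, and $\Psi_X(z)=\int_{z_{\tt o}}^z\omega_X$ with $z_{\tt o}\in M\backslash\mathcal{S}$; $\Psi_X$ is in general multivalued, and the set $\{(z,\Psi_X(z))\}\subset M\times\mathbb{C}_t$ is the graph including all branches obtained by analytic continuation, regarded as a Riemann surface. The set of singular points where $\omega_X$ has nonzero residue is assumed at most countable. A local nonstationary complex trajectory solution of $X$ with initial condition $z_{\tt o}\in M\backslash\mathcal{S}$ is $z(t)=\Psi_X^{-1}(t):D(0,\rho)\subset\mathbb{C}_t\to M$. The *maximal region of univalence* $\mathscr{D}_X$ of $X$ is the connected Riemann surface obtained by analytic continuation of a local nonstationary complex trajectory solution $z(t)$ along paths from $t=0$ in $\mathbb{C}_t$ (so that $\pi_2:\mathscr{D}_X\to\mathbb{C}_t$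 is an unbranched Riemann domain, where $\pi_2$ is the projection to $t$). $\Psi_X$ and $\Psi_X+c$, $c\in\mathbb{C}$, are regarded as the same object.
   Formalization: Two assumptions are added, without which the claim fails: M∖S is connected, and at a nonisolated point of S the field X has no analytic nonvanishing continuation along any path of M∖S ending at that point (otherwise z(t) would continue into S). *)

(* Defs.v *)
(* MathComp-Analysis, over R : realType, with complex numbers R[i]. *)
From HB Require Import structures.
From mathcomp Require Import all_boot all_order all_algebra complex.
From mathcomp Require Import all_classical all_reals all_analysis.
Set Implicit Arguments.
Unset Strict Implicit.
Unset Printing Implicit Defensive.
Import Order.TTheory GRing.Theory Num.Theory numFieldNormedType.Exports.
Local Open Scope classical_set_scope.
Local Open Scope ring_scope.
Local Open Scope complex_scope.

(* R[i] seen as a numFieldType, which is what carries the norm topology. *)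
Definition cplx (R : realType) : numFieldType := R[i].

Definition analytic_at (R : realType) (f : cplx R -> cplx R) (a : cplx R) :=
  exists c : nat -> cplx R, \forall z \near a,
    series (fun n => c n * (z - a) ^+ n) @ \oo --> f z.

(* \int_0^1 h(s) ds for complex-valued h *)
Definition cintegral (R : realType) (h : R -> cplx R) : cplx R :=
  (\int[@lebesgue_measure R]_(s in `[0, 1]) complex.Re (h s)) +i*
  (\int[@lebesgue_measure R]_(s in `[0, 1]) complex.Im (h s)).

(** * Riemann surfaces *)

(* cinv matters only on the image of cdom. *)
Record chart (R : realType) (T : Type) := Chart {
  cdom : set T;
  cmap : T -> cplx R;
  cinv : cplx R -> T }.

(* A homeomorphism of an open set onto an open subset of the plane. *)
Definition is_chart (R : realType) (T : topologicalType) (c : chart R T) :=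
  [/\ open (cdom c),
      {in cdom c, cancel (cmap c) (cinv c)} &
      forall U, U `<=` cdom c -> (open U <-> open (cmap c @` U))].

(* The surface is the open set D of T with its induced topology, so that a
   component of a space of germs is treated without forming a subtype; a
   surface T is the case D = [set: T].  Second countability is not required. *)
Definition riemann_surface (R : realType) (T : topologicalType)
    (A : set (chart R T)) (D : set T) :=
  [/\ forall c, A c -> is_chart c,
      \bigcup_(c in A) cdom c = D,
      forall c1 c2 p, A c1 -> A c2 -> cdom c1 p -> cdom c2 p ->
        analytic_at (cmap c2 \o cinv c1) (cmap c1 p),
      forall p q, D p -> D q -> p <> q -> exists U V : set T,
        [/\ open U, open V, U p, V q & U `&` V = set0] &
      connected D].

Definition plane_atlas (R : realType) : set (chart R (cplx R)) :=
  [set Chart [set: cplx R] id id].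

Definition analytic_map (R : realType) (T1 T2 : topologicalType)
    (A1 : set (chart R T1)) (A2 : set (chart R T2)) (F : T1 -> T2) (p : T1) :=
  {for p, continuous F} /\
  forall c1 c2, A1 c1 -> A2 c2 -> cdom c1 p -> cdom c2 (F p) ->
    analytic_at (cmap c2 \o F \o cinv c1) (cmap c1 p).

Definition biholomorphic (R : realType) (T1 T2 : topologicalType)
    (A1 : set (chart R T1)) (D1 : set T1)
    (A2 : set (chart R T2)) (D2 : set T2) (F : T1 -> T2) :=
  [/\ set_bij D1 D2 F,
      forall p, D1 p -> analytic_map A1 A2 F p &
      exists2 G : T2 -> T1, {in D1, cancel F G} &
        forall q, D2 q -> analytic_map A2 A1 G q].

(** * Singular complex analytic vector fields *)

(* X c w is the coefficient f(w) of X = f(w) d/dw in the coordinate w of the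
   chart c. *)
Definition vfield (R : realType) (M : Type) := chart R M -> cplx R -> cplx R.

Section Singularities.
Variables (R : realType) (M : topologicalType) (A : set (chart R M)).
Variables (S : set M) (X : vfield R M).

Definition is_zero (p : M) := isolated S p /\
  exists c, [/\ A c, cdom c p & exists g : cplx R -> cplx R,
    [/\ analytic_at g (cmap c p), g (cmap c p) = 0 &
        \forall w \near (cmap c p)^', X c w = g w]].

Definition is_pole (p : M) := isolated S p /\
  exists c, [/\ A c, cdom c p & exists (k : nat) (g : cplx R -> cplx R),
    [/\ (0 < k)%N, analytic_at g (cmap c p), g (cmap c p) != 0 &
        \forall w \near (cmap c p)^', X c w = g w / (w - cmap c p) ^+ k]].

Definition is_isolated_essential (p : M) := isolated S p /\
  exists c, [/\ A c, cdom c p & ~ exists (k : nat) (g : cplx R -> cplx R),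
    analytic_at g (cmap c p) /\
    \forall w \near (cmap c p)^', X c w = g w / (w - cmap c p) ^+ k].

(* X has an analytic nonvanishing continuation to beta 1 along beta. *)
Definition regular_along (beta : R -> M) :=
  exists c, [/\ A c, cdom c (beta 1) & exists g : cplx R -> cplx R,
    [/\ analytic_at g (cmap c (beta 1)), g (cmap c (beta 1)) != 0 &
        \forall s \near (1 : R)^'-,
          \forall w \near cmap c (beta s), X c w = g w]].

(* An accumulation point p of S at which X is genuinely singular: whichever
   path of M \ S leads to p, X does not continue along it to a regular point.
   When S does not separate M locally at p this holds automatically as soon as
   isolated zeros, poles or essential singularities accumulate at p; in general
   S may contain an arc with poles accumulating from one side only, while X
   continues analytically across it from the other side. *)
Definition is_nonisolated_essential (p : M) :=
  [/\ S p, limit_point S p, closure (~` S) p &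
      forall beta : R -> M, {within `[0, 1], continuous beta} -> beta 1 = p ->
        (forall s, 0 <= s < 1 -> ~ S (beta s)) -> ~ regular_along beta].

(* (1 / 2 pi i) times the integral of dw / f(w) along |w - c(p)| = r *)
Definition circle_period (c : chart R M) (p : M) (r : R) : cplx R :=
  cintegral (fun s : R =>
    let u : cplx R := r * cos (2 * pi * s) +i* (r * sin (2 * pi * s)) in
    u / X c (cmap c p + u)).

(* The residue is the common value on all small circles. *)
Definition time_form_residue (p : M) (v : cplx R) :=
  exists c, [/\ A c, cdom c p & \forall r \near (0 : R)^'+,
    circle_period c p r = v].

(* X not identically zero amounts to S being a proper subset, which every
   initial condition outside S witnesses. *)
Record singular_vector_field : Prop := SingularVectorField {
  svf_closed : closed S;
  svf_connected : connected (~` S);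
  svf_change : forall c1 c2 p, A c1 -> A c2 -> cdom c1 p -> cdom c2 p ->
    ~ S p -> X c2 (cmap c2 p) =
      derive1 (cmap c2 \o cinv c1) (cmap c1 p) * X c1 (cmap c1 p);
  svf_analytic : forall c p, A c -> cdom c p -> ~ S p ->
    analytic_at (X c) (cmap c p);
  svf_nonzero : forall c p, A c -> cdom c p -> ~ S p -> X c (cmap c p) != 0;
  svf_singular : forall p, S p ->
    [\/ is_zero p, is_pole p, is_isolated_essential p |
        is_nonisolated_essential p];
  svf_residues : countable [set p | isolated S p /\
    exists2 v, v != 0 & time_form_residue p v] }.

End Singularities.

(** * Germs and analytic continuation *)

(* A germ is the class of all functions that agree near the base point. *)
Definition germ_class (X : topologicalType) (Y : Type) (f : X -> Y) (p : X) :
  set (X -> Y) := [set h | \forall q \near p, h q = f q].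

Record etale (X : topologicalType) (Y : Type) := Etale {
  base : X;
  germ : set (X -> Y);
  germP : exists f, germ = germ_class f base }.

Definition germ_at (X : topologicalType) (Y : Type) (f : X -> Y) (p : X) :
  etale X Y := Etale (ex_intro _ f (erefl (germ_class f p))).

Definition germ_rep (X : topologicalType) (Y : Type) (e : etale X Y) : X -> Y :=
  projT1 (cid (germP e)).

Section EtaleTopology.
Variables (X : topologicalType) (Y : Type).

Definition etale_open : set_system (etale X Y) :=
  [set W | forall f p, W (germ_at f p) ->
    \forall q \near p, W (germ_at f q)].

Let etale_openT : etale_open setT.
Proof. by move=> f p _; apply: filterE. Qed.

Let etale_openI : setI_closed etale_open.
Proof.
move=> V W oV oW f p [Vp Wp].
by apply: filterS2 (oV _ _ Vp) (oW _ _ Wp) => q; split.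
Qed.

Let etale_open_bigU (I : Type) (F : I -> set (etale X Y)) :
  (forall i, etale_open (F i)) -> etale_open (\bigcup_i F i).
Proof.
move=> oF f p [i _ Fip].
by apply: filterS (oF i _ _ Fip) => q Fq; exists i.
Qed.

HB.instance Definition _ := gen_eqMixin (etale X Y).
HB.instance Definition _ := gen_choiceMixin (etale X Y).
HB.instance Definition _ := isOpenTopological.Build (etale X Y)
  etale_openT etale_openI etale_open_bigU.

End EtaleTopology.

Definition analytic_germs (R : realType) (T1 T2 : topologicalType)
    (A1 : set (chart R T1)) (A2 : set (chart R T2)) (D : set T1) :
    set (etale T1 T2) :=
  [set e | exists f p, [/\ e = germ_at f p, D p & analytic_map A1 A2 f p]].

(* All germs obtained from e0 by continuation along paths, the germs met on
   the way lying in O: a continuation along the path base \o sigma is a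
   continuous lift sigma of it to the space of germs. *)
Definition continuation (R : realType) (X : topologicalType) (Y : Type)
    (O : set (etale X Y)) (e0 : etale X Y) : set (etale X Y) :=
  [set e | exists sigma : R -> etale X Y,
    [/\ {within `[0, 1], continuous sigma}, sigma 0 = e0, sigma 1 = e &
        forall s, 0 <= s <= 1 -> O (sigma s)]].

(* The complex structure on the open set D for which proj is locally
   biholomorphic. *)
Definition pullback_atlas (R : realType) (T X : topologicalType)
    (A : set (chart R X)) (D : set T) (proj : T -> X) : set (chart R T) :=
  [set c | [/\ is_chart c, cdom c `<=` D &
    exists2 c0, A c0 & proj @` cdom c `<=` cdom c0 /\
                       cmap c = cmap c0 \o proj]].

(** * Time function, trajectories, and the region of univalence *)

(* psi is Psi_X(p) = \int_z0^p dw / f(w) for p near z0, integrated along the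
   segment from z0 to p in a chart. *)
Definition time_branch (R : realType) (M : topologicalType)
    (A : set (chart R M)) (X : vfield R M) (z0 : M) (psi : M -> cplx R) :=
  forall c, A c -> cdom c z0 -> \forall p \near z0,
    psi p = cintegral (fun s : R =>
      (cmap c p - cmap c z0) /
      X c (cmap c z0 + s%:C * (cmap c p - cmap c z0))).

(* z(t) = Psi_X^-1(t) on some disc about t = 0, with z(0) = z0. *)
Definition local_solution (R : realType) (M : topologicalType)
    (A : set (chart R M)) (X : vfield R M) (z0 : M) (z : cplx R -> M) :=
  [/\ z 0 = z0, {for 0, continuous z} &
      exists2 psi, time_branch A X z0 psi & \forall t \near 0, psi (z t) = t].

(* The points are pairs (t, germ of the solution at t).  The continuation is
   that of z as an analytic map into M; it is not required to stay away from
   the singular set. *)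
Definition univalence_region (R : realType) (M : topologicalType)
    (A : set (chart R M)) (z : cplx R -> M) : set (etale (cplx R) M) :=
  @continuation R _ _ (analytic_germs (@plane_atlas R) A setT) (germ_at z 0).

(* base is the projection to the time plane. *)
Definition univalence_atlas (R : realType) (M : topologicalType)
    (A : set (chart R M)) (z : cplx R -> M) : set (chart R (etale (cplx R) M)) :=
  pullback_atlas (@plane_atlas R) (univalence_region A z) (@base _ _).

Definition time_branches (R : realType) (M : topologicalType)
    (A : set (chart R M)) (S : set M) (X : vfield R M) (z0 : M) :
    set (etale M (cplx R)) :=
  [set e | exists2 psi, time_branch A X z0 psi &
    @continuation R _ _ (analytic_germs A (@plane_atlas R) (~` S))
      (germ_at psi z0) e].

Definition graph_of (M : topologicalType) (Y : Type) (B : set (etale M Y)) :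
  set (M * Y) := [set q | exists2 psi, B (germ_at psi q.1) & q.2 = psi q.1].

(* M * Y with the topology whose basic open subsets of the graph are the graphs
   of the single branches.  It is finer than the product topology, in which
   the graph is in general not a surface, the values over one point being
   possibly dense in the plane. *)
Definition sheets (M : topologicalType) (Y : choiceType)
  (B : set (etale M Y)) : Type := (M * Y)%type.

Section SheetTopology.
Variables (M : topologicalType) (Y : choiceType) (B : set (etale M Y)).

Definition sheets_open : set_system (sheets B) :=
  [set W | forall psi p, B (germ_at psi p) -> W (p, psi p) ->
    \forall q \near p, W (q, psi q)].

Let sheets_openT : sheets_open setT.
Proof. by move=> f p _ _; apply: filterE. Qed.

Let sheets_openI : setI_closed sheets_open.
Proof.
move=> V W oV oW f p Bp [Vp Wp].
by apply: filterS2 (oV _ _ Bp Vp) (oW _ _ Bp Wp) => q; split.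
Qed.

Let sheets_open_bigU (I : Type) (F : I -> set (sheets B)) :
  (forall i, sheets_open (F i)) -> sheets_open (\bigcup_i F i).
Proof.
move=> oF f p Bp [i _ Fip].
by apply: filterS (oF i _ _ Bp Fip) => q Fq; exists i.
Qed.

HB.instance Definition _ := Choice.copy (sheets B) (M * Y)%type.
HB.instance Definition _ := isOpenTopological.Build (sheets B)
  sheets_openT sheets_openI sheets_open_bigU.

End SheetTopology.

Definition time_sheets (R : realType) (M : topologicalType)
    (A : set (chart R M)) (S : set M) (X : vfield R M) (z0 : M) :
    topologicalType :=
  sheets (time_branches A S X z0).

(* { (z, Psi_X(z)) | z in M \ S }, with all branches of Psi_X *)
Definition time_graph (R : realType) (M : topologicalType)
    (A : set (chart R M)) (S : set M) (X : vfield R M) (z0 : M) :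
    set (time_sheets A S X z0) :=
  graph_of (time_branches A S X z0).
Arguments time_graph {R M} A S X z0.

Definition time_graph_atlas (R : realType) (M : topologicalType)
    (A : set (chart R M)) (S : set M) (X : vfield R M) (z0 : M) :
    set (chart R (time_sheets A S X z0)) :=
  pullback_atlas A (time_graph A S X z0) fst.
Arguments time_graph_atlas {R M} A S X z0.

(* (t, germ of z at t) |-> (z(t), t) *)
Definition space_time (R : realType) (M : topologicalType)
    (A : set (chart R M)) (S : set M) (X : vfield R M) (z0 : M)
    (e : etale (cplx R) M) : time_sheets A S X z0 :=
  (germ_rep e (base e), base e).
Arguments space_time {R M} A S X z0 e.

(* (t, germ of z at t) |-> (t + b, germ of z(. - b) at t + b) *)
Definition time_shift (R : realType) (M : topologicalType) (b : cplx R)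
    (e : etale (cplx R) M) : etale (cplx R) M :=
  germ_at (fun t => germ_rep e (t - b)) (base e + b).

(* Main.v *)
(* At a regular point the solutions z of z' = X(z) and the primitives psi of the
   time form are local inverses of each other, and each germ is determined by
   the pair (position, time).  Hence (germ of z at t) |-> (germ of psi at z(t))
   is a homeomorphism between the germs of solutions and the germs of time
   functions over M \ S; it carries continuation to continuation, so it maps
   the region of univalence onto the branches of Psi_X.

   The point is that continuing z merely as an analytic map never leads into S.
   If z tended analytically to a singular point p as t' -> t, with multiplicity
   k, then in a coordinate x with z = p + x^k the identity theorem on a
   punctured disc would continue X, as the velocity k x^(k-1) theta(x), to a
   full punctured neighbourhood.  For k > 1 this velocity is not a function of
   x^k; for k = 1 it continues X to a regular point along a path ending at p,
   which no kind of singularity allows.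

   Two time functions differ locally by a constant, so every path of M \ S
   can be covered from any branch; as M \ S is connected, the branches started
   at z0 lie over all of M \ S, and a translation of time carries the region
   of one initial condition onto that of another. *)

Require Import Defs.
From mathcomp Require Import all_boot all_order all_algebra complex.
From mathcomp Require Import all_classical all_reals all_analysis.
From mathcomp Require Import ring lra.
Import Order.TTheory GRing.Theory Num.Theory numFieldNormedType.Exports.
Set Implicit Arguments.
Unset Strict Implicit.
Unset Printing Implicit Defensive.
Local Open Scope classical_set_scope.
Local Open Scope ring_scope.

(** * Complex differentiation, power series and Cauchy's formula *)

(** Nothing is known about [analytic_at] beyond pointwise convergence of some power series, so its
    calculus is built here: a power series has a complex derivative that is again a power series,
    and a function with a continuous complex derivative is a power series by Cauchy's formula.
    Closure under sums, products, compositions and inverses then reduces to differentiation rules,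
    and existence and uniqueness of trajectories reduce to the inverse function theorem applied to
    [psi]; no theorem on differential equations enters.

    The obstacle in the punctured disc argument is that S need not be discrete: it could a priori
    meet the disc of the coordinate x away from 0, where X is then not known to be analytic.
    Connectedness of the punctured disc is therefore combined with a first exit argument. On a
    segment starting at a good point, the first point that could fail is reached with nonzero
    velocity, hence by a path along which X continues regularly; no kind of singularity allows this,
    so the point is regular, and only then does the identity theorem carry the trajectory equation
    to it. *)

Section Caratheodory.
Variable K : numFieldType.
Implicit Types (f g : K -> K) (z d : K).

(** Carathéodory's form of the derivative: [phi] is the difference quotient completed by [d] at [z].
    The product and chain rules become algebra plus limits, with no division and no punctured
    neighbourhood. *)
Definition cdiff f z d := exists phi : K -> K,
  [/\ phi @ nbhs z --> d, phi z = d & forall w, f w = f z + phi w * (w - z)].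

Lemma cdiff_cont f z d : cdiff f z d -> f @ nbhs z --> f z.
Proof.
move=> [phi [cphi _ fE]].
have -> : f = (fun w => f z + phi w * (w - z)) by exact/funext.
rewrite subrr mulr0 addr0 -[X in _ --> X](addr0 (f z)).
apply: cvgD; first exact: cvg_cst.
rewrite -[X in _ --> X](mulr0 d) -(subrr z).
apply: (cvgM cphi); apply: cvgB; [exact: cvg_id | exact: cvg_cst].
Qed.

Lemma cdiff_cst (c z : K) : cdiff (fun=> c) z 0.
Proof.
by exists (fun=> 0); split => [||w]; [exact: cvg_cst| |rewrite mul0r addr0].
Qed.

Lemma cdiff_id z : cdiff id z 1.
Proof.
by exists (fun=> 1); split => [||w]; [exact: cvg_cst| |rewrite mul1r addrC subrK].
Qed.

Lemma cdiffD f g z df dg : cdiff f z df -> cdiff g z dg ->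
  cdiff (fun w => f w + g w) z (df + dg).
Proof.
move=> [p [cp pz fE]] [q [cq qz gE]]; exists (fun w => p w + q w); split.
- exact: (cvgD cp cq).
- by rewrite pz qz.
- by move=> w; rewrite fE gE; ring.
Qed.

Lemma cdiffM f g z df dg : cdiff f z df -> cdiff g z dg ->
  cdiff (fun w => f w * g w) z (df * g z + f z * dg).
Proof.
move=> hf hg; have cg := cdiff_cont hg; move: hf hg.
move=> [p [cp pz fE]] [q [cq qz gE]].
exists (fun w => p w * g w + f z * q w); split.
- exact: (cvgD (cvgM cp cg) (cvgM (cvg_cst (f z)) cq)).
- by rewrite pz qz.
- move=> w; have qE : q w * (w - z) = g w - g z by rewrite [g w]gE; ring.
  by rewrite [f w]fE [in RHS]mulrDl -(mulrA (f z)) qE; ring.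
Qed.

Lemma cdiffN f z df : cdiff f z df -> cdiff (fun w => - f w) z (- df).
Proof.
move=> [p [cp pz fE]]; exists (fun w => - p w); split.
- exact: (cvgN cp).
- by rewrite pz.
- by move=> w; rewrite fE; ring.
Qed.

Lemma cdiffB f g z df dg : cdiff f z df -> cdiff g z dg ->
  cdiff (fun w => f w - g w) z (df - dg).
Proof. by move=> hf hg; apply: cdiffD => //; exact: cdiffN. Qed.

Lemma cdiffZ (c : K) f z df : cdiff f z df -> cdiff (fun w => c * f w) z (c * df).
Proof.
by move=> hf; have := cdiffM (cdiff_cst c z) hf; rewrite mul0r add0r.
Qed.

Lemma cdiff_comp f g z dg df : cdiff g z dg -> cdiff f (g z) df ->
  cdiff (fun w => f (g w)) z (df * dg).
Proof.
move=> hg; have cg := cdiff_cont hg; move: hg => [q [cq qz gE]] [p [cp pz fE]].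
exists (fun w => p (g w) * q w); split.
- exact: (cvgM (cvg_comp _ _ cg cp) cq).
- by rewrite pz qz.
- by move=> w; rewrite (fE (g w)) [X in (X - g z)](gE w); ring.
Qed.

Lemma cdiffX n z : cdiff (fun w => w ^+ n) z (n%:R * z ^+ n.-1).
Proof.
elim: n => [|n IH]; first by rewrite mul0r; exact: cdiff_cst.
have -> : (fun w : K => w ^+ n.+1) = (fun w => w * w ^+ n).
  by apply/funext => w; rewrite exprS.
have -> : n.+1%:R * z ^+ n = 1 * z ^+ n + z * (n%:R * z ^+ n.-1).
  case: n {IH} => [|n] /=; first by rewrite mul0r mulr0 addr0.
  by rewrite mulrCA -exprS -[X in X%:R * _]addn1 natrD mulrDl addrC.
by apply: cdiffM => //; exact: cdiff_id.
Qed.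

Lemma near_neq (z w0 : K) : z != w0 -> \forall w \near z, w != w0.
Proof.
move=> zw; apply/nbhs_ballP; exists `|z - w0| => /=; first by rewrite normr_gt0 subr_eq0.
move=> w; rewrite /ball /=; apply: contraTneq => ->.
by rewrite ltxx.
Qed.

Lemma cvg_near (F : set_system K) (FF : Filter F) f g l :
  (\forall w \near F, f w = g w) -> f @ F --> (l : K) -> g @ F --> (l : K).
Proof. by move=> fg; apply: cvg_trans; exact: near_eq_cvg. Qed.

Lemma cdiffV z : z != 0 -> cdiff (fun w => w^-1) z (- (z ^+ 2)^-1).
Proof.
(* The convention that the inverse of 0 is 0 forces the value at [w = 0]: the slope identity there
   reads [0 = z^-1 + phi 0 * (0 - z)]. *)
move=> z0; pose phi (w : K) : K := if w == 0 then z^-1 ^+ 2 else - (w * z)^-1.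
exists phi; split.
- rewrite expr2; apply: (@cvg_near _ _ (fun w => - (w * z)^-1)).
    by move: (near_neq z0); apply: filterS => w w0; rewrite /phi (negbTE w0).
  apply: cvgN; apply: cvgV; first by rewrite mulf_neq0.
  by apply: cvgM; [exact: cvg_id|exact: cvg_cst].
- by rewrite /phi (negbTE z0) expr2.
- move=> w; rewrite /phi; have [->|w0] := eqVneq w 0.
    by rewrite invr0; field.
  by field; rewrite w0 z0.
Qed.

(** Only the germ matters although the slope identity is demanded at every [w]: far from [z] the
    quotient of [g] itself serves as slope. *)
Lemma cdiff_near f g z d : (\forall w \near z, f w = g w) -> cdiff f z d -> cdiff g z d.
Proof.
move=> fg; have fgz := nbhs_singleton fg.
move=> [p [cp pz fE]].
pose q w := if w == z then d else (g w - g z) / (w - z).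
exists q; split; last 2 first.
- by rewrite /q eqxx.
- move=> w; rewrite /q; case: eqVneq => [->|wz]; first by rewrite subrr mulr0 addr0.
  by rewrite divfK ?subr_eq0 // addrC subrK.
apply: cvg_near cp; move: fg; apply: filterS => w fgw; rewrite /q; case: eqVneq => [->//|wz].
by rewrite -fgw -fgz [f w]fE addrC addKr mulfK // subr_eq0.
Qed.

(** The link with [derive1], in which the change of coordinates of the vector field is stated; it
    also gives uniqueness of [d]. *)
Lemma cdiff_derive1 f z d : cdiff f z d -> derive1 f z = d.
Proof.
move=> [p [cp pz fE]]; apply: cvg_lim => //.
apply: (@cvg_near _ _ (fun h => p (h + z))).
  apply: filterS (nbhs_dnbhs_neq 0) => h h0.
  by rewrite [f (h + z)]fE [X in X - _]addrC !addrK [X in _ = X]mulrC mulfK.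
apply: cvg_within_filter.
have cz : (fun h : K => h + z) @ nbhs (0 : K) --> z.
  rewrite -[X in _ --> X]add0r; apply: cvgD; [exact: cvg_id|exact: cvg_cst].
exact: (cvg_comp _ _ cz cp).
Qed.

Lemma cdiff_uniq f z d d' : cdiff f z d -> cdiff f z d' -> d = d'.
Proof. by move=> /cdiff_derive1 <- /cdiff_derive1. Qed.

End Caratheodory.

(** * Real and imaginary parts, norms and limits in the plane *)

Section ComplexPlane.
Variable R : realType.
Local Notation C := (cplx R).
Local Notation Re := (@complex.Re R).
Local Notation Im := (@complex.Im R).

Lemma Re_add (x y : C) : Re (x + y) = Re x + Re y.
Proof. by case: x y => a b [c d]. Qed.

Lemma Im_add (x y : C) : Im (x + y) = Im x + Im y.
Proof. by case: x y => a b [c d]. Qed.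

Lemma Re_opp (x : C) : Re (- x) = - Re x.
Proof. by case: x. Qed.

Lemma Im_opp (x : C) : Im (- x) = - Im x.
Proof. by case: x. Qed.

Lemma Re_mul (x y : C) : Re (x * y) = Re x * Re y - Im x * Im y.
Proof. by case: x y => a b [c d]. Qed.

Lemma Im_mul (x y : C) : Im (x * y) = Re x * Im y + Im x * Re y.
Proof. by case: x y => a b [c d]. Qed.

Lemma ReIm_eq (x y : C) : Re x = Re y -> Im x = Im y -> x = y.
Proof. by case: x y => a b [c d] /= -> ->. Qed.

Lemma norm_rc (x : R) : `|x%:C%C : C| = `|x|%:C%C.
Proof.
have -> : `|x%:C%C : C| = (Num.sqrt (x ^+ 2 + 0 ^+ 2))%:C%C by [].
by rewrite expr0n /= addr0 sqrtr_sqr.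
Qed.

Lemma norm_Re (z : C) : `|Re z|%:C%C <= `|z|.
Proof.
case: z => a b /=; have -> : `|(a +i* b)%C : C| = (Num.sqrt (a ^+ 2 + b ^+ 2))%:C%C by [].
by rewrite lecR -sqrtr_sqr ler_wsqrtr // lerDl sqr_ge0.
Qed.

Lemma norm_Im (z : C) : `|Im z|%:C%C <= `|z|.
Proof.
case: z => a b /=; have -> : `|(a +i* b)%C : C| = (Num.sqrt (a ^+ 2 + b ^+ 2))%:C%C by [].
by rewrite lecR -sqrtr_sqr ler_wsqrtr // lerDr sqr_ge0.
Qed.

Lemma normc_le (z : C) : `|z| <= (`|Re z| + `|Im z|)%:C%C.
Proof.
case: z => a b /=; have -> : `|(a +i* b)%C : C| = (Num.sqrt (a ^+ 2 + b ^+ 2))%:C%C by [].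
rewrite lecR -(@ler_pXn2r _ 2) ?nnegrE ?sqrtr_ge0 ?addr_ge0 //.
rewrite sqr_sqrtr ?addr_ge0 ?sqr_ge0 // sqrrD !real_normK ?num_real //.
by rewrite lerD2r lerDl mulrn_wge0 ?mulr_ge0.
Qed.

Lemma gt0_rc (e : C) : 0 < e -> exists2 r : R, 0 < r & e = r%:C%C.
Proof.
case: e => a b; rewrite ltcE /= => /andP[/eqP b0 a0].
by exists a => //; rewrite b0.
Qed.

Lemma ge0_rc (e : C) : 0 <= e -> exists2 r : R, 0 <= r & e = r%:C%C.
Proof.
case: e => a b; rewrite lecE /= => /andP[/eqP b0 a0].
by exists a => //; rewrite b0.
Qed.

Lemma norm_rcE (z : C) : exists2 r : R, 0 <= r & `|z| = r%:C%C.
Proof. exact/ge0_rc/normr_ge0. Qed.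

Lemma cvg_rc T (F : set_system T) (FF : Filter F) (f : T -> R) (l : R) :
  f @ F --> l -> (fun x => (f x)%:C%C : C) @ F --> (l%:C%C : C).
Proof.
move=> fl; apply/cvgrPdist_lt => e /gt0_rc[r r0 ->].
move/cvgrPdist_lt : fl => /(_ r r0); apply: filterS => x.
by rewrite -(@rmorphB _ _ (real_complex R)) norm_rc ltcR.
Qed.

Lemma cvg_Re T (F : set_system T) (FF : Filter F) (f : T -> C) (l : C) :
  f @ F --> l -> (fun x => Re (f x)) @ F --> Re l.
Proof.
move=> fl; apply/cvgrPdist_lt => e e0.
move/cvgrPdist_lt : fl => /(_ (e%:C%C)); rewrite ltcR => /(_ e0).
apply: filterS => x; rewrite -ltcR -Re_opp -Re_add; apply: le_lt_trans.
exact: norm_Re.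
Qed.

Lemma cvg_Im T (F : set_system T) (FF : Filter F) (f : T -> C) (l : C) :
  f @ F --> l -> (fun x => Im (f x)) @ F --> Im l.
Proof.
move=> fl; apply/cvgrPdist_lt => e e0.
move/cvgrPdist_lt : fl => /(_ (e%:C%C)); rewrite ltcR => /(_ e0).
apply: filterS => x; rewrite -ltcR -Im_opp -Im_add; apply: le_lt_trans.
exact: norm_Im.
Qed.

Lemma cvg_ReIm T (F : set_system T) (FF : Filter F) (f : T -> C) (l : C) :
  (fun x => Re (f x)) @ F --> Re l -> (fun x => Im (f x)) @ F --> Im l ->
  f @ F --> l.
Proof.
move=> fr fi.
have -> : f = (fun x => (Re (f x))%:C%C + 'i%C * (Im (f x))%:C%C).
  by apply/funext => x; rewrite -complexE.
rewrite (complexE l); apply: cvgD; first exact: cvg_rc.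
by apply: cvgM; [exact: cvg_cst | exact: cvg_rc].
Qed.

End ComplexPlane.

(* A field complete for an absolute value N, through which all estimates go:
   the norm of R[i] is itself complex valued. *)
Record complete_abs (R : realType) (K : numFieldType) (N : K -> R) : Prop := {
  abs_ge0 : forall x, 0 <= N x;
  abs_eq0 : forall x, N x = 0 -> x = 0;
  absM : forall x y, N (x * y) = N x * N y;
  absD : forall x y, N (x + y) <= N x + N y;
  abs_nat : forall n, N n%:R = n%:R;
  abs_near : forall (z : K) (P : K -> Prop), (\forall w \near nbhs z, P w) <->
    exists2 e, 0 < e & forall w, N (w - z) < e -> P w;
  abs_complete : forall (u : nat -> K) M q, 0 <= q < 1 ->
    (forall n, N (u n) <= M * q ^+ n) -> exists l : K, series u @ \oo --> l }.

(** * Power series over a field complete for an absolute value *)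

Section PowerSeries.
Variables (R : realType) (K : numFieldType) (N : K -> R).
Hypothesis hN : complete_abs N.
Implicit Types (x y z w h : K) (c : nat -> K) (f g : K -> K).
Let N_ge0 := abs_ge0 hN.
Let NM := absM hN.
Let ND := absD hN.

Lemma abs1 : N 1 = 1.
Proof. exact: (abs_nat hN 1). Qed.

Lemma abs0 : N 0 = 0.
Proof. exact: (abs_nat hN 0). Qed.

Lemma absN x : N (- x) = N x.
Proof.
rewrite -mulN1r NM; have : N (-1) * N (-1) = 1 by rewrite -NM mulrNN mul1r abs1.
move=> /eqP; rewrite -expr2 sqrf_eq1 => /orP[/eqP->|/eqP H]; first by rewrite mul1r.
by have := N_ge0 (-1); rewrite H oppr_ge0 ler10.
Qed.

Lemma absB x y : N (x - y) <= N x + N y.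
Proof. by rewrite -(absN y); exact: ND. Qed.

Lemma absC x y : N (x - y) = N (y - x).
Proof. by rewrite -absN opprB. Qed.

Lemma absX x n : N (x ^+ n) = N x ^+ n.
Proof. by elim: n => [|n IH]; rewrite ?expr0 ?abs1 // !exprS NM IH. Qed.

Lemma abs_gt0 x : x != 0 -> 0 < N x.
Proof.
by move=> x0; rewrite lt_neqAle N_ge0 eq_sym andbT; apply: contra x0 => /eqP /(abs_eq0 hN) ->.
Qed.

Lemma absV x : x != 0 -> N x^-1 = (N x)^-1.
Proof.
move=> x0; have Nx := abs_gt0 x0; apply: (mulfI (lt0r_neq0 Nx)).
by rewrite -NM mulfV // abs1 mulfV // lt0r_neq0.
Qed.

Lemma abs_cvg (u : nat -> K) l :
  u @ \oo --> l <-> forall e, 0 < e -> \forall n \near \oo, N (u n - l) < e.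
Proof.
split=> [ul e e0|H P].
  by apply: (ul [set w | N (w - l) < e]); apply/(abs_near hN); exists e.
rewrite -[nbhs l P]/(\forall w \near nbhs l, P w) => /(abs_near hN)[e e0 eP].
by apply: filterS (H e e0) => n; exact: eP.
Qed.

Lemma abs_cvg_shift k (u : nat -> K) (l : K) :
  u @ \oo --> l -> (fun n => u (n + k)%N) @ \oo --> l.
Proof.
move=> /abs_cvg H; apply/abs_cvg => e /H[m _ Hm]; exists m => // n mn.
exact/Hm/leq_trans/leq_addr.
Qed.

Lemma abs_cont f z l :
  f @ nbhs z --> l <-> forall e, 0 < e -> exists2 d, 0 < d &
    forall w, N (w - z) < d -> N (f w - l) < e.
Proof.
split=> [ul e e0|H P].
  by apply/(abs_near hN); apply: (ul [set w | N (w - l) < e]); apply/(abs_near hN); exists e.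
rewrite -[nbhs l P]/(\forall w \near nbhs l, P w) => /(abs_near hN)[e e0 eP].
apply/(abs_near hN); have [d d0 dP] := H e e0.
by exists d => // w /dP; exact: eP.
Qed.

Lemma geo_sum_le (q : R) n : 0 <= q < 1 -> \sum_(0 <= i < n) q ^+ i <= (1 - q)^-1.
Proof.
move=> /andP[q0 q1]; have q1' : 0 < 1 - q by rewrite subr_gt0.
rewrite -(ler_pM2l q1') mulfV ?lt0r_neq0 // -opprB mulNr big_mkord -subrX1 opprB.
by rewrite lerBlDr lerDl exprn_ge0.
Qed.

Lemma abs_series (u : nat -> K) M q n : 0 <= q < 1 ->
  (forall n, N (u n) <= M * q ^+ n) -> N (series u n) <= M / (1 - q).
Proof.
move=> q01 H; apply: (@le_trans _ _ (\sum_(0 <= i < n) M * q ^+ i)).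
  rewrite /series /=; elim: n => [|n IH]; first by rewrite !big_geq // abs0.
  by rewrite !big_nat_recr //= (le_trans (ND _ _)) // lerD.
rewrite -big_distrr /= ler_wpM2l ?geo_sum_le //.
by have := le_trans (N_ge0 _) (H 0%N); rewrite expr0 mulr1.
Qed.

Lemma abs_lim_le (u : nat -> K) l B :
  (forall n, N (u n) <= B) -> u @ \oo --> l -> N l <= B.
Proof.
move=> H /abs_cvg ul; rewrite leNgt; apply/negP => Bl.
have /ul : 0 < N l - B by rewrite subr_gt0.
case=> m _ /(_ m (leqnn m)) /= Hm.
have := absB (u m) (u m - l); rewrite opprB addrC subrK => Hl.
by have := H m; lra.
Qed.

Lemma expr_small (q e : R) : 0 <= q < 1 -> 0 < e -> exists n, q ^+ n < e.
Proof.
move=> /andP[q0 q1] e0; have : `|q| < 1 by rewrite ger0_norm.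
move=> /cvg_expr /cvgrPdist_lt /(_ e e0)[n _ /(_ n (leqnn n))] /=.
by rewrite sub0r normrN ger0_norm ?exprn_ge0 // => H; exists n.
Qed.

Definition psum c h (l : K) := series (fun n => c n * h ^+ n) @ \oo --> l.
(** Cauchy bounds on the coefficients; they put the radius of convergence at [1 / q] or more. *)
Definition geo_bound c M (q : R) := [/\ 0 <= M, 0 < q & forall n, N (c n) <= M * q ^+ n].
Definition geo c := exists M q, geo_bound c M q.

Lemma psum_uniq c h l l' : psum c h l -> psum c h l' -> l = l'.
Proof.
move=> /abs_cvg H /abs_cvg H'; apply/eqP; rewrite -subr_eq0; apply/negPn/negP => ll.
have e0 : 0 < N (l - l') / 2 by rewrite divr_gt0 // abs_gt0.
have [m _ Hm] := filterI (H _ e0) (H' _ e0).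
have [/= H1 H2] := Hm m (leqnn m).
set s := series _ m in H1 H2.
have := absB (s - l') (s - l); have -> : s - l' - (s - l) = l - l' by ring.
lra.
Qed.

Lemma psum0 c : psum c 0 (c 0%N).
Proof.
apply/abs_cvg => e e0; exists 1%N => // n /= n0.
rewrite /series /= big_ltn // expr0 mulr1 big1_seq ?addr0 ?subrr ?abs0 //.
by move=> i; rewrite mem_index_iota => /andP[_ /andP[i0 _]]; rewrite expr0n gtn_eqF // mulr0.
Qed.

(** Abel's observation: the terms of a convergent series are bounded, so convergence at a single
    nonzero [h] bounds the coefficients with ratio [1 / N h]. *)
Lemma psum_geo c h l : h != 0 -> psum c h l -> geo c.
Proof.
move=> h0 H.
have H0 : \forall n \near \oo, N (c n * h ^+ n) < 1.
  move/abs_cvg : H => /(_ (2^-1)); rewrite invr_gt0 ltr0n => /(_ isT)[m _ Hm].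
  exists m => // n /= mn; have /= H1 := Hm n mn; have /= H2 := Hm n.+1 (leqW mn).
  have -> : c n * h ^+ n = (series (fun n => c n * h ^+ n) n.+1 - l) - (series (fun n => c n * h ^+ n) n - l).
    by rewrite /series /= big_nat_recr //=; ring.
  apply: le_lt_trans (absB _ _) _; lra.
have [m _ Hm] := H0.
(* The terms from [m] on are below 1; the finitely many earlier ones are absorbed by their sum. *)
pose M := 1 + \sum_(0 <= i < m) N (c i * h ^+ i).
have sum0 k : 0 <= \sum_(0 <= i < k) N (c i * h ^+ i) by apply: sumr_ge0.
exists M, (N h)^-1; split; rewrite ?invr_gt0 ?abs_gt0 //.
  by rewrite /M addr_ge0.
move=> n; rewrite exprVn -(ler_pM2r (exprn_gt0 n (abs_gt0 h0))) mulfVK; last first.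
  by rewrite expf_neq0 // lt0r_neq0 // abs_gt0.
rewrite -absX -NM; case: (leqP m n) => mn.
  by apply: le_trans (ltW (Hm n mn)) _; rewrite /M lerDl.
rewrite /M (@big_cat_nat _ _ _ n.+1) //= big_nat_recr //=.
have := sum0 n; have : 0 <= \sum_(n.+1 <= i < m) N (c i * h ^+ i) by apply: sumr_ge0.
lra.
Qed.

(** Half the guaranteed radius is used, so that the dominating geometric series always has ratio
    1/2. *)
Lemma geo_psum c M q h : geo_bound c M q -> N h * (2 * q) <= 1 -> exists l, psum c h l.
Proof.
move=> [M0 q0 H] hq.
have h2 : 0 <= (2^-1 : R) < 1 by apply/andP; split; lra.
apply: (abs_complete hN (M := M) h2) => n.
rewrite NM absX (le_trans (ler_wpM2r _ (H n))) ?exprn_ge0 //.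
rewrite -mulrA -exprMn ler_wpM2l // lerXn2r ?nnegrE ?mulr_ge0 //; first exact: ltW.
by lra.
Qed.

(** The second order divided difference of the monomial of degree n:
    [w ^+ n - h ^+ n - n h^(n-1) (w - h)] divided by [(w - h) ^+ 2], written as a polynomial so that
    [w = h] is allowed. *)
Fixpoint taylor2 w h n : K :=
  if n is m.+1 then m%:R * h ^+ m.-1 + w * taylor2 w h m else 0.

Lemma taylor2E w h n :
  w ^+ n - h ^+ n = (w - h) * (n%:R * h ^+ n.-1 + (w - h) * taylor2 w h n).
Proof.
elim: n => [|n IH] /=; first by rewrite !expr0 subrr mul0r mulr0 addr0 mulr0.
have -> : w ^+ n.+1 - h ^+ n.+1 = w * (w ^+ n - h ^+ n) + (w - h) * h ^+ n.
  by rewrite !exprS; ring.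
rewrite IH; case: n {IH} => [|n] /=; first by rewrite expr0; ring.
by rewrite !exprS -[n.+2%:R]natr1; ring.
Qed.

(** [taylor2 w h n] has degree n - 2 and coefficients of sum n (n - 1) / 2. The factor [r ^+ 2]
    stands on the left to avoid the exponent n - 2. *)
Lemma taylor2_le w h n r : N w <= r -> N h <= r ->
  N (taylor2 w h n) * r ^+ 2 <= n%:R ^+ 2 * r ^+ n.
Proof.
move=> wr hr; have r0 : 0 <= r := le_trans (N_ge0 _) wr.
elim: n => [|n IH] /=; first by rewrite abs0 expr0n !mul0r.
have step : N (n%:R * h ^+ n.-1) * r ^+ 2 <= n%:R * r ^+ n.+1.
  case: n {IH} => [|n] /=; first by rewrite mul0r abs0 !mul0r.
  rewrite NM (abs_nat hN) absX -mulrA ler_wpM2l // -[n.+2]addn2 exprD.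
  apply: ler_wpM2r; first exact: exprn_ge0.
  by apply: lerXn2r; rewrite ?nnegrE ?N_ge0.
have step2 : N (w * taylor2 w h n) * r ^+ 2 <= n%:R ^+ 2 * r ^+ n.+1.
  rewrite NM -mulrA [r ^+ n.+1]exprS [X in _ <= X]mulrCA.
  apply: le_trans (ler_wpM2r _ wr) _; first by rewrite mulr_ge0 ?N_ge0 ?exprn_ge0.
  exact: ler_wpM2l.
apply: (@le_trans _ _ (n%:R * r ^+ n.+1 + n%:R ^+ 2 * r ^+ n.+1)).
  apply: le_trans (lerD step step2); rewrite -mulrDl ler_wpM2r ?exprn_ge0 //.
rewrite -mulrDl ler_wpM2r ?exprn_ge0 // -[n.+1%:R]natr1.
by have := ler0n R n; nra.
Qed.

Lemma nat_le_exp2 n : n%:R <= 2 ^+ n :> R.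
Proof. by rewrite -natrX ler_nat ltnW // ltn_expl. Qed.

Definition dcoef c : nat -> K := fun n => n.+1%:R * c n.+1.

(** The factor n + 1 is at most 2^n, which doubling [q] absorbs. *)
Lemma geo_dcoef c M q : geo_bound c M q -> geo_bound (dcoef c) (M * q) (2 * q).
Proof.
move=> [M0 q0 H]; split => [||n]; [by rewrite mulr_ge0 // ltW|by rewrite mulr_gt0|].
rewrite /dcoef NM (abs_nat hN) exprMn mulrCA.
apply: ler_pM; rewrite ?N_ge0 //; first by rewrite -natrX ler_nat ltn_expl.
by rewrite -mulrA -exprS; exact: H.
Qed.

(** A quadratic remainder uniform in both points, so that differentiability follows at every [h] of
    a disc and not just at the centre. With [r = 1 / (8 q)], the bound n^2 <= 4^n leaves terms of
    ratio [4 q r = 1/2]. *)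
Lemma psum_taylor c M q : geo_bound c M q -> exists2 B, 0 <= B &
  forall w h fw fh d, N w * (8 * q) <= 1 -> N h * (8 * q) <= 1 ->
    psum c w fw -> psum c h fh -> psum (dcoef c) h d ->
    N (fw - fh - d * (w - h)) <= B * N (w - h) ^+ 2.
Proof.
move=> [M0 q0 H]; pose r := (8 * q)^-1.
have r0 : 0 < r by rewrite invr_gt0 mulr_gt0.
have r20 : 0 < r ^+ 2 by rewrite exprn_gt0.
exists (2 * M / r ^+ 2); first by rewrite !mulr_ge0 // ltW // invr_gt0.
move=> w h fw fh d wr hr Hw Hh Hd.
have {}wr : N w <= r by rewrite /r -[X in _ <= X]mul1r ler_pdivlMr // mulr_gt0.
have {}hr : N h <= r by rewrite /r -[X in _ <= X]mul1r ler_pdivlMr // mulr_gt0.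
have h2 : 0 <= (2^-1 : R) < 1 by apply/andP; split; lra.
have Hb n : N (c n * taylor2 w h n) <= M / r ^+ 2 * 2^-1 ^+ n.
  rewrite NM mulrAC ler_pdivlMr // -mulrA.
  apply: le_trans (ler_wpM2l (N_ge0 _) (taylor2_le n wr hr)) _.
  apply: le_trans (ler_wpM2r _ (H n)) _; first by rewrite mulr_ge0 ?exprn_ge0 // ltW.
  rewrite -mulrA ler_wpM2l //.
  have -> : (2^-1 : R) = q * 4 * r by rewrite /r; field; exact: lt0r_neq0.
  have [q0' r0'] := (ltW q0, ltW r0).
  rewrite !exprMn -!mulrA; apply: ler_wpM2l; first exact: exprn_ge0.
  rewrite mulrA; apply: ler_wpM2r; first exact: exprn_ge0.
  have -> : (4 : R) = 2 * 2 by ring.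
  by rewrite exprMn ler_pM // nat_le_exp2.
(* The two sums of [c] have one term more than that of [dcoef c], since differentiation drops the
   constant term; with this offset the partial sums satisfy the Taylor identity exactly. *)
apply: (@abs_lim_le (fun n => series (fun n => c n * w ^+ n) n.+1 -
  series (fun n => c n * h ^+ n) n.+1 -
  series (fun n => dcoef c n * h ^+ n) n * (w - h))) => [n|].
  have -> : series (fun n => c n * w ^+ n) n.+1 -
    series (fun n => c n * h ^+ n) n.+1 - series (fun n => dcoef c n * h ^+ n) n * (w - h)
    = (w - h) ^+ 2 * series (fun n => c n * taylor2 w h n) n.+1.
    rewrite /series /= -sumrB /= (big_nat_recl n 0) //= !expr0 subrr add0r.
    rewrite [in RHS]big_nat_recl //= mulr0 add0r mulr_sumr mulr_suml -sumrB.
    apply: eq_bigr => i _; rewrite -mulrBr taylor2E /= /dcoef.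
    by ring.
  rewrite NM absX mulrC ler_wpM2r ?exprn_ge0 ?N_ge0 //.
  apply: le_trans (abs_series n.+1 h2 Hb) _.
  have -> : 1 - 2^-1 = 2^-1 :> R by field.
  by rewrite invrK mulrC mulrA.
apply: cvgB; first apply: cvgB.
- by have := @abs_cvg_shift 1 _ _ Hw; under eq_fun do rewrite addn1.
- by have := @abs_cvg_shift 1 _ _ Hh; under eq_fun do rewrite addn1.
- by apply: cvgM => //; exact: cvg_cst.
Qed.

(** Over [cplx R] this is [analytic_at] by conversion. *)
Definition power_series_at f (a : K) :=
  exists c : nat -> K, \forall z \near nbhs a, psum c (z - a) (f z).

Lemma small_elt e : 0 < e -> exists2 h : K, h != 0 & N h < e.
Proof.
move=> e0; have h2 : 0 <= (2^-1 : R) < 1 by apply/andP; split; lra.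
have [n Hn] := expr_small h2 e0.
have n0 : (2 ^ n)%:R != 0 :> K by rewrite pnatr_eq0 expn_eq0.
exists (2 ^ n)%:R^-1; first by rewrite invr_neq0.
by rewrite absV // (abs_nat hN) natrX -exprVn.
Qed.

Lemma power_series_geo f (a : K) : power_series_at f a -> exists c M q,
  geo_bound c M q /\ \forall z \near nbhs a, psum c (z - a) (f z).
Proof.
move=> [c H]; exists c; have /(abs_near hN)[e e0 eP] := H.
have [h h0 he] := small_elt e0.
have := eP (h + a); rewrite addrK => /(_ he) /(psum_geo h0)[M [q Mq]].
by exists M, q.
Qed.

Lemma psum_fun c : exists F : K -> K, forall h, (exists l, psum c h l) -> psum c h (F h).
Proof.
have /choice[F FP] : forall h, exists l, (exists l, psum c h l) -> psum c h l.
  move=> h; have [[l Hl]|H] := pselect (exists l, psum c h l); first by exists l.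
  by exists 0 => /H.
by exists F.
Qed.

Lemma power_series_of_geo c M q (a : K) F : geo_bound c M q ->
  (forall h, (exists l, psum c h l) -> psum c h (F h)) ->
  power_series_at (fun z => F (z - a)) a.
Proof.
move=> Hc HF; exists c; apply/(abs_near hN); exists (2 * q)^-1.
  by case: Hc => _ q0 _; rewrite invr_gt0 mulr_gt0.
move=> w wa; apply/HF/(geo_psum Hc); case: Hc => _ q0 _.
by rewrite -ler_pdivlMr ?mulr_gt0 // mul1r ltW.
Qed.

Lemma power_series_taylor f (a : K) : power_series_at f a ->
  exists f' B e, [/\ power_series_at f' a, 0 <= B, 0 < e & forall w h,
    N (w - a) < e -> N (h - a) < e ->
    N (f w - f h - f' h * (w - h)) <= B * N (w - h) ^+ 2].
Proof.
move=> /power_series_geo[c [M [q [Hc /(abs_near hN)[e e0 eP]]]]].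
have [F HF] := psum_fun (dcoef c); have Hd := geo_dcoef Hc.
have [B B0 HB] := psum_taylor Hc; have [_ q0 _] := Hc.
exists (fun z => F (z - a)), B, (Num.min e (8 * q)^-1); split => //.
- exact: power_series_of_geo Hd HF.
- by rewrite lt_min e0 invr_gt0 mulr_gt0.
move=> w h; rewrite !lt_min => /andP[we wq] /andP[he hq].
have -> : w - h = (w - a) - (h - a) by ring.
have q8 : 0 < 8 * q by rewrite mulr_gt0.
have wq1 : N (w - a) * (8 * q) <= 1 by rewrite -ler_pdivlMr // mul1r ltW.
have hq1 : N (h - a) * (8 * q) <= 1 by rewrite -ler_pdivlMr // mul1r ltW.
apply: HB => //; [exact: eP|exact: eP|].
by apply/HF/(geo_psum Hd); have := N_ge0 (h - a); lra.
Qed.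

Lemma taylor_cdiff f (h d : K) B e : 0 < e -> (forall w, N (w - h) < e ->
  N (f w - f h - d * (w - h)) <= B * N (w - h) ^+ 2) -> cdiff f h d.
Proof.
move=> e0 H.
have B0 : 0 <= B.
  have [k k0 ke] := small_elt e0; have /= := H (k + h); rewrite addrK => /(_ ke) H1.
  have := le_trans (N_ge0 _) H1; rewrite pmulr_lge0 // exprn_gt0 //; exact: abs_gt0.
pose phi w := if w == h then d else (f w - f h) / (w - h).
exists phi; split; last 2 first.
- by rewrite /phi eqxx.
- move=> w; rewrite /phi; case: eqVneq => [->|wh]; first by rewrite subrr mulr0 addr0.
  by rewrite divfK ?subr_eq0 // addrC subrK.
apply/abs_cont => r r0.
exists (Num.min e (r / (B + 1))); first by rewrite lt_min e0 divr_gt0 // ltr_wpDl.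
move=> w; rewrite lt_min => /andP[we wr]; rewrite /phi; case: eqVneq => [_|wh].
  by rewrite subrr abs0.
have wh0 : w - h != 0 by rewrite subr_eq0.
have Nwh := abs_gt0 wh0; rewrite -(ltr_pM2r Nwh) -NM mulrBl divfK //.
apply: le_lt_trans (H _ we) _; rewrite expr2 mulrA ltr_pM2r //.
move: wr; rewrite ltr_pdivlMr ?ltr_wpDl //.
lra.
Qed.

Lemma power_series_cdiff f (a : K) : power_series_at f a ->
  exists2 f', power_series_at f' a & \forall z \near nbhs a, cdiff f z (f' z).
Proof.
move=> /power_series_taylor[f' [B [e [Hf' B0 e0 H]]]]; exists f' => //.
apply/(abs_near hN); exists e => // w we.
apply: (@taylor_cdiff _ _ _ B (e - N (w - a))); first by rewrite subr_gt0.
move=> z zw; apply: H => //.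
have -> : z - a = (z - w) + (w - a) by ring.
by apply: le_lt_trans (ND _ _) _; lra.
Qed.

Lemma power_series_prim f (a : K) : power_series_at f a ->
  exists F, \forall z \near nbhs a, cdiff F z (f z).
Proof.
move=> /power_series_geo[c [M [q [Hc H]]]].
(* The termwise antiderivative, normalised by constant term 0. *)
pose b n : K := if n is m.+1 then c m / m.+1%:R else 0.
have Db : dcoef b = c.
  by apply/funext => n; rewrite /dcoef /= mulrC divfK // pnatr_eq0.
have [M0 q0 Hq] := Hc.
have Hb : geo_bound b (M / q) q.
  split => //; first by rewrite divr_ge0 // ltW.
  case=> [|n] /=; first by rewrite abs0 mulr_ge0 ?exprn_ge0 ?divr_ge0 // ltW.
  have n0 : n.+1%:R != 0 :> K by rewrite pnatr_eq0.
  rewrite NM absV // (abs_nat hN) ler_pdivrMr ?ltr0n // exprS mulrA divfK ?lt0r_neq0 //.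
  apply: le_trans (Hq n) _; rewrite ler_peMr ?ler1n // mulr_ge0 ?exprn_ge0 //.
  exact: ltW.
have [F HF] := psum_fun b; exists (fun z => F (z - a)).
have [B B0 HB] := psum_taylor Hb; rewrite Db in HB.
move: H => /(abs_near hN)[e e0 eP].
(* With [w] within [1 / (16 q)] of [a] and [z] within [1 / (16 q)] of [w], both lie in the disc of
   radius [1 / (8 q)] where the remainder estimate holds. *)
apply/(abs_near hN); exists (Num.min e (16 * q)^-1); first by rewrite lt_min e0 invr_gt0 mulr_gt0.
move=> w; rewrite lt_min => /andP[we wq].
have wq1 : N (w - a) * (16 * q) <= 1 by rewrite -ler_pdivlMr ?mulr_gt0 // mul1r ltW.
apply: (@taylor_cdiff _ _ _ B (16 * q)^-1); first by rewrite invr_gt0 mulr_gt0.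
move=> z zw.
have zw1 : N (z - w) * (16 * q) <= 1 by rewrite -ler_pdivlMr ?mulr_gt0 // mul1r ltW.
have za : N (z - a) <= N (z - w) + N (w - a).
  by have -> : z - a = (z - w) + (w - a) by ring.
have E : z - w = (z - a) - (w - a) by ring.
have := @HB (z - a) (w - a) (F (z - a)) (F (w - a)) (f w); rewrite -E; apply.
- by have := N_ge0 (z - a); nra.
- by have := N_ge0 (w - a); nra.
- by apply/HF/(geo_psum Hb); have := N_ge0 (z - a); nra.
- by apply/HF/(geo_psum Hb); have := N_ge0 (w - a); nra.
- exact: eP.
Qed.

Lemma psum_shift c k h l : h != 0 -> (forall i, (i < k)%N -> c i = 0) ->
  psum c h l -> psum (fun n => c (n + k)%N) h (l / h ^+ k).
Proof.
move=> h0 Hk H; have hk : h ^+ k != 0 by rewrite expf_neq0.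
have E : series (fun n => c (n + k)%N * h ^+ n) =
         (fun n => series (fun n => c n * h ^+ n) (n + k)%N / h ^+ k).
  apply/funext => n; rewrite /series /= [in RHS](@big_cat_nat _ _ _ k) ?leq_addl //=.
  rewrite [X in (X + _) / _]big1_seq ?add0r; last first.
    by move=> i; rewrite mem_index_iota => /andP[_ /andP[_ /Hk ->]]; rewrite mul0r.
  have -> : \sum_(k <= i < n + k) c i * h ^+ i = \sum_(0 <= i < n) c (i + k)%N * h ^+ (i + k).
    by rewrite -{1}[k]add0n big_addn addnK.
  rewrite mulr_suml; apply: eq_bigr => i _.
  by rewrite exprD mulrA mulfK.
rewrite /psum E; apply: cvgM; last exact: cvg_cst.
exact: abs_cvg_shift H.
Qed.

(** [k] is the index of the first nonzero coefficient. The point [z = a] is treated apart in the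
    proof, because shifting the series divides by a power of [z - a]. *)
Lemma power_series_order f (a : K) : power_series_at f a ->
  (\forall z \near nbhs a, f z = 0) \/
  exists k u, [/\ power_series_at u a, u a != 0 &
    \forall z \near nbhs a, f z = (z - a) ^+ k * u z].
Proof.
move=> /power_series_geo[c [M [q [Hc H]]]].
have [c0|/existsNP[n0 /eqP cn0]] := pselect (forall n, c n = 0).
  left; apply: filterS H => z Hz; apply: psum_uniq Hz _.
  apply/abs_cvg => e e0; exists 0%N => // n _ /=.
  by rewrite /series /= big1 ?subrr ?abs0 // => i _; rewrite c0 mul0r.
right; have ex : exists n, c n != 0 by exists n0.
case: (ex_minnP ex) => k ck kmin; have [M0 q0 Hq] := Hc.
have cS i : (i < k)%N -> c i = 0.
  by move=> ik; apply/eqP; apply: contraTT ik => /kmin; rewrite leqNgt.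
pose b n := c (n + k)%N.
have Hb : geo_bound b (M * q ^+ k) q.
  split => // [|n]; first by rewrite mulr_ge0 // exprn_ge0 // ltW.
  by rewrite -mulrA -exprD addnC; exact: Hq.
have [F HF] := psum_fun b.
have F0 : F 0 = c k.
  exact: psum_uniq (HF 0 (ex_intro _ (b 0%N) (@psum0 b))) (@psum0 b).
exists k, (fun z => F (z - a)); split.
- exact: power_series_of_geo Hb HF.
- by rewrite subrr F0.
apply: filterS H => z; have [->|za] := eqVneq z a.
  rewrite subrr => Hz; have -> : f a = c 0%N by apply: psum_uniq Hz (@psum0 c).
  rewrite F0; case: k ck {kmin b Hb HF F0} cS => [|k] ck cS; first by rewrite mul1r.
  by rewrite expr0n mul0r cS.
have za0 : z - a != 0 by rewrite subr_eq0.
move=> /(psum_shift za0 cS) Hz; rewrite -(psum_uniq Hz (HF _ _)); last by exists (f z / (z - a) ^+ k).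
by rewrite mulrC divfK // expf_neq0.
Qed.

Lemma power_series_cont f (a : K) : power_series_at f a -> f @ nbhs a --> f a.
Proof. by move=> /power_series_cdiff[f' _ /nbhs_singleton /cdiff_cont]. Qed.

Lemma near_close (a : K) (P : K -> Prop) : (\forall z \near nbhs a, P z) ->
  exists2 e, 0 < e & forall w, N (w - a) < e -> P w.
Proof. by move/(abs_near hN). Qed.

(* Newton's iteration with frozen slope. *)
Lemma power_series_inverse f (a : K) f' : power_series_at f a ->
  (\forall z \near nbhs a, cdiff f z (f' z)) -> power_series_at f' a -> f' a != 0 ->
  exists g : K -> K, [/\ g (f a) = a, g @ nbhs (f a) --> a,
    \forall y \near nbhs (f a), f (g y) = y /\ cdiff g y (f' (g y))^-1 &
    \forall z \near nbhs a, g (f z) = z].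
Proof.
move=> Hf Hf' Hf'' d0; set d := f' a.
have [f1 [B [e1 [Hf1 B0 e10 HB]]]] := power_series_taylor Hf.
have Nd : 0 < N d by exact: abs_gt0.
have E1 : f1 a = d.
  apply: (@cdiff_uniq _ f a); last exact: nbhs_singleton Hf'.
  by apply: (taylor_cdiff e10) => w we; apply: HB => //; rewrite subrr abs0.
have /abs_cont := power_series_cont Hf1; rewrite E1 => /(_ (N d / 4)).
rewrite divr_gt0 // => /(_ isT)[e2 e20 He2].
have /abs_cont := power_series_cont Hf''; rewrite -/d => /(_ (N d / 4)).
rewrite divr_gt0 // => /(_ isT)[e3 e30 He3].
have [e4 e40 He4] := near_close Hf'.
have [e5 e50 He5] : exists2 e5, 0 < e5 & 8 * B * e5 <= N d.
  have B1 : 0 < 8 * (B + 1) by rewrite mulr_gt0 // ltr_wpDl.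
  exists (N d / (8 * (B + 1))); first by rewrite divr_gt0.
  rewrite mulrA ler_pdivrMr //; nra.
have [e e0 He] : exists2 e, 0 < e & [/\ e <= e1, e <= e2, e <= e3, e <= e4 & e <= e5].
  exists (Num.min (Num.min e1 e2) (Num.min e3 (Num.min e4 e5))).
    by rewrite !lt_min e10 e20 e30 e40 e50.
  by split; rewrite !ge_min lexx ?orbT.
move: He => [le1 le2 le3 le4 le5].
(* On the ball of radius [e], [f] differs from a linear map of slope [d] by at most half that slope:
   one quarter comes from the quadratic remainder and one quarter from the variation of the
   derivative. Injectivity and the contraction ratio 1/2 both follow. *)
have key w h : N (w - a) < e -> N (h - a) < e ->
    N (f w - f h - d * (w - h)) <= N d / 2 * N (w - h).
  move=> we he.
  have -> : f w - f h - d * (w - h) = (f w - f h - f1 h * (w - h)) + (f1 h - d) * (w - h) by ring.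
  apply: le_trans (ND _ _) _; rewrite NM.
  have H1 := HB w h (lt_le_trans we le1) (lt_le_trans he le1).
  have H2 := He2 h (lt_le_trans he le2).
  have H3 : N (w - h) <= N (w - a) + N (h - a).
    by rewrite (_ : w - h = (w - a) - (h - a)); [exact: absB|ring].
  have H4 := N_ge0 (w - h).
  have H5 : B * N (w - h) ^+ 2 <= N d / 4 * N (w - h).
    rewrite expr2 mulrA; apply: ler_wpM2r => //.
    have : B * N (w - h) <= B * (2 * e5) by apply: ler_wpM2l => //; lra.
    lra.
  have H6 : N (f1 h - d) * N (w - h) <= N d / 4 * N (w - h) by rewrite ler_wpM2r // ltW.
  lra.
have inj w h : N (w - a) < e -> N (h - a) < e -> N d / 2 * N (w - h) <= N (f w - f h).
  move=> we he; have := key w h we he => H1.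
  have := absB (f w - f h) (f w - f h - d * (w - h)).
  have -> : f w - f h - (f w - f h - d * (w - h)) = d * (w - h) by ring.
  by rewrite NM; lra.
(* Since the error halves at each step, the iterates move by at most [2 * N (y - f a) / N d] in all,
   which is below [e / 2] for such [y]; they never leave the ball. *)
pose r := N d * e / 4.
have r0 : 0 < r by rewrite divr_gt0 // mulr_gt0.
have sur y : N (y - f a) < r -> exists2 z, N (z - a) < e & f z = y.
  move=> yr; pose F z := z - (f z - y) / d.
  pose z n := iter n F a.
  have dz : d != 0 by [].
  have zS n : N (z n.+1 - z n) = N (f (z n) - y) / N d.
    rewrite /z /= /F; have -> : forall p q : K, p - q - p = - q by move=> p q; ring.
    by rewrite absN NM absV.
  have bnd n : 2 * N (y - f a) / N d * (1 - 2^-1 ^+ n) < e.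
    apply: (@le_lt_trans _ _ (2 * N (y - f a) / N d)).
      have : 0 <= 2^-1 ^+ n :> R by rewrite exprn_ge0 // invr_ge0.
      have : 0 <= 2 * N (y - f a) / N d by rewrite divr_ge0 ?mulr_ge0.
      nra.
    by rewrite ltr_pdivrMr //; move: yr; rewrite /r; nra.
  have zb n : N (z n - a) < e /\ N (f (z n) - y) <= N (y - f a) * 2^-1 ^+ n.
    suff : N (z n - a) <= 2 * N (y - f a) / N d * (1 - 2^-1 ^+ n) /\
        N (f (z n) - y) <= N (y - f a) * 2^-1 ^+ n.
      move=> [H1 H2]; split => //; exact: le_lt_trans H1 (bnd n).
    elim: n => [|n [IH1 IH2]].
      by rewrite subrr abs0 expr0 mulr1 subrr mulr0 absC.
    have zne : N (z n - a) < e.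
      exact: le_lt_trans IH1 (bnd n).
    have step : N (z n.+1 - z n) <= N (y - f a) / N d * 2^-1 ^+ n.
      by rewrite zS ler_pdivrMr // mulrAC divfK // lt0r_neq0.
    have H1 : N (z n.+1 - a) <= 2 * N (y - f a) / N d * (1 - 2^-1 ^+ n.+1).
      have -> : z n.+1 - a = (z n.+1 - z n) + (z n - a) by ring.
      apply: le_trans (ND _ _) _; apply: le_trans (lerD step IH1) _.
      by rewrite exprS le_eqVlt; apply/orP; left; apply/eqP; field; exact: lt0r_neq0.
    split => //.
    have zne1 : N (z n.+1 - a) < e.
      exact: le_lt_trans H1 (bnd n.+1).
    have := key (z n.+1) (z n) zne1 zne.
    have -> : f (z n.+1) - f (z n) - d * (z n.+1 - z n) = f (z n.+1) - y.
      by rewrite {3}/z /= -/(z n) /F; field.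
    move=> H2; apply: le_trans H2 _; rewrite zS exprS.
    have -> : N d / 2 * (N (f (z n) - y) / N d) = 2^-1 * N (f (z n) - y).
      by field; exact: lt0r_neq0.
    by rewrite mulrCA ler_wpM2l // invr_ge0.
  have h2 : 0 <= (2^-1 : R) < 1 by apply/andP; split; lra.
  have [l Hl] : exists l, series (fun n => z n.+1 - z n) @ \oo --> (l : K).
    apply: (abs_complete hN (M := N (y - f a) / N d) h2) => n.
    rewrite zS ler_pdivrMr // mulrAC divfK ?lt0r_neq0 //; by case: (zb n).
  have Hz : series (fun n => z n.+1 - z n) = (fun n => z n - a).
    by apply/funext => n; rewrite /series /= telescope_sumr.
  rewrite Hz in Hl.
  have Hb n : N (z n - a) <= 2 * N (y - f a) / N d.
    have -> : z n - a = series (fun n => z n.+1 - z n) n by rewrite Hz.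
    have := @abs_series (fun n => z n.+1 - z n) (N (y - f a) / N d) 2^-1 n h2.
    have -> : N (y - f a) / N d / (1 - 2^-1) = 2 * N (y - f a) / N d.
      by field; rewrite lt0r_neq0.
    apply=> m; rewrite zS ler_pdivrMr // mulrAC divfK ?lt0r_neq0 //; by case: (zb m).
  have le : N l < e.
    apply: le_lt_trans (abs_lim_le Hb Hl) _.
    by rewrite ltr_pdivrMr //; move: yr; rewrite /r; nra.
  exists (l + a); rewrite ?addrK //.
  apply/eqP; rewrite -subr_eq0; apply/negPn/negP => /abs_gt0 fy.
  have : cdiff f (l + a) (f' (l + a)) by apply: He4; rewrite addrK; lra.
  move=> /cdiff_cont /abs_cont /(_ (N (f (l + a) - y) / 2)).
  rewrite divr_gt0 // => /(_ isT)[s s0 Hs].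
  move/abs_cvg : Hl => /(_ s s0)[m1 _ Hm1].
  have [m2 Hm2] : exists m2, 2^-1 ^+ m2 < N (f (l + a) - y) / 2 / (N (y - f a) + 1).
    by apply: expr_small => //; rewrite divr_gt0 ?divr_gt0 // ltr_wpDl.
  have Y1 : 0 < N (y - f a) + 1 by rewrite ltr_wpDl.
  have := Hs (z (m1 + m2)%N); have /= := Hm1 (m1 + m2)%N (leq_addr _ _).
  have -> : z (m1 + m2)%N - a - l = z (m1 + m2)%N - (l + a) by ring.
  move=> H1 /(_ H1) H2; have [_ H3] := zb (m1 + m2)%N.
  have H4 : 2^-1 ^+ (m1 + m2) <= 2^-1 ^+ m2 :> R.
    by apply: ler_wiXn2l; rewrite ?leq_addl // ?invr_ge0 // invf_le1 // ler1n.
  have H5 : N (y - f a) * 2^-1 ^+ (m1 + m2) < N (f (l + a) - y) / 2.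
    move: Hm2; rewrite ltr_pdivlMr // => Hm2.
    have : 0 <= 2^-1 ^+ (m1 + m2) :> R by rewrite exprn_ge0 // invr_ge0.
    have := N_ge0 (y - f a); nra.
  have := absB (f (z (m1 + m2)%N) - y) (f (z (m1 + m2)%N) - f (l + a)).
  have -> : f (z (m1 + m2)%N) - y - (f (z (m1 + m2)%N) - f (l + a)) = f (l + a) - y by ring.
  lra.
have /choice[g Hg] : forall y, exists z, N (y - f a) < r -> N (z - a) < e /\ f z = y.
  move=> y; have [/sur[z]|H] := pselect (N (y - f a) < r); first by exists z.
  by exists a.
have gf z : N (z - a) < e -> N (f z - f a) < r -> g (f z) = z.
  move=> ze /[dup] fr /Hg[ge fE]; apply/eqP; rewrite -subr_eq0; apply/negPn/negP => /abs_gt0.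
  have := inj _ _ ge ze; rewrite fE subrr abs0; nra.
have aa : N (a - a) < e by rewrite subrr abs0.
have glip y1 y2 : N (y1 - f a) < r -> N (y2 - f a) < r -> N d / 2 * N (g y1 - g y2) <= N (y1 - y2).
  by move=> /Hg[g1 f1E] /Hg[g2 f2E]; have := inj _ _ g1 g2; rewrite f1E f2E.
have gcont y : N (y - f a) < r -> g @ nbhs y --> g y.
  move=> yr; apply/abs_cont => s s0.
  exists (Num.min (r - N (y - f a)) (N d / 2 * s)).
    by rewrite lt_min subr_gt0 yr mulr_gt0 // divr_gt0.
  move=> w; rewrite lt_min => /andP[w1 w2].
  have wr : N (w - f a) < r.
    have -> : w - f a = (w - y) + (y - f a) by ring.
    by apply: le_lt_trans (ND _ _) _; lra.
  have := glip w y wr yr => H; rewrite -(ltr_pM2l (_ : 0 < N d / 2)) ?divr_gt0 //.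
  exact: le_lt_trans H w2.
have fafa : N (f a - f a) < r by rewrite subrr abs0.
have gfa : g (f a) = a by apply: gf.
exists g; split => //.
- by have := gcont (f a) fafa; rewrite gfa.
- apply/(abs_near hN); exists r => // y yr; have [ge fE] := Hg y yr; split => //.
  have [phi [cphi phig fphi]] := He4 _ (lt_le_trans ge le4).
  (* The slope of the inverse is to be the inverse of [phi], which must not vanish: away from [g y]
     this is injectivity of [f], and at [g y] the derivative of [f] is within a quarter of [d]. *)
  have phi0 y' : N (y' - f a) < r -> phi (g y') != 0.
    move=> y'r; have [ge' fE'] := Hg y' y'r.
    have [yy|yy] := eqVneq (g y') (g y).
      rewrite yy phig; apply/negP => /eqP H0.
      by have := He3 _ (lt_le_trans ge le3); rewrite H0 sub0r absN; lra.
    apply/negP => /eqP H0; have := fphi (g y'); rewrite H0 mul0r addr0 => ff.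
    have := inj _ _ ge' ge; rewrite ff subrr abs0.
    have : 0 < N (g y' - g y) by rewrite abs_gt0 // subr_eq0.
    nra.
  (* Nothing is known about [g] outside the ball, whereas the slope identity must hold everywhere;
     there [g] is replaced by the value that makes the identity true. *)
  apply: (@cdiff_near _ (fun y' => if N (y' - f a) < r then g y' else g y + (phi (g y'))^-1 * (y' - y))).
    apply/(abs_near hN); exists (r - N (y - f a)); first by rewrite subr_gt0.
    move=> w w1; rewrite ifT //.
    have -> : w - f a = (w - y) + (y - f a) by ring.
    by apply: le_lt_trans (ND _ _) _; lra.
  exists (fun y' => (phi (g y'))^-1); split.
  + apply: cvgV; first by rewrite -phig; exact: phi0.
    exact: (cvg_comp _ _ (gcont y yr) cphi).
  + by rewrite phig.
  + move=> w; rewrite yr; case: ifP => // wr.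
    have := fphi (g w); have [_ ->] := Hg w wr; rewrite fE => E.
    have -> : w - y = phi (g w) * (g w - g y) by rewrite [in LHS]E addrC addKr.
    by rewrite mulKf ?phi0 // addrC subrK.
- have /abs_cont /(_ r r0)[s s0 Hs] := power_series_cont Hf.
  apply/(abs_near hN); exists (Num.min e s); first by rewrite lt_min e0.
  by move=> w; rewrite lt_min => /andP[we ws]; apply: gf => //; exact: Hs.
Qed.

End PowerSeries.

(** * The absolute value of the complex plane *)

Section ComplexAbs.
Variable R : realType.
Local Notation C := (cplx R).

Definition cabs (z : C) : R := complex.Re (`|z| : C).

Lemma cabsE (z : C) : `|z| = (cabs z)%:C%C.
Proof. by rewrite /cabs; have [r _ ->] := norm_rcE z. Qed.

Lemma cabs_rc (x : R) : cabs (x%:C%C) = `|x|.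
Proof. by rewrite /cabs norm_rc. Qed.

Lemma cabs_Re (z : C) : `|complex.Re z| <= cabs z.
Proof. by rewrite -lecR -cabsE; exact: norm_Re. Qed.

Lemma cabs_Im (z : C) : `|complex.Im z| <= cabs z.
Proof. by rewrite -lecR -cabsE; exact: norm_Im. Qed.

Lemma cabs_le (z : C) : cabs z <= `|complex.Re z| + `|complex.Im z|.
Proof. by rewrite -lecR -cabsE; exact: normc_le. Qed.

Lemma series_Re (u : nat -> C) n : complex.Re (series u n) = series (fun i => complex.Re (u i)) n.
Proof.
rewrite /series /=; elim: n => [|n IH]; first by rewrite !big_geq.
by rewrite !big_nat_recr //= Re_add IH.
Qed.

Lemma series_Im (u : nat -> C) n : complex.Im (series u n) = series (fun i => complex.Im (u i)) n.
Proof.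
rewrite /series /=; elim: n => [|n IH]; first by rewrite !big_geq.
by rewrite !big_nat_recr //= Im_add IH.
Qed.

Lemma cvg_geo_series (u : nat -> R) M q : 0 <= q < 1 ->
  (forall n, `|u n| <= M * q ^+ n) -> exists l : R, series u @ \oo --> l.
Proof.
move=> /andP[q0 q1] H.
have : cvgn (series u).
  apply: normed_cvg; apply: (@series_le_cvg _ _ (geometric M q)) => [n|n|n|] /=.
  - exact: normr_ge0.
  - exact: le_trans (H n).
  - exact: H.
  - by apply: is_cvg_geometric_series; rewrite ger0_norm.
by move=> Hc; exists (lim (series u @ \oo)).
Qed.

Lemma complete_cabs : complete_abs cabs.
Proof.
split.
- by move=> z; rewrite -ler0c -cabsE.
- by move=> z z0; apply/eqP; rewrite -normr_eq0 cabsE z0.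
- move=> x y; apply: (@complexI R); rewrite -cabsE normrM !cabsE.
  by rewrite (rmorphM (real_complex R)).
- move=> x y; rewrite -lecR (rmorphD (real_complex R)).
  by have := ler_normD x y; rewrite !cabsE.
- move=> n; apply: (@complexI R); rewrite -cabsE normr_nat.
  by rewrite (rmorph_nat (real_complex R)).
- move=> z P; split.
    move=> /nbhs_ballP[e /= /gt0_rc[r r0 ->] H]; exists r => // w wr.
    by apply: H; rewrite -ball_normE /= distrC cabsE ltcR.
  move=> [r r0 H]; apply/nbhs_ballP; exists (r%:C%C) => /=; first by rewrite ltcR.
  by move=> w; rewrite -ball_normE /= distrC cabsE ltcR; exact: H.
- move=> u M q q01 H.
  have [a Ha] : exists l : R, series (fun i => complex.Re (u i)) @ \oo --> l.
    by apply: (@cvg_geo_series _ M q) => // n; apply: le_trans (cabs_Re _) (H n).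
  have [b Hb] : exists l : R, series (fun i => complex.Im (u i)) @ \oo --> l.
    by apply: (@cvg_geo_series _ M q) => // n; apply: le_trans (cabs_Im _) (H n).
  exists (a +i* b)%C; apply: cvg_ReIm => /=.
    by under eq_fun do rewrite series_Re.
  by under eq_fun do rewrite series_Im.
Qed.

End ComplexAbs.

(** * Integration of complex functions over the unit interval *)

Section ComplexIntegral.
Variable R : realType.
Local Notation C := (cplx R).
Local Notation mu := (@lebesgue_measure R).
Local Notation Re := (@complex.Re R).
Local Notation Im := (@complex.Im R).
Implicit Types (h g F : R -> C) (f : C -> C).

Definition cont01 h := forall s : R, 0 <= s <= 1 -> h @ nbhs s --> h s.

(** The slope form for a real variable and complex values. It composes on the left with [cdiff], so
    that one chain rule serves for curves in the plane. *)
Definition rdiff h (s : R) (d : C) := exists phi : R -> C,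
  [/\ phi @ nbhs s --> d, phi s = d & forall x, h x = h s + phi x * (x - s)%:C%C].

Lemma real_caratheodory (g phi : R -> R) (s : R) : phi @ nbhs s --> phi s ->
  (forall x, g x = g s + phi x * (x - s)) -> is_derive s 1 g (phi s).
Proof.
move=> cphi gE.
have H : (fun t => t^-1 *: (g (t *: (1 : R) + s) - g s)) @ (0 : R)^' --> phi s.
  have cz : (fun t : R => t + s) @ (0 : R)^' --> s.
    have cz0 : (fun t : R => t + s) @ nbhs (0 : R) --> 0 + s.
      by apply: cvgD; [exact: cvg_id|exact: cvg_cst].
    by rewrite add0r in cz0; exact: cvg_within_filter cz0.
  apply: cvg_trans (cvg_comp _ _ cz cphi); apply: near_eq_cvg.
  apply: filterS (nbhs_dnbhs_neq 0) => t t0.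
  have -> : t *: (1 : R) = t by rewrite /GRing.scale /= mulr1.
  have -> : g (t + s) - g s = phi (t + s) * t by rewrite [in LHS]gE; ring.
  by rewrite /GRing.scale /= mulrC mulfK.
apply: DeriveDef; first by apply/cvg_ex; exists (phi s).
exact: cvg_lim.
Qed.

Lemma rdiff_Re h s d : rdiff h s d -> is_derive s 1 (fun x => Re (h x)) (Re d).
Proof.
move=> [phi [cphi phid hE]]; rewrite -phid.
apply: (@real_caratheodory _ (fun x => Re (phi x))).
  by rewrite phid; apply: cvg_Re.
by move=> x; rewrite {1}hE Re_add Re_mul /= mulr0 subr0.
Qed.

Lemma rdiff_Im h s d : rdiff h s d -> is_derive s 1 (fun x => Im (h x)) (Im d).
Proof.
move=> [phi [cphi phid hE]]; rewrite -phid.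
apply: (@real_caratheodory _ (fun x => Im (phi x))).
  by rewrite phid; apply: cvg_Im.
by move=> x; rewrite {1}hE Im_add Im_mul /= mulr0 add0r.
Qed.

Lemma rdiff_cont h s d : rdiff h s d -> h @ nbhs s --> h s.
Proof.
move=> [phi [cphi phid hE]].
rewrite (_ : h = (fun x => h s + phi x * (x - s)%:C%C)); last exact/funext.
rewrite subrr mulr0 addr0 -[X in _ --> X](addr0 (h s)).
apply: cvgD; first exact: cvg_cst.
rewrite -[X in _ --> X](mulr0 d); apply: cvgM; first exact: cphi.
have H : (fun x : R => x - s) @ nbhs s --> s - s.
  by apply: cvgB; [exact: cvg_id|exact: cvg_cst].
by rewrite subrr in H; exact: (cvg_rc _ H).
Qed.

Lemma rdiff_comp f h s d e : rdiff h s d -> cdiff f (h s) e ->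
  rdiff (fun x => f (h x)) s (e * d).
Proof.
move=> hh; have ch := rdiff_cont hh; move: hh => [p [cp ps hE]] [q [cq qh fE]].
exists (fun x => q (h x) * p x); split.
- exact: (cvgM (cvg_comp _ _ ch cq) cp).
- by rewrite qh ps.
- by move=> x; rewrite (fE (h x)) [X in (X - h s)]hE [h s + _]addrC addrK mulrA.
Qed.

Lemma rdiff_line (z v : C) s : rdiff (fun x => z + x%:C%C * v) s v.
Proof.
exists (fun=> v); split => [||x]; [exact: cvg_cst| by [] |].
by rewrite (rmorphB (real_complex R)); ring.
Qed.

Lemma cont01_within h : cont01 h ->
  {within `[0, 1], continuous (fun s => Re (h s))} /\
  {within `[0, 1], continuous (fun s => Im (h s))}.
Proof.
move=> ch; split; apply: continuous_in_subspaceT => s /set_mem /=;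
  rewrite in_itv /= => s01.
- by apply: cvg_Re; exact: ch.
- by apply: cvg_Im; exact: ch.
Qed.

Lemma cont01_integrable h : cont01 h ->
  mu.-integrable `[0, 1] (EFin \o (fun s => Re (h s))) /\
  mu.-integrable `[0, 1] (EFin \o (fun s => Im (h s))).
Proof.
move=> /cont01_within[cr ci].
by split; apply: continuous_compact_integrable => //; exact: segment_compact.
Qed.

Lemma FTC01 (F f : R -> R) : {within `[0, 1], continuous f} ->
  (forall s : R, 0 <= s <= 1 -> is_derive s 1 F (f s)) ->
  \int[mu]_(s in `[0, 1]) f s = F 1 - F 0.
Proof.
move=> cf dF; rewrite /Rintegral (continuous_FTC2 _ cf (F := F)) //.
- have dd s : 0 <= s <= 1 -> derivable F s 1 by move=> /dF[].
  have cF s : 0 <= s <= 1 -> {for s, continuous F}.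
    by move=> /dd /derivable1_diffP /differentiable_continuous.
  split.
  + by move=> s; rewrite in_itv /= => /andP[s0 s1]; apply: dd; rewrite !ltW.
  + by apply: cvg_at_right_filter; apply: cF; rewrite lexx ler01.
  + by apply: cvg_at_left_filter; apply: cF; rewrite lexx ler01.
- move=> s; rewrite in_itv /= => /andP[s0 s1].
  have [|? <-] := dF s; first by rewrite !ltW.
  by rewrite derive1E.
Qed.

Lemma cintegral_FTC h F : cont01 h -> (forall s : R, 0 <= s <= 1 -> rdiff F s (h s)) ->
  cintegral h = F 1 - F 0.
Proof.
move=> /cont01_within[cr ci] dF; apply: ReIm_eq; rewrite ?Re_add ?Re_opp ?Im_add ?Im_opp /=.
- exact: (FTC01 cr (fun s hs => rdiff_Re (dF s hs))).
- exact: (FTC01 ci (fun s hs => rdiff_Im (dF s hs))).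
Qed.

Lemma eq_cintegral h g : (forall s : R, 0 <= s <= 1 -> h s = g s) -> cintegral h = cintegral g.
Proof.
by move=> hg; apply: ReIm_eq => /=; apply: eq_Rintegral => s /set_mem /=;
  rewrite in_itv /= => /hg ->.
Qed.

Lemma cintegralD h g : cont01 h -> cont01 g ->
  cintegral (fun s => h s + g s) = cintegral h + cintegral g.
Proof.
move=> /cont01_integrable[hr hi] /cont01_integrable[gr gi].
apply: ReIm_eq; rewrite ?Re_add ?Im_add /=.
- by under eq_Rintegral do rewrite Re_add; rewrite RintegralD.
- by under eq_Rintegral do rewrite Im_add; rewrite RintegralD.
Qed.

Lemma integrable_scale (c : R) (u : R -> R) : mu.-integrable `[0, 1] (EFin \o u) ->
  mu.-integrable `[0, 1] (EFin \o (fun s => c * u s)).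
Proof.
by move=> iu; have := @integrableZl _ _ _ mu `[0, 1]%classic ltac:(exact: measurable_itv) c _ iu.
Qed.

Lemma cintegralZ (c : C) h : cont01 h ->
  cintegral (fun s => c * h s) = c * cintegral h.
Proof.
move=> /cont01_integrable[hr hi].
apply: ReIm_eq; rewrite ?Re_mul ?Im_mul /=.
- under eq_Rintegral do rewrite Re_mul.
  by rewrite RintegralB ?RintegralZl //; apply: integrable_scale.
- under eq_Rintegral do rewrite Im_mul.
  by rewrite RintegralD ?RintegralZl //; apply: integrable_scale.
Qed.

(** Real and imaginary parts are estimated separately, whence the factor 2; only convergence to 0 is
    drawn from such bounds, so the loss is harmless. *)
Lemma cabs_cintegral h (M : R) : cont01 h -> (forall s : R, 0 <= s <= 1 -> cabs (h s) <= M) ->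
  cabs (cintegral h) <= 2 * M.
Proof.
move=> ch hM; have [hr hi] := cont01_integrable ch; have [cr ci] := cont01_within ch.
have key (u : R -> R) : {within `[0, 1], continuous u} ->
    (forall s : R, 0 <= s <= 1 -> `|u s| <= M) -> `|\int[mu]_(s in `[0, 1]) u s| <= M.
  move=> cu uM.
  have iu : mu.-integrable `[0, 1] (EFin \o u).
    by apply: continuous_compact_integrable => //; exact: segment_compact.
  apply: le_trans (le_normr_Rintegral _ iu) _ => //.
  have -> : M = \int[mu]_(s in `[0, 1]) cst M s.
    rewrite Rintegral_cst //= lebesgue_measure_itv /= lte_fin ltr01.
    by rewrite /= subr0 mulr1.
  apply: le_Rintegral => //.
  - exact: integrable_norm iu.
  - apply: continuous_compact_integrable; first exact: segment_compact.
    by apply: continuous_subspaceT => x; exact: cvg_cst.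
apply: le_trans (cabs_le _) _; rewrite mulr2n mulrDl mul1r /=; apply: lerD; apply: key => // s /hM.
- exact/le_trans/cabs_Re.
- exact/le_trans/cabs_Im.
Qed.

End ComplexIntegral.

(** * Cauchy's formula on circles and the expansion into power series *)

Section Cauchy.
Variable R : realType.
Local Notation C := (cplx R).
Local Notation mu := (@lebesgue_measure R).
Local Notation Re := (@complex.Re R).
Local Notation Im := (@complex.Im R).
Implicit Types (h : R -> C) (f : C -> C).
Let hN := complete_cabs R.

Lemma real_derive_caratheodory (g : R -> R) (s d : R) : is_derive s 1 g d ->
  exists phi : R -> R,
    [/\ phi @ nbhs s --> d, phi s = d & forall x, g x = g s + phi x * (x - s)].
Proof.
move=> [dg dgE].
pose phi x := if x == s then d else (g x - g s) / (x - s).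
exists phi; split; last 2 first.
- by rewrite /phi eqxx.
- move=> x; rewrite /phi; case: eqVneq => [->|xs]; first by rewrite subrr mulr0 addr0.
  by rewrite divfK ?subr_eq0 // addrC subrK.
have dq : (fun t => t^-1 *: (g (t *: (1 : R) + s) - g s)) @ (0 : R)^' --> d.
  by rewrite -dgE; exact: dg.
apply/cvgrPdist_lt => e e0.
move/cvgrPdist_lt : dq => /(_ e e0) [r /= r0 rP].
apply/nbhs_ballP; exists r => //= x; rewrite /ball /= => xr.
rewrite /phi; case: eqVneq => [_|xs]; first by rewrite subrr normr0.
have := rP (x - s); rewrite /= sub0r normrN distrC subr_eq0 => /(_ xr xs).
have -> : (x - s) *: (1 : R) = x - s by rewrite /GRing.scale /= mulr1.
by rewrite subrK /GRing.scale /= mulrC.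
Qed.

Lemma rdiff_ReIm h (s : R) (d : C) : is_derive s 1 (fun x => Re (h x)) (Re d) ->
  is_derive s 1 (fun x => Im (h x)) (Im d) -> rdiff h s d.
Proof.
move=> /real_derive_caratheodory[p [cp ps pE]] /real_derive_caratheodory[q [cq qs qE]].
exists (fun x => (p x +i* q x)%C : C); split.
- exact: cvg_ReIm.
- by apply: ReIm_eq.
- by move=> x; apply: ReIm_eq; rewrite ?Re_add ?Im_add ?Re_mul ?Im_mul /=
    ?mulr0 ?subr0 ?add0r.
Qed.

Definition circle (r : R) (s : R) : C :=
  ((r * cos (2 * pi * s)) +i* (r * sin (2 * pi * s)))%C.

(** The number 2 pi i, the logarithmic derivative of [circle r]. Because of it,
    [circle r s / (circle r s - h)] is the pullback of the Cauchy kernel dw / (2 pi i (w - h)). *)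
Definition twopii : C := (0 +i* (2 * pi))%C.

Lemma twopii_neq0 : twopii != 0.
Proof. by rewrite eq_complex /= eqxx /= mulf_neq0 ?pnatr_eq0 // gt_eqF // pi_gt0. Qed.

Lemma rdiff_circle r s : rdiff (circle r) s (twopii * circle r s).
Proof.
have dl : is_derive s 1 (fun x : R => 2 * pi * x) (2 * pi).
  by apply: (@real_caratheodory _ _ (fun=> 2 * pi)); [exact: cvg_cst|move=> x; ring].
have d1 : rdiff (fun x => (cos (2 * pi * x) +i* sin (2 * pi * x))%C : C) s
    ((- sin (2 * pi * s) * (2 * pi)) +i* (cos (2 * pi * s) * (2 * pi)))%C.
  apply: rdiff_ReIm => /=.
  - exact: (@is_derive1_comp _ cos (fun x : R => 2 * pi * x)).
  - exact: (@is_derive1_comp _ sin (fun x : R => 2 * pi * x)).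
have := rdiff_comp d1 (cdiffZ (r%:C%C : C) (cdiff_id _)).
congr (rdiff _ _ _).
- apply/funext => x; apply: ReIm_eq; rewrite ?Re_mul ?Im_mul /=; ring.
- apply: ReIm_eq; rewrite ?Re_mul ?Im_mul /=; ring.
Qed.

Lemma circle01 r : circle r 1 = circle r 0.
Proof. by rewrite /circle mulr1 mulr0 mulr_natl cos2pi sin2pi cos0 sin0. Qed.

Lemma cabs_circle r s : 0 <= r -> cabs (circle r s) = r.
Proof.
move=> r0; rewrite /cabs.
have -> : `|circle r s| = (Num.sqrt ((r * cos (2 * pi * s)) ^+ 2 + (r * sin (2 * pi * s)) ^+ 2))%:C%C :> C by [].
by rewrite /= !exprMn -mulrDr cos2Dsin2 mulr1 sqrtr_sqr ger0_norm.
Qed.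

Section Kernel.
Variables (r : R) (h : C).
Hypotheses (r0 : 0 < r) (hr : cabs h < r).
Let w := circle r.
Let k s := w s / (w s - h).

Lemma circle_neq0 s : w s != 0.
Proof.
apply/negP => /eqP w0; have := cabs_circle s (ltW r0); rewrite -/w w0 (abs0 hN) => r00.
by move: r0; rewrite -r00 ltxx.
Qed.

Lemma circle_sub_neq0 s : w s - h != 0.
Proof.
rewrite subr_eq0; apply/negP => /eqP w0; have := cabs_circle s (ltW r0).
by rewrite -/w w0 => r00; move: hr; rewrite r00 ltxx.
Qed.

Lemma cabs_kernel s : cabs (k s) <= r / (r - cabs h).
Proof.
have wh := circle_sub_neq0 s.
have r0' := ltW r0.
rewrite /k (absM hN) (absV hN) // cabs_circle //; apply: ler_wpM2l => //.
rewrite lef_pV2 ?posrE ?subr_gt0 ?(abs_gt0 hN) //.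
by rewrite lerBlDr -{1}(cabs_circle s r0') -/w -{1}(subrK h (w s)) (absD hN).
Qed.

Lemma cont_circle s : w @ nbhs s --> w s.
Proof. exact: rdiff_cont (rdiff_circle r s). Qed.

Lemma cont_kernel s : k @ nbhs s --> k s.
Proof.
apply: cvgM; first exact: cont_circle.
apply: cvgV; first exact: circle_sub_neq0.
by apply: cvgB; [exact: cont_circle|exact: cvg_cst].
Qed.

Lemma cont_circleV n s : (fun s => (w s ^+ n)^-1) @ nbhs s --> (w s ^+ n)^-1.
Proof.
apply: cvgV; first by rewrite expf_neq0 ?circle_neq0.
elim: n => [|n IH]; first by rewrite expr0; exact: cvg_cst.
rewrite exprS (_ : (fun x => w x ^+ n.+1) = (fun x => w x * w x ^+ n)).
  by apply: cvgM; [exact: cont_circle|exact: IH].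
by apply/funext => x; rewrite exprS.
Qed.

(** The kernel is the geometric series in [h / w]. Summing it finitely often leaves an exact
    remainder, [h ^+ n] times an integral, so no exchange of limit and integral is needed. *)
Lemma psum_kernel (u : R -> C) (B : R) : cont01 u ->
  (forall s : R, 0 <= s <= 1 -> cabs (u s) <= B) ->
  psum (fun n => cintegral (fun s => u s / w s ^+ n)) h
    (cintegral (fun s => u s * k s)).
Proof.
move=> cu uB; set c := fun n => _; set l := cintegral _.
have B0 : 0 <= B by apply: le_trans (uB 0 _); rewrite ?(abs_ge0 hN) // lexx ler01.
have cc n : cont01 (fun s => u s / w s ^+ n).
  by move=> s s01; apply: cvgM; [exact: cu|exact: cont_circleV].
have ck n : cont01 (fun s => u s / w s ^+ n * k s).
  by move=> s s01; apply: cvgM; [exact: cc|exact: cont_kernel].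
have rem n : l - series (fun n => c n * h ^+ n) n =
    h ^+ n * cintegral (fun s => u s / w s ^+ n * k s).
  elim: n => [|n IH].
    rewrite /series /= big_geq // subr0 expr0 mul1r; apply: eq_cintegral => s _.
    by rewrite expr0 invr1 mulr1.
  rewrite /series /= big_nat_recr //= opprD addrA -/(series _ n).
  have -> : l - series (fun n => c n * h ^+ n) n = h ^+ n * cintegral (fun s => u s / w s ^+ n * k s) := IH.
  have E : cintegral (fun s => u s / w s ^+ n * k s) =
      c n + h * cintegral (fun s => u s / w s ^+ n.+1 * k s).
    rewrite -cintegralZ; last exact: ck.
    rewrite /c -cintegralD; last 2 first.
    - exact: cc.
    - by move=> s s01; apply: cvgM; [exact: cvg_cst|exact: ck].
    apply: eq_cintegral => s _; rewrite /k exprS.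
    by field; rewrite circle_neq0 circle_sub_neq0 expf_neq0 ?circle_neq0.
  by rewrite E exprSr; ring.
have kb0 : 0 <= r / (r - cabs h) by rewrite divr_ge0 ?ltW // subr_gt0.
have rb n : cabs (series (fun n => c n * h ^+ n) n - l) <=
    2 * (B * (r / (r - cabs h))) * (cabs h / r) ^+ n.
  rewrite (absC hN) rem (absM hN) (absX hN) exprMn [X in _ <= X]mulrCA.
  apply: ler_wpM2l; first by rewrite exprn_ge0 // (abs_ge0 hN).
  rewrite -mulrA; apply: (cabs_cintegral (ck n)) => s s01.
  rewrite (absM hN) (absM hN (u s)) (absV hN) ?expf_neq0 ?circle_neq0 //.
  have r0' := ltW r0; rewrite (absX hN) cabs_circle // exprVn mulrAC; apply: ler_wpM2r.
    by rewrite invr_ge0 exprn_ge0 // ltW.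
  by apply: ler_pM; rewrite ?(abs_ge0 hN) ?uB ?cabs_kernel.
apply/(abs_cvg hN) => e e0.
have q01 : 0 <= cabs h / r < 1.
  by rewrite divr_ge0 ?(abs_ge0 hN) ?ltW //= ltr_pdivrMr ?mul1r.
pose D := 2 * (B * (r / (r - cabs h))) + 1.
have E0 : 0 <= 2 * (B * (r / (r - cabs h))) by rewrite mulr_ge0 // mulr_ge0.
have D0 : 0 < D by rewrite ltr_wpDl.
have [m Hm] := expr_small q01 (divr_gt0 e0 D0).
exists m => // n /= mn; apply: le_lt_trans (rb n) _.
have H1 : (cabs h / r) ^+ n <= (cabs h / r) ^+ m.
  by move/andP: q01 => [q0 q1]; apply: ler_wiXn2l => //; exact: ltW.
move: Hm; rewrite ltr_pdivlMr // => Hm.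
have H2 : 0 <= (cabs h / r) ^+ n by rewrite exprn_ge0 // divr_ge0 ?(abs_ge0 hN) // ltW.
apply: le_lt_trans Hm; rewrite mulrC; apply: (@le_trans _ _ ((cabs h / r) ^+ n * D)).
  by apply: ler_wpM2l => //; rewrite /D; lra.
by apply: ler_wpM2r => //; exact: ltW.
Qed.

(** Expand with [u = 1]: for n > 0 the power [w ^- n] has a primitive taking the same value at both
    ends of the closed circle, so only the term n = 0 survives. *)
Lemma cintegral_kernel : cintegral k = 1.
Proof.
have c1 : cont01 (fun=> 1 : C) by move=> s _; exact: cvg_cst.
have H := psum_kernel c1 (B := 1); rewrite (abs1 hN) in H; have {}H := H (fun _ _ => lexx _).
have cV n : cont01 (fun s => 1 / w s ^+ n).
  by move=> s _; apply: cvgM; [exact: cvg_cst|exact: cont_circleV].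
have E : (fun n => cintegral (fun s => 1 / w s ^+ n)) = (fun n => (n == 0%N)%:R).
  apply/funext => n; case: n => [|n] /=.
    rewrite (cintegral_FTC (F := fun s => 0 + s%:C%C * 1)).
    - by rewrite /= !add0r !mulr1 (rmorph0 (real_complex R)) subr0.
    - exact: cV.
    - by move=> s _; rewrite expr0 divr1; exact: rdiff_line.
  rewrite (cintegral_FTC (F := fun s => (- (n.+1%:R * twopii)^-1) * (w s ^+ n.+1)^-1)).
  - by rewrite /w circle01 subrr.
  - exact: cV.
  - move=> s _; have w0 := circle_neq0 s.
    have n0 : n.+1%:R != 0 :> C by rewrite pnatr_eq0.
    have d1 := cdiff_comp (cdiffX n.+1 (w s)) (cdiffV (expf_neq0 n.+1 w0)).
    have d2 := rdiff_comp (rdiff_circle r s) (cdiffZ (- (n.+1%:R * twopii)^-1) d1).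
    rewrite (_ : 1 / w s ^+ n.+1 = - (n.+1%:R * twopii)^-1 * (- (w s ^+ n.+1 ^+ 2)^-1 * (n.+1%:R * w s ^+ n.+1.-1)) * (twopii * circle r s)) //.
    rewrite /= -/w exprS; have := twopii_neq0.
    have wn0 : w s ^+ n != 0 by rewrite expf_neq0.
    move: (w s ^+ n) wn0 (n.+1%:R) n0 => W W0 k' k0 t0.
    by field; rewrite w0 t0 k0 W0.
rewrite E in H; rewrite (_ : cintegral k = cintegral (fun s => 1 * k s)); last first.
  by apply: eq_cintegral => s _; rewrite mul1r.
apply: (psum_uniq hN H); apply/(abs_cvg hN) => e e0; exists 1%N => // n /= n0.
rewrite /series /= big_ltn // mul1r expr0 big1_seq ?addr0 ?subrr ?(abs0 hN) //.
by move=> i; rewrite mem_index_iota => /andP[_ /andP[i0 _]]; rewrite gtn_eqF // mul0r.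
Qed.

End Kernel.

Lemma derive_under01 (u u' : R -> R -> R) (l b c M : R) : b < l < c -> 0 <= M ->
  (forall x : R, b < x < c -> {within `[0, 1], continuous (u x)}) ->
  (forall x s : R, b < x < c -> 0 <= s <= 1 -> is_derive x 1 (u^~ s) (u' x s)) ->
  (forall x s : R, b < x < c -> 0 <= s <= 1 -> `|u' x s| <= M) ->
  is_derive l 1 (fun x => \int[mu]_(s in `[0, 1]) u x s)
    (\int[mu]_(s in `[0, 1]) u' l s).
Proof.
move=> hl M0 cu du bu.
have E (x s : R) : b < x < c -> 0 <= s <= 1 -> partial1of2 u x s = u' x s.
  by move=> hx hs; rewrite partial1of2E; have [] := du _ _ hx hs.
have H : (fun t => t^-1 *: (\int[mu]_(s in `[0, 1]) u (t + l) s - \int[mu]_(s in `[0, 1]) u l s))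
    @ (0 : R)^' --> \int[mu]_(s in `[0, 1]) partial1of2 u l s.
  apply: (@cvg_differentiation_under_integral R _ _ mu u `[0, 1]%classic _ l b c _ _ _ (fun=> M)).
  - exact: measurable_itv.
  - by rewrite /= in_itv.
  - move=> x; rewrite /= in_itv /= => hx; apply: continuous_compact_integrable; last exact: cu.
    exact: segment_compact.
  - by move=> x s; rewrite /= !in_itv /= => hx hs; have [] := du _ _ hx hs.
  - by [].
  - apply: continuous_compact_integrable; first exact: segment_compact.
    by apply: continuous_subspaceT => x; exact: cvg_cst.
  - by move=> x s; rewrite /= !in_itv /= => hx hs; rewrite E // bu.
have E2 : \int[mu]_(s in `[0, 1]) partial1of2 u l s = \int[mu]_(s in `[0, 1]) u' l s.
  by apply: eq_Rintegral => s /set_mem /=; rewrite in_itv /= => hs; rewrite E.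
rewrite E2 in H.
have H' : (fun t => t^-1 *: (\int[mu]_(s in `[0, 1]) u (t *: (1 : R) + l) s - \int[mu]_(s in `[0, 1]) u l s))
    @ (0 : R)^' --> \int[mu]_(s in `[0, 1]) u' l s.
  apply: cvg_trans H; apply: near_eq_cvg; apply: nearW => t.
  by rewrite /GRing.scale /= mulr1.
apply: DeriveDef; first by apply/cvg_ex; exists (\int[mu]_(s in `[0, 1]) u' l s).
exact: cvg_lim.
Qed.

(* The mean of f over the circles z + l (w - z), weighted by the kernel, does
   not depend on l in [0, 1]. *)
Lemma cauchy_formula f f' (a z : C) (r M : R) : 0 < r -> cabs (z - a) < r / 4 ->
  (forall w, cabs (w - a) < 2 * r ->
    [/\ cdiff f w (f' w), f' @ nbhs w --> f' w & cabs (f' w) <= M]) ->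
  cintegral (fun s => f (a + circle r s) * (circle r s / (circle r s - (z - a)))) = f z.
Proof.
move=> r0 zr Hf; set h := z - a; set w := circle r; set k := fun s => w s / (w s - h).
have hr : cabs h < r by rewrite /h; lra.
have r0' := ltW r0.
(* These curves contract the circle about [a] (at [l = 1]) to the point [z] (at [l = 0]). The range
   [- 4^-1 < l < 5 / 4] gives room for derivatives at both ends, and on it [g] is at distance at
   most 5/4 (|h| + r) < 2 r from [a], because |h| < r / 4. *)
pose g (l s : R) : C := z + l%:C%C * (w s - h).
have gin (l s : R) : - 4^-1 < l < 5 / 4 -> cabs (g l s - a) < 2 * r.
  move=> /andP[l1 l2].
  rewrite (_ : g l s - a = (1 - l)%:C%C * h + l%:C%C * w s); last first.
    by rewrite /g /h (rmorphB (real_complex R)) (rmorph1 (real_complex R)); ring.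
  apply: le_lt_trans (absD hN _ _) _; rewrite !(absM hN) !cabs_rc cabs_circle //.
  have H1 : `|1 - l| <= 5 / 4 by rewrite ler_norml; apply/andP; split; lra.
  have H2 : `|l| <= 5 / 4 by rewrite ler_norml; apply/andP; split; lra.
  have := abs_ge0 hN h; have := normr_ge0 (1 - l); have := normr_ge0 l.
  rewrite -/h in zr; nra.
have dgl l s : rdiff (fun l => g l s) l (w s - h) by exact: rdiff_line.
have dgs l s : rdiff (g l) s (l%:C%C * (twopii * w s)).
  have := rdiff_comp (rdiff_circle r s) (cdiffD (cdiff_cst z _) (cdiffZ (l%:C%C : C) (cdiffB (cdiff_id (w s)) (cdiff_cst h (w s))))).
  by congr (rdiff _ _ _); rewrite subr0 add0r mulr1.
pose G (l s : R) : C := f (g l s) * k s.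
pose G' (l s : R) : C := f' (g l s) * w s.
have dG l s : - 4^-1 < l < 5 / 4 -> rdiff (fun l => G l s) l (G' l s).
  move=> /(gin l s) /Hf[df _ _].
  have := rdiff_comp (rdiff_comp (dgl l s) df) (cdiffM (cdiff_id _) (cdiff_cst (k s) _)).
  congr (rdiff _ _ _); rewrite mul1r mulr0 addr0 /G' /k.
  by field; exact: circle_sub_neq0.
have cG l : - 4^-1 < l < 5 / 4 -> cont01 (G l).
  move=> hl s _; apply: cvgM; last exact: cont_kernel.
  by have [df _ _] := Hf _ (gin l s hl); exact: rdiff_cont (rdiff_comp (dgs l s) df).
have cG' l : - 4^-1 < l < 5 / 4 -> cont01 (G' l).
  move=> hl s _; apply: cvgM; last exact: cont_circle.
  have [_ cf' _] := Hf _ (gin l s hl).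
  exact: (cvg_comp _ _ (rdiff_cont (dgs l s)) cf').
(* The [l]-derivative of the integrand is, up to the factor [l * twopii], the [s]-derivative of
   [f (g l s)], and the curve is closed. Dividing by the factor requires [l] nonzero, which the open
   interval ensures. *)
have intG' (l : R) : 0 < l < 1 -> cintegral (G' l) = 0.
  move=> l01; have hl : - 4^-1 < l < 5 / 4 by move/andP: l01 => [l0 l1]; apply/andP; split; lra.
  have l0 : l%:C%C != 0 :> C.
    by rewrite eq_complex /= eqxx andbT; move/andP: l01 => [? _]; rewrite gt_eqF.
  rewrite (cintegral_FTC (F := fun s => (l%:C%C * twopii)^-1 * f (g l s))).
  - by rewrite /g /w circle01 subrr.
  - exact: cG'.
  - move=> s _; have [df _ _] := Hf _ (gin l s hl).
    have := rdiff_comp (rdiff_comp (dgs l s) df) (cdiffZ ((l%:C%C * twopii)^-1) (cdiff_id _)).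
    congr (rdiff _ _ _); rewrite /G' mulr1.
    by have t0 := twopii_neq0; field; rewrite l0 t0.
have bG' l s : - 4^-1 < l < 5 / 4 -> cabs (G' l s) <= M * r.
  move=> hl; have [_ _ bf] := Hf _ (gin l s hl).
  by rewrite (absM hN) cabs_circle // ler_wpM2r.
have M0 : 0 <= M * r.
  have h0 : - 4^-1 < (0 : R) < 5 / 4 by apply/andP; split; lra.
  exact: le_trans (abs_ge0 hN _) (bG' 0 0 h0).
(* The mean value theorem is about real functions, so the argument is made once for a real linear
   [T], to be taken as the real and then the imaginary part. *)
have const01 (T : C -> R) : (forall h, cont01 h -> {within `[0, 1], continuous (T \o h)}) ->
    (forall h (s : R) (d : C), rdiff h s d -> is_derive s 1 (T \o h) (T d)) ->
    (forall c : C, `|T c| <= cabs c) ->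
    (forall l : R, 0 < l < 1 -> \int[mu]_(s in `[0, 1]) T (G' l s) = 0) ->
    \int[mu]_(s in `[0, 1]) T (G 1 s) = \int[mu]_(s in `[0, 1]) T (G 0 s).
  move=> cT dT bT zT; pose P l := \int[mu]_(s in `[0, 1]) T (G l s).
  have dP (l : R) : - 4^-1 < l < 5 / 4 ->
      is_derive l 1 P (\int[mu]_(s in `[0, 1]) T (G' l s)).
    move=> hl; apply: (@derive_under01 (fun l s => T (G l s)) (fun l s => T (G' l s)) _ _ _ (M * r) hl M0).
    - by move=> x hx; apply: cT; exact: cG.
    - by move=> x s hx _; have := dT _ _ _ (dG x s hx).
    - by move=> x s hx _; apply: le_trans (bT _) _; exact: bG'.
  have [||c c01] := @MVT R P (fun l => \int[mu]_(s in `[0, 1]) T (G' l s)) 0 1 ltr01.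
  - move=> x; rewrite in_itv /= => /andP[x0 x1]; apply: dP; apply/andP; split; lra.
  - apply: continuous_in_subspaceT => x /set_mem /=; rewrite in_itv /= => /andP[x0 x1].
    have [dx _] : is_derive x 1 P (\int[mu]_(s in `[0, 1]) T (G' x s)).
      by apply: dP; apply/andP; split; lra.
    by move/derivable1_diffP : dx => /differentiable_continuous.
  - rewrite zT ?mul0r; last by move: c01; rewrite in_itv.
    by move=> /eqP; rewrite subr_eq0 => /eqP.
have E : cintegral (G 1) = cintegral (G 0).
  have zR (l : R) : 0 < l < 1 -> \int[mu]_(s in `[0, 1]) Re (G' l s) = 0.
    by move=> /intG' /(congr1 Re).
  have zI (l : R) : 0 < l < 1 -> \int[mu]_(s in `[0, 1]) Im (G' l s) = 0.
    by move=> /intG' /(congr1 Im).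
  apply: ReIm_eq => /=; [apply: (const01 Re) => //|apply: (const01 Im) => //].
  - by move=> u /cont01_within[].
  - exact: rdiff_Re.
  - exact: cabs_Re.
  - by move=> u /cont01_within[].
  - exact: rdiff_Im.
  - exact: cabs_Im.
rewrite (_ : cintegral _ = cintegral (G 1)); last first.
  apply: eq_cintegral => s _; rewrite /G /g /k; congr (f _ * _).
  by rewrite (rmorph1 (real_complex R)) mul1r /h; ring.
rewrite E (_ : cintegral _ = cintegral (fun s => f z * k s)); last first.
  apply: eq_cintegral => s _; rewrite /G /g (rmorph0 (real_complex R)) mul0r addr0.
  by [].
rewrite cintegralZ; last by move=> s _; exact: cont_kernel.
by rewrite cintegral_kernel // mulr1.
Qed.

(** The coefficients are Cauchy's integrals over a small circle. Assuming [f'] continuous makes the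
    fundamental theorem of calculus and differentiation under the integral available. Closure of
    [analytic_at] under the usual operations goes through this criterion. *)
Lemma analytic_of_cdiff f f' (a : C) :
  (\forall z \near nbhs a, cdiff f z (f' z)) ->
  (\forall z \near nbhs a, f' @ nbhs z --> f' z) -> analytic_at f a.
Proof.
move=> Hf Hf'.
have ca := nbhs_singleton Hf'; have dfa := nbhs_singleton Hf.
have [e e0 He] : exists2 e, 0 < e & forall w, cabs (w - a) < e ->
    cdiff f w (f' w) /\ f' @ nbhs w --> f' w.
  by apply/(abs_near hN); exact: filterI Hf Hf'.
move/(abs_cont hN) : ca => /(_ 1 ltr01)[d d0 Hd].
have /(abs_cont hN) := cdiff_cont dfa => /(_ 1 ltr01)[d' d'0 Hd'].
(* The disc of radius [2 * r] must lie where [f] is differentiable with continuous derivative ([e]),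
   where [f'] is bounded ([d]) and where [f] is bounded ([d']). *)
pose r := Num.min e (Num.min d d') / 2.
have r0 : 0 < r by rewrite divr_gt0 // !lt_min e0 d0.
have [re [rd rd']] : 2 * r <= e /\ 2 * r <= d /\ 2 * r <= d'.
  have E : 2 * r = Num.min e (Num.min d d') by rewrite /r; field.
  by rewrite E !ge_min !lexx !orbT.
have le1 (x y : C) : cabs (x - y) < 1 -> cabs x <= cabs y + 1.
  move=> H; rewrite -{1}(subrK y x); apply: le_trans (absD hN _ _) _; lra.
exists (fun n => cintegral (fun s => f (a + circle r s) / circle r s ^+ n)).
apply/(abs_near hN); exists (r / 4); first by rewrite divr_gt0.
move=> z zr.
have Hr w : cabs (w - a) < 2 * r ->
    [/\ cdiff f w (f' w), f' @ nbhs w --> f' w & cabs (f' w) <= cabs (f' a) + 1].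
  move=> wr; have [H1 H2] := He _ (lt_le_trans wr re); split => //.
  by apply: le1; apply: Hd; exact: lt_le_trans wr rd.
have wr s : cabs (a + circle r s - a) < 2 * r.
  by rewrite addrC addKr cabs_circle ?ltW //; lra.
have cu : cont01 (fun s => f (a + circle r s)).
  move=> s _; have [df _ _] := Hr _ (wr s).
  apply: (cvg_comp _ _ _ (cdiff_cont df)).
  by apply: cvgD; [exact: cvg_cst|exact: cont_circle].
have hr : cabs (z - a) < r by lra.
rewrite -(cauchy_formula r0 zr Hr).
apply: (psum_kernel r0 hr cu (B := cabs (f a) + 1)) => s _.
by apply: le1; apply: Hd'; exact: lt_le_trans (wr s) rd'.
Qed.

End Cauchy.

(** * Calculus of analytic functions of one variable *)

Section Analytic.
Variable R : realType.
Local Notation C := (cplx R).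
Implicit Types (f g : C -> C) (a z w : C).
Let hN := complete_cabs R.

Lemma analytic_cdiff f a : analytic_at f a ->
  exists2 f', analytic_at f' a & \forall z \near nbhs a, cdiff f z (f' z).
Proof. exact: power_series_cdiff hN _ _. Qed.

Lemma analytic_cont f a : analytic_at f a -> f @ nbhs a --> f a.
Proof. exact: power_series_cont hN _ _. Qed.

Lemma analytic_near_cont f a : analytic_at f a ->
  \forall z \near nbhs a, f @ nbhs z --> f z.
Proof. by move=> /analytic_cdiff[f' _]; apply: filterS => z; exact: cdiff_cont. Qed.

Lemma near_near a (P : C -> Prop) : (\forall z \near nbhs a, P z) ->
  \forall z \near nbhs a, \forall w \near nbhs z, P w.
Proof. exact: near_join. Qed.

(** Differentiability passes to nearby points and Cauchy's formula re-expands there; no double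
    series is rearranged. *)
Lemma analytic_near f a : analytic_at f a -> \forall z \near nbhs a, analytic_at f z.
Proof.
move=> /analytic_cdiff[f' /analytic_near_cont cf' df].
apply: filterS2 (near_near cf') (near_near df) => z H1 H2.
exact: analytic_of_cdiff H2 H1.
Qed.

Lemma analytic_ext f g a : (\forall z \near nbhs a, f z = g z) ->
  analytic_at f a -> analytic_at g a.
Proof.
move=> fg [c Hc]; exists c; apply: filterS2 fg Hc => z ->.
by [].
Qed.

Lemma analytic_cst (c : C) a : analytic_at (fun=> c) a.
Proof.
apply: (@analytic_of_cdiff _ _ (fun=> 0)); apply: nearW => z.
- exact: cdiff_cst.
- exact: cvg_cst.
Qed.

Lemma analytic_id a : analytic_at (fun z => z) a.
Proof.
apply: (@analytic_of_cdiff _ _ (fun=> 1)); apply: nearW => z.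
- exact: cdiff_id.
- exact: cvg_cst.
Qed.

Lemma analyticD f g a : analytic_at f a -> analytic_at g a ->
  analytic_at (fun z => f z + g z) a.
Proof.
move=> /analytic_cdiff[f' /analytic_near_cont cf' df].
move=> /analytic_cdiff[g' /analytic_near_cont cg' dg].
apply: (@analytic_of_cdiff _ _ (fun z => f' z + g' z)).
- by apply: filterS2 df dg => z; exact: cdiffD.
- by apply: filterS2 cf' cg' => z H1 H2; exact: (cvgD H1 H2).
Qed.

Lemma analyticM f g a : analytic_at f a -> analytic_at g a ->
  analytic_at (fun z => f z * g z) a.
Proof.
move=> hf hg; have cf := analytic_near_cont hf; have cg := analytic_near_cont hg.
move: hf hg => /analytic_cdiff[f' /analytic_near_cont cf' df].
move=> /analytic_cdiff[g' /analytic_near_cont cg' dg].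
apply: (@analytic_of_cdiff _ _ (fun z => f' z * g z + f z * g' z)).
- by apply: filterS2 df dg => z; exact: cdiffM.
- apply: filterS2 (filterI cf cf') (filterI cg cg') => z [H1 H2] [H3 H4].
  exact: (cvgD (cvgM H2 H3) (cvgM H1 H4)).
Qed.

Lemma analyticN f a : analytic_at f a -> analytic_at (fun z => - f z) a.
Proof.
move=> hf; have := analyticM (analytic_cst (-1) a) hf; apply: analytic_ext.
by apply: nearW => z; rewrite mulN1r.
Qed.

Lemma analyticB f g a : analytic_at f a -> analytic_at g a ->
  analytic_at (fun z => f z - g z) a.
Proof. by move=> hf hg; apply: analyticD hf (analyticN hg). Qed.

Lemma analyticX f a n : analytic_at f a -> analytic_at (fun z => f z ^+ n) a.
Proof.
move=> hf; elim: n => [|n IH].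
  by apply: analytic_ext (analytic_cst 1 a); apply: nearW => z; rewrite expr0.
by apply: analytic_ext (analyticM hf IH); apply: nearW => z; rewrite exprS.
Qed.

Lemma cvg_preimage (T U : topologicalType) (f : T -> U) (p : T) (P : U -> Prop) :
  f @ nbhs p --> f p -> (\forall y \near nbhs (f p), P y) -> \forall x \near nbhs p, P (f x).
Proof. by move=> cf; exact: cf. Qed.

Lemma analytic_comp f g a : analytic_at f a -> analytic_at g (f a) ->
  analytic_at (fun z => g (f z)) a.
Proof.
move=> hf hg; have cf := analytic_near_cont hf; have cfa := analytic_cont hf.
move: hf hg => /analytic_cdiff[f' /analytic_near_cont cf' df].
move=> /analytic_cdiff[g' /analytic_near_cont cg' dg].
apply: (@analytic_of_cdiff _ _ (fun z => g' (f z) * f' z)).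
- by apply: filterS2 df (cvg_preimage cfa dg) => z; exact: cdiff_comp.
- apply: filterS2 (filterI cf cf') (cvg_preimage cfa cg') => z [H1 H2] H3.
  exact: (cvgM (cvg_comp _ _ H1 H3) H2).
Qed.

Lemma analytic_inv a : a != 0 -> analytic_at (fun z => z^-1) a.
Proof.
move=> a0; apply: (@analytic_of_cdiff _ _ (fun z => - (z ^+ 2)^-1)).
- by apply: filterS (near_neq a0) => z; exact: cdiffV.
- apply: filterS (near_neq a0) => z z0; apply: cvgN; apply: cvgV.
    by rewrite expf_neq0.
  exact: (analytic_cont (analyticX 2 (analytic_id z))).
Qed.

Lemma analyticV f a : analytic_at f a -> f a != 0 -> analytic_at (fun z => (f z)^-1) a.
Proof. by move=> hf fa; exact: analytic_comp hf (analytic_inv fa). Qed.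

Lemma analytic_near_neq f a (c : C) : analytic_at f a -> f a != c ->
  \forall z \near nbhs a, f z != c.
Proof.
move=> hf fac; apply: (@cvg_preimage _ _ f a (fun y => y != c)); last exact: near_neq.
exact: analytic_cont.
Qed.

Lemma analytic_order f a : analytic_at f a ->
  (\forall z \near nbhs a, f z = 0) \/
  exists k u, [/\ analytic_at u a, u a != 0 &
    \forall z \near nbhs a, f z = (z - a) ^+ k * u z].
Proof. exact: power_series_order hN _ _. Qed.

Lemma exists_near_neq a (P : C -> Prop) : (\forall z \near nbhs a, P z) ->
  exists2 z, z != a & P z.
Proof.
move=> /(near_close hN)[e e0 He]; have [h h0 he] := small_elt hN e0.
exists (h + a); last by apply: He; rewrite addrK.
by rewrite -subr_eq0 addrK.
Qed.

(** The agreement is asked near points [q] arbitrarily close to [a], the form in which open-closed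
    arguments deliver it. If the difference is [(z - a) ^+ k * u z] with [u] nonvanishing, it can
    vanish only at [a], whereas any neighbourhood of [q] contains a point other than [a]; so [q = a]
    may be allowed. *)
Lemma analytic_identity f g a : analytic_at f a -> analytic_at g a ->
  (forall P : C -> Prop, (\forall z \near nbhs a, P z) ->
    exists2 q, P q & \forall z \near nbhs q, f z = g z) ->
  \forall z \near nbhs a, f z = g z.
Proof.
move=> hf hg H; have [|[k [u [hu ua fg]]]] := analytic_order (analyticB hf hg).
  by apply: filterS => z /eqP; rewrite subr_eq0 => /eqP.
have [q qP fgq] := H _ (near_near (filterI (analytic_near_neq hu ua) fg)).
have [z za] : exists2 z, z != a & [/\ f z = g z, u z != 0 & f z - g z = (z - a) ^+ k * u z].
  have Q : \forall z \near nbhs q, [/\ f z = g z, u z != 0 & f z - g z = (z - a) ^+ k * u z].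
    by apply: filterS2 qP fgq => z [? ?] ?.
  have [qa|qa] := eqVneq q a.
    by rewrite qa in Q; exact: exists_near_neq Q.
  by exists q; last exact: nbhs_singleton Q.
move=> [fgz uz E]; have zk : (z - a) ^+ k * u z != 0.
  by apply: mulf_neq0 uz; apply: expf_neq0; rewrite subr_eq0.
by case/negP: zk; apply/eqP; rewrite -E fgz subrr.
Qed.

Lemma analytic_prim f a : analytic_at f a ->
  exists2 F, analytic_at F a & \forall z \near nbhs a, cdiff F z (f z).
Proof.
move=> hf; have [F dF] := power_series_prim hN hf; exists F; last exact: dF.
by apply: analytic_of_cdiff dF _; exact: analytic_near_cont.
Qed.

Lemma analytic_inverse f f' a : analytic_at f a ->
  (\forall z \near nbhs a, cdiff f z (f' z)) -> f' a != 0 ->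
  exists g, [/\ analytic_at g (f a), g (f a) = a,
    \forall y \near nbhs (f a), f (g y) = y /\ cdiff g y (f' (g y))^-1 &
    \forall z \near nbhs a, g (f z) = z].
Proof.
move=> hf df f'a0.
have hf' : analytic_at f' a.
  have [f1 hf1 df1] := analytic_cdiff hf; apply: analytic_ext hf1.
  by apply: filterS2 df df1 => z H1 H2; exact: cdiff_uniq H2 H1.
have [g [ga cg gP gf]] := power_series_inverse hN hf df hf' f'a0.
exists g; split; [|exact: ga|exact: gP|exact: gf].
have cga : g @ nbhs (f a) --> g (f a) by rewrite ga.
apply: (@analytic_of_cdiff _ _ (fun y => (f' (g y))^-1)).
  by apply: filterS gP => y [].
have E : \forall z \near nbhs (g (f a)), f' z != 0 /\ f' @ nbhs z --> f' z.
  by rewrite ga; exact: filterI (analytic_near_neq hf' f'a0) (analytic_near_cont hf').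
apply: filterS2 gP (cvg_preimage cga E) => y [_ dg] [n0 cf'].
by apply: cvgV n0 _; exact: (cvg_comp _ _ (cdiff_cont dg) cf').
Qed.

(** One k-th root of [f a] is nonzero, so the k-th power is locally invertible there; compose its
    inverse with [f]. *)
Lemma analytic_root f a k : (0 < k)%N -> analytic_at f a -> f a != 0 ->
  exists v, [/\ analytic_at v a, v a != 0 & \forall z \near nbhs a, v z ^+ k = f z].
Proof.
move=> k0 hf fa0; pose w0 : C := (k.-root (f a : R[i]))%C.
have w0k : w0 ^+ k = f a by apply: (@rootCK R[i]).
have w00 : w0 != 0 by apply: contraNneq fa0; rewrite -w0k => ->; rewrite expr0n gtn_eqF.
have d0 : (k%:R * w0 ^+ k.-1 : C) != 0 by rewrite mulf_neq0 ?expf_neq0 // pnatr_eq0 -lt0n.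
have dX : \forall z \near nbhs w0, cdiff (fun z : C => z ^+ k) z (k%:R * z ^+ k.-1).
  by apply: nearW => z; exact: cdiffX.
have [g [hg ga gP _]] := analytic_inverse (analyticX k (analytic_id w0)) dX d0.
rewrite w0k in hg ga gP.
exists (fun z => g (f z)); split.
- exact: analytic_comp hf hg.
- by rewrite ga.
- apply: (@cvg_preimage _ _ f a (fun y => g y ^+ k = y)); first exact: analytic_cont.
  by apply: filterS gP => y [].
Qed.

(** A root of 1 + X + ... + X^(k-1), which is not constant for k > 1 and takes the value k at 1. *)
Lemma nontrivial_unity_root k : (1 < k)%N -> exists2 x : C, x ^+ k = 1 & x != 1.
Proof.
move=> k1; pose p : {poly R[i]} := \sum_(i < k) 'X^i.
have p1 : p.[1] = k%:R.
  rewrite /p horner_sum (eq_bigr (fun=> 1)) => [|i _]; last by rewrite hornerXn expr1n.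
  by rewrite sumr_const card_ord.
have sp : size p != 1%N.
  have E : ('X - 1%:P) * p = 'X^k - 1 by rewrite /p subrX1.
  have k0 : (0 < k)%N by exact: ltnW.
  apply/negP => /eqP sp1; have /size_poly1P[c c0 pc] : size p == 1%N by rewrite sp1.
  have := congr1 (fun q : {poly R[i]} => size q) E.
  rewrite pc mulrC mul_polyC size_scale // size_XsubC size_XnsubC // => -[kE].
  by move: k1; rewrite -kE.
have [x /rootP px] := closed_rootP _ sp; exists x.
- have := congr1 (fun q : {poly R[i]} => q.[x]) (subrX1 ('X : {poly R[i]}) k).
  rewrite hornerM -/p px mulr0 !hornerE => /eqP.
  by rewrite subr_eq0 => /eqP.
- apply/negP => /eqP x1; move: px; rewrite x1 p1 => /eqP.
  by rewrite pnatr_eq0 gtn_eqF // ltnW.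
Qed.

Lemma line_FTC F f a (v : C) :
  (forall s : R, 0 <= s <= 1 -> cdiff F (a + s%:C%C * v) (f (a + s%:C%C * v))) ->
  (forall s : R, 0 <= s <= 1 -> f @ nbhs (a + s%:C%C * v) --> f (a + s%:C%C * v)) ->
  cintegral (fun s => v * f (a + s%:C%C * v)) = F (a + v) - F a.
Proof.
move=> dF cf; rewrite (cintegral_FTC (F := fun s => F (a + s%:C%C * v))).
- by rewrite (rmorph0 (real_complex R)) (rmorph1 (real_complex R)) mul1r mul0r addr0.
- move=> s s01; apply: cvgM; first exact: cvg_cst.
  exact: (cvg_comp _ _ (rdiff_cont (rdiff_line a v s)) (cf s s01)).
- by move=> s s01; rewrite mulrC; exact: rdiff_comp (rdiff_line a v s) (dF s s01).
Qed.

Lemma segment_in a z (r s : R) : cabs (z - a) < r -> 0 <= s <= 1 ->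
  cabs (a + s%:C%C * (z - a) - a) < r.
Proof.
move=> zr /andP[s0 s1]; rewrite addrC addKr (absM hN) cabs_rc ger0_norm //.
have := abs_ge0 hN (z - a); nra.
Qed.

Lemma cdiff0_const f a : (\forall z \near nbhs a, cdiff f z 0) ->
  \forall z \near nbhs a, f z = f a.
Proof.
move=> /(near_close hN)[e e0 He]; apply/(abs_near hN); exists e => // z za.
have := @line_FTC f (fun=> 0) a (z - a).
rewrite (_ : cintegral _ = 0); last first.
  rewrite (cintegral_FTC (F := fun=> 0)) ?subrr //.
    by move=> s _; exact: cvg_cst.
  by move=> s _; rewrite mulr0; exists (fun=> 0); split => [||x]; [exact: cvg_cst|by []|rewrite mul0r addr0].
have -> : a + (z - a) = z by ring.
move=> H; apply/eqP; rewrite -subr_eq0; apply/eqP; symmetry; apply: H => s s01.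
- by apply: He; exact: segment_in.
- exact: cvg_cst.
Qed.

End Analytic.

(** * Connectedness arguments and first exit times *)

Lemma nearI (T : topologicalType) (p : T) (P Q : T -> Prop) :
  (\forall x \near nbhs p, P x) -> (\forall x \near nbhs p, Q x) ->
  \forall x \near nbhs p, P x /\ Q x.
Proof. exact: filterI. Qed.

(** The open-closed argument relative to [A], behind the identity theorem on a punctured disc,
    induction along continuations, and the proof that the branches lie over all of M \ S. *)
Lemma connected_forall (T : topologicalType) (A : set T) (P : T -> Prop) :
  connected A -> (exists2 a, A a & P a) ->
  (forall x, A x -> P x -> \forall y \near nbhs x, A y -> P y) ->
  (forall x, A x -> (forall U, nbhs x U -> exists y, [/\ U y, A y & P y]) -> P x) ->
  forall x, A x -> P x.
Proof.
move=> cA [a Aa Pa] oP clP x Ax.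
suff E : A `&` [set y | P y] = A by have := Ax; rewrite -{1}E => -[].
apply: cA.
- by exists a.
- exists (interior [set y | A y -> P y]); first exact: open_interior.
  apply/seteqP; split=> y [Ay Py]; split=> //; first exact: oP.
  exact: (interior_subset Py).
- exists (closure (A `&` [set y | P y])); first exact: closed_closure.
  apply/seteqP; split=> y [Ay Py]; split=> //; first exact: subset_closure.
  apply: clP => // U /Py [z [[Az Pz] Uz]]; by exists z.
Qed.

Section FirstExit.
Variable R : realType.

(** The time is the infimum of the bad parameters; [P] being open in the interval, the infimum is
    itself bad. *)
Lemma first_exit (P : R -> Prop) : P 0 -> ~ P 1 ->
  (forall s : R, 0 <= s <= 1 -> P s -> \forall x \near nbhs s, 0 <= x <= 1 -> P x) ->
  exists t : R, [/\ 0 < t <= 1, ~ P t & forall s, 0 <= s < t -> P s].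
Proof.
move=> P0 P1 oP; pose B := [set s : R | 0 <= s <= 1 /\ ~ P s].
have B1 : B 1 by split=> //; rewrite ler01 lexx.
have hB : has_inf B.
  by split; [exists 1|exists 0 => s [/andP[]]].
have i0 : 0 <= inf B by apply: lb_le_inf; [exists 1|move=> s [/andP[]]].
have i1 : inf B <= 1 by apply: ge_inf => //; case: hB.
have nP : ~ P (inf B).
  move=> /(oP _ _)[]; first by rewrite i0 i1.
  move=> e /= e0 He; have [b [b01 nPb] be] := inf_adherent e0 hB.
  have ib : inf B <= b by apply: ge_inf; [case: hB|split].
  apply: nPb; apply: He => //=; rewrite ltr_norml.
  by apply/andP; split; lra.
exists (inf B); split=> //.
- rewrite i1 andbT lt_neqAle i0 andbT; apply/negP => /eqP i0E.
  by apply: nP; rewrite -i0E.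
- move=> s /andP[s0 si]; apply: contrapT => nPs.
  have : inf B <= s by apply: ge_inf; [case: hB|split=> //; rewrite s0 (le_trans (ltW si))].
  by rewrite leNgt si.
Qed.

Local Notation C := (cplx R).
Let hN := complete_cabs R.

Lemma unit_interval_connected : connected (`[0, 1]%classic : set R).
Proof. by apply/connected_intervalP => x y; rewrite /= !in_itv /= => /andP[x0 x1] /andP[y0 y1] z /andP[xz zy]; rewrite in_itv /= (le_trans x0 xz) (le_trans zy y1). Qed.

Lemma convex_connected (A : set C) (a : C) : A a ->
  (forall z (s : R), A z -> 0 <= s <= 1 -> A (a + s%:C%C * (z - a))) -> connected A.
Proof.
move=> Aa cvA.
have -> : A = \bigcup_(z in A) ((fun s : R => a + s%:C%C * (z - a)) @` `[0, 1]%classic).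
  apply/seteqP; split=> [z Az|z [w Aw [s]]].
    exists z => //; exists 1; rewrite /= ?in_itv /= ?ler01 ?lexx //.
    by rewrite (rmorph1 (real_complex R)) mul1r addrC subrK.
  by rewrite /= in_itv /= => s01 <-; exact: cvA.
apply: bigcup_connected.
  exists a => z Az; exists 0; rewrite /= ?in_itv /= ?ler01 ?lexx //.
  by rewrite (rmorph0 (real_complex R)) mul0r addr0.
move=> z Az; apply: connected_continuous_connected; first exact: unit_interval_connected.
by apply: continuous_subspaceT => s; exact: rdiff_cont (rdiff_line a (z - a) s).
Qed.

Definition punctured (r : R) : set C := [set z | 0 < cabs z < r].

(** The punctured disc is the union of its right, upper, left and lower open halves, each convex;
    corner points with coordinates [e] or [- e] lie in two adjacent halves. *)
Lemma punctured_connected (r : R) : 0 < r -> connected (punctured r).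
Proof.
move=> r0; pose H (T : C -> R) : set C := [set z | 0 < T z /\ cabs z < r].
have TT (T : C -> R) (a : C) : (forall z w, T (z + w) = T z + T w) ->
    (forall z w, T (z - w) = T z - T w) ->
    (forall (s : R) z, T (s%:C%C * z) = s * T z) -> H T a -> connected (H T).
  move=> TD TB TZ Ha; apply: (convex_connected Ha) => z s [Tz rz] /andP[s0 s1].
  case: Ha => Ta ra; split; first by rewrite TD TZ TB; nra.
  have -> : a + s%:C%C * (z - a) = (1 - s)%:C%C * a + s%:C%C * z.
    by rewrite (rmorphB (real_complex R)) (rmorph1 (real_complex R)); ring.
  apply: le_lt_trans (absD hN _ _) _; rewrite !(absM hN) !cabs_rc !ger0_norm ?subr_ge0 //.
  have [->|s0'] := eqVneq s 0; first by rewrite subr0 mul1r mul0r addr0.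
  have s00 : 0 < s by rewrite lt_neqAle eq_sym s0' s0.
  have := abs_ge0 hN a; have := abs_ge0 hN z; nra.
pose e := r / 4; have e0 : 0 < e by rewrite divr_gt0.
pose Re := @complex.Re R; pose Im := @complex.Im R.
have small (x y : R) : `|x| = e -> `|y| = e -> cabs ((x +i* y)%C : C) < r.
  move=> xe ye; apply: le_lt_trans (cabs_le _) _; rewrite /= xe ye /e; lra.
have ee : `|e| = e by rewrite ger0_norm // ltW.
have nee : `|- e| = e by rewrite normrN.
have c1 : connected (H Re).
  by apply: (TT Re (e +i* e)%C) => // [[? ?] [? ?]|[? ?] [? ?]|s [x y]|]; rewrite /Re /= ?mul0r ?subr0 //; split => //=; exact: small.
have c2 : connected (H Im).
  by apply: (TT Im (e +i* e)%C) => // [[? ?] [? ?]|[? ?] [? ?]|s [x y]|]; rewrite /Im /= ?mul0r ?addr0 //; split => //=; exact: small.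
have c3 : connected (H (fun z => - Re z)).
  apply: (TT _ ((- e) +i* (- e))%C) => // [[? ?] [? ?]|[? ?] [? ?]|s [x y]|]; rewrite /Re /= ?mul0r ?subr0 ?mulrN ?opprD //.
  by split => /=; rewrite ?opprK //; exact: small.
have c4 : connected (H (fun z => - Im z)).
  apply: (TT _ ((- e) +i* (- e))%C) => // [[? ?] [? ?]|[? ?] [? ?]|s [x y]|]; rewrite /Im /= ?mul0r ?addr0 ?mulrN ?opprD //.
  by split => /=; rewrite ?opprK //; exact: small.
have -> : punctured r = (H Re `|` H Im) `|` (H (fun z => - Re z) `|` H (fun z => - Im z)).
  apply/seteqP; split=> [z /andP[z0 zr]|z].
    have [x0|x0|x0] := ltgtP (Re z) 0.
    - by right; left; split => //; rewrite oppr_gt0.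
    - by left; left.
    - have [y0|y0|y0] := ltgtP (Im z) 0.
      + by right; right; split => //; rewrite oppr_gt0.
      + by left; right.
      + have zE : z = 0 by exact: ReIm_eq.
        by move: z0; rewrite zE (abs0 hN) ltxx.
  have R0 : Re z != 0 -> 0 < cabs z.
    by move=> x0; apply: lt_le_trans (cabs_Re z); rewrite normr_gt0.
  have I0 : Im z != 0 -> 0 < cabs z.
    by move=> x0; apply: lt_le_trans (cabs_Im z); rewrite normr_gt0.
  rewrite /punctured /= => -[[]|[]] [h1 ->]; rewrite andbT.
  - by apply: R0; rewrite gt_eqF.
  - by apply: I0; rewrite gt_eqF.
  - by apply: R0; rewrite lt_eqF // -oppr_gt0.
  - by apply: I0; rewrite lt_eqF // -oppr_gt0.
apply: connectedU; last 2 first.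
- by apply: connectedU => //; exists (e +i* e)%C; split; split => //=; exact: small.
- by apply: connectedU => //; exists ((- e) +i* (- e))%C; split; split => /=; rewrite ?opprK //; exact: small.
- exists ((- e) +i* e)%C; split; [right|left]; split => /=; rewrite ?opprK //; exact: small.
Qed.

End FirstExit.

(** * Neighbourhoods and continuity read in a chart *)

Section Charts.
Variables (R : realType) (T : topologicalType) (c : chart R T).
Hypothesis hc : is_chart c.
Local Notation C := (cplx R).

Lemma chart_open : open (cdom c).
Proof. by case: hc. Qed.

Lemma chartK p : cdom c p -> cinv c (cmap c p) = p.
Proof. by case: hc => _ cK _ dp; apply: cK; rewrite inE. Qed.

Lemma chart_image_open (U : set T) : U `<=` cdom c -> open (cmap c @` U) <-> open U.
Proof. by case: hc => _ _ H /H; exact: iff_sym. Qed.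

Lemma chart_near p (P : T -> Prop) : cdom c p ->
  (\forall q \near nbhs p, P q) <-> \forall w \near nbhs (cmap c p), P (cinv c w).
Proof.
move=> dp; split=> [|H].
  rewrite nbhsE => -[U [oU Up] UP].
  rewrite nbhsE; exists (cmap c @` (U `&` cdom c)).
    split; last by exists p.
    by apply/chart_image_open; [exact: subIsetr|apply: openI oU chart_open].
  by move=> w [q [Uq dq] <-]; rewrite chartK //; exact: UP.
rewrite nbhsE in H; case: H => V [oV Vp] VP.
rewrite nbhsE; exists (cdom c `&` cmap c @^-1` V); last first.
  by move=> q [dq /VP]; rewrite /= chartK.
split; last by split.
apply/chart_image_open; first exact: subIsetl.
have -> : cmap c @` (cdom c `&` cmap c @^-1` V) = V `&` (cmap c @` cdom c).
  apply/seteqP; split=> [w [q [dq Vq] <-]|w [Vw [q dq qw]]].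
    by split => //; exists q.
  by exists q => //; split => //; rewrite /= qw.
by apply: openI oV _; apply/chart_image_open => //; exact: chart_open.
Qed.

Lemma chart_dom_near p : cdom c p -> \forall q \near nbhs p, cdom c q.
Proof. by move=> dp; apply: open_nbhs_nbhs; split => //; exact: chart_open. Qed.

Lemma chart_inv_near p : cdom c p ->
  \forall w \near nbhs (cmap c p), cdom c (cinv c w) /\ cmap c (cinv c w) = w.
Proof.
move=> dp; rewrite nbhsE; exists (cmap c @` cdom c).
  split; last by exists p.
  by apply/chart_image_open => //; exact: chart_open.
by move=> w [q dq <-]; rewrite chartK.
Qed.

Lemma chart_near_map p (P : C -> Prop) : cdom c p ->
  (\forall w \near nbhs (cmap c p), P w) <-> \forall q \near nbhs p, P (cmap c q).
Proof.
move=> dp; rewrite (chart_near _ dp); split; apply: filterS2 (chart_inv_near dp) => w [_ ->].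
  by [].
by [].
Qed.

Lemma chart_inv_cont p : cdom c p -> cinv c @ nbhs (cmap c p) --> p.
Proof. by move=> dp P HP; apply/(chart_near P dp). Qed.

End Charts.

(** * Trajectories and time functions near a regular point *)

Section Trajectories.
Variables (R : realType) (M : topologicalType) (A : set (chart R M)).
Hypothesis hM : riemann_surface A [set: M].
Variables (S : set M) (X : vfield R M).
Hypothesis hX : singular_vector_field A S X.
Local Notation C := (cplx R).
Implicit Types (c : chart R M) (p q : M) (psi : M -> C) (z : C -> M).

Lemma atlas_chart c : A c -> is_chart c.
Proof. by case: hM => H _ _ _ _; exact: H. Qed.

Lemma atlas_at p : exists2 c, A c & cdom c p.
Proof.
by case: hM => _ E _ _ _; have : (\bigcup_(c in A) cdom c) p by rewrite E.
Qed.

Lemma transition_analytic c1 c2 p : A c1 -> A c2 -> cdom c1 p -> cdom c2 p ->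
  analytic_at (cmap c2 \o cinv c1) (cmap c1 p).
Proof. by case: hM => _ _ H _ _; exact: H. Qed.

Lemma near_regular p : ~ S p -> \forall q \near nbhs p, ~ S q.
Proof.
by move=> Sp; apply: open_nbhs_nbhs; split => //; rewrite openC; exact: svf_closed hX.
Qed.

(** The derivative is nonzero by the chain rule for the inverse transition. The point [p] may be
    singular; the transformation rule of the field is then claimed only at the regular points near
    it. *)
Lemma transition_derivative c1 c2 p : A c1 -> A c2 -> cdom c1 p -> cdom c2 p ->
  exists T' : C -> C, [/\ analytic_at T' (cmap c1 p), T' (cmap c1 p) != 0,
    \forall w \near nbhs (cmap c1 p), cdiff (cmap c2 \o cinv c1) w (T' w) &
    \forall q \near nbhs p, ~ S q -> X c2 (cmap c2 q) = T' (cmap c1 q) * X c1 (cmap c1 q)].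
Proof.
move=> A1 A2 d1 d2; have [h1 h2] := (atlas_chart A1, atlas_chart A2).
have [T' hT' dT'] := analytic_cdiff (transition_analytic A1 A2 d1 d2).
have [U' _ /nbhs_singleton dU'] := analytic_cdiff (transition_analytic A2 A1 d2 d1).
exists T'; split => //.
- have dT := nbhs_singleton dT'.
  have E1 : (cmap c2 \o cinv c1) (cmap c1 p) = cmap c2 p by rewrite /= (chartK h1).
  rewrite -E1 in dU'; have dI := cdiff_comp dT dU'.
  have dI' : cdiff (fun w => w) (cmap c1 p) (U' (cmap c2 p) * T' (cmap c1 p)).
    rewrite -E1; apply: cdiff_near dI.
    have /(chart_near h1 _ d1) : \forall q \near nbhs p, cdom c2 q by exact: chart_dom_near.
    apply: filterS2 (chart_inv_near h1 d1) => w [_ E] dw.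
    by rewrite /= (chartK h2).
  have E := cdiff_uniq dI' (cdiff_id _).
  by apply/negP => /eqP T0; move/eqP: E; rewrite T0 mulr0 eq_sym oner_eq0.
- have /(chart_near_map h1 _ d1) dT := dT'.
  apply: filterS2 (nearI (chart_dom_near h1 d1) (chart_dom_near h2 d2)) dT.
  move=> q [d1q d2q] dT Sq; rewrite (svf_change hX A1 A2 d1q d2q Sq).
  by rewrite (cdiff_derive1 dT).
Qed.

(** A local primitive of the time form. Unlike [time_branch] it refers to no base point, so it makes
    sense for every germ met in a continuation. *)
Definition good_psi psi p := ~ S p /\ exists c, [/\ A c, cdom c p &
  \forall w \near nbhs (cmap c p), cdiff (psi \o cinv c) w (X c w)^-1].

(** A local solution of z' = X(z) through a regular point. Continuity is required separately, since
    the coordinate expression says nothing about [z] outside the domain of the chart. *)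
Definition good_z z t := [/\ ~ S (z t), z @ nbhs t --> z t & exists c,
  [/\ A c, cdom c (z t) &
  \forall t' \near nbhs t, cdiff (cmap c \o z) t' (X c (cmap c (z t')))]].

Lemma field_neq0_near c p : A c -> cdom c p -> ~ S p ->
  \forall w \near nbhs (cmap c p), [/\ ~ S (cinv c w), cdom c (cinv c w),
    cmap c (cinv c w) = w, X c w != 0 & analytic_at (X c) w].
Proof.
move=> Ac dp Sp; have hc := atlas_chart Ac.
have /(chart_near hc _ dp) := near_regular Sp.
apply: filterS2 (chart_inv_near hc dp) => w [dw E] Sw; split => //.
- by rewrite -{1}E; exact: svf_nonzero hX _ _ Ac dw Sw.
- by rewrite -E; exact: svf_analytic hX _ _ Ac dw Sw.
Qed.

(** Invariance of the time form: the derivative of the transition from the chain rule cancels the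
    one in the transformation rule of X. *)
Lemma good_psi_chart psi p c : good_psi psi p -> A c -> cdom c p ->
  \forall w \near nbhs (cmap c p), cdiff (psi \o cinv c) w (X c w)^-1.
Proof.
move=> [Sp [c0 [A0 d0 H0]]] Ac dp; have [h0 hc] := (atlas_chart A0, atlas_chart Ac).
have [T' [_ T0 dT XT]] := transition_derivative Ac A0 dp d0.
have hT : analytic_at (cmap c0 \o cinv c) (cmap c p) by exact: transition_analytic.
have T'0 : \forall w \near nbhs (cmap c p), T' w != 0.
  have [T2 hT2 dT2] := analytic_cdiff hT.
  have E : T2 (cmap c p) = T' (cmap c p) := cdiff_uniq (nbhs_singleton dT2) (nbhs_singleton dT).
  have : T2 (cmap c p) != 0 by rewrite E.
  move=> /(analytic_near_neq hT2); apply: filterS2 (nearI dT2 dT) => w [H1 H2].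
  by rewrite (cdiff_uniq H1 H2).
have E0 : (cmap c0 \o cinv c) (cmap c p) = cmap c0 p by rewrite /= (chartK hc).
have H0' : \forall w \near nbhs (cmap c p), cdiff (psi \o cinv c0) ((cmap c0 \o cinv c) w) (X c0 ((cmap c0 \o cinv c) w))^-1.
  by rewrite -E0 in H0; exact: (cvg_preimage (analytic_cont hT) H0).
move: XT => /(chart_near hc _ dp) XT.
have /(chart_near hc _ dp) D0 := chart_dom_near h0 d0.
have near1 : \forall w \near nbhs (cmap c p), (psi \o cinv c0) ((cmap c0 \o cinv c) w) = (psi \o cinv c) w.
  by apply: filterS D0 => w dw; rewrite /= (chartK h0).
have P1 := nearI (near_near near1) (nearI T'0 dT).
have P2 := nearI H0' (nearI XT (field_neq0_near Ac dp Sp)).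
apply: filterS2 P1 P2 => w [n1 [t0 dtw]] [dpsi [xt [Sw dw Ew x0 _]]].
apply: cdiff_near n1 _; have := cdiff_comp dtw dpsi.
congr (cdiff _ _ _); rewrite /= xt // Ew.
by field; rewrite t0 x0.
Qed.

Lemma good_psi_near psi p : good_psi psi p -> \forall q \near nbhs p, good_psi psi q.
Proof.
move=> [Sp [c [Ac dp H]]]; have hc := atlas_chart Ac.
have /(chart_near_map hc _ dp) H' := near_near H.
apply: filterS2 (nearI (near_regular Sp) (chart_dom_near hc dp)) H' => q [Sq dq] Hq.
by split => //; exists c.
Qed.

Lemma good_psi_analytic_chart psi p c : good_psi psi p -> A c -> cdom c p ->
  analytic_at (psi \o cinv c) (cmap c p).
Proof.
move=> gp Ac dp; have [Sp _] := gp.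
apply: analytic_of_cdiff (good_psi_chart gp Ac dp) _.
apply: filterS (field_neq0_near Ac dp Sp) => w [_ _ _ x0 ax].
by apply: cvgV x0 _; exact: analytic_cont ax.
Qed.

Lemma good_psi_cont psi p : good_psi psi p -> psi @ nbhs p --> psi p.
Proof.
move=> gp; have [c Ac dp] := atlas_at p; have hc := atlas_chart Ac.
have H := analytic_cont (good_psi_analytic_chart gp Ac dp).
move=> P HP; apply/(chart_near hc _ dp); apply: (H P).
by rewrite /= (chartK hc).
Qed.

Lemma good_psi_uniq psi1 psi2 p : good_psi psi1 p -> good_psi psi2 p ->
  psi1 p = psi2 p -> \forall q \near nbhs p, psi1 q = psi2 q.
Proof.
move=> g1 g2 E; have [c Ac dp] := atlas_at p; have hc := atlas_chart Ac.
have : \forall w \near nbhs (cmap c p), cdiff (fun w => (psi1 \o cinv c) w - (psi2 \o cinv c) w) w 0.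
  apply: filterS2 (good_psi_chart g1 Ac dp) (good_psi_chart g2 Ac dp) => w H1 H2.
  by rewrite -(subrr (X c w)^-1); exact: cdiffB.
move=> /cdiff0_const H; apply/(chart_near hc _ dp); apply: filterS H => w.
by rewrite /= (chartK hc) // E subrr => /eqP; rewrite subr_eq0 => /eqP.
Qed.

Lemma good_psi_exists p (t : C) : ~ S p -> exists2 psi, good_psi psi p & psi p = t.
Proof.
move=> Sp; have [c Ac dp] := atlas_at p; have hc := atlas_chart Ac.
have [_ _ _ x0 ax] := nbhs_singleton (field_neq0_near Ac dp Sp).
have [F _ dF] := analytic_prim (analyticV ax x0).
exists (fun q => F (cmap c q) + (t - F (cmap c p))); last by rewrite addrC subrK.
split => //; exists c; split => //.
apply: filterS2 dF (near_near (chart_inv_near hc dp)) => w dFw Ew.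
have := cdiffD dFw (cdiff_cst (t - F (cmap c p)) w); rewrite addr0.
by apply: cdiff_near; apply: filterS Ew => w' [_ /= ->].
Qed.

Lemma good_psi_analytic psi p : good_psi psi p -> analytic_map A (@plane_atlas R) psi p.
Proof.
move=> gp; split; first exact: good_psi_cont.
move=> c1 c2 A1 -> d1 _; exact: good_psi_analytic_chart.
Qed.

Lemma good_z_dom z t c : good_z z t -> cdom c (z t) -> A c -> \forall t' \near nbhs t, cdom c (z t').
Proof.
by move=> [_ cz _] dz Ac; exact: (cvg_preimage cz (chart_dom_near (atlas_chart Ac) dz)).
Qed.

Lemma good_z_chart z t c : good_z z t -> A c -> cdom c (z t) ->
  \forall t' \near nbhs t, cdiff (cmap c \o z) t' (X c (cmap c (z t'))).
Proof.
move=> gz Ac dz; have [Sz cz [c0 [A0 d0 H0]]] := gz.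
have [h0 hc] := (atlas_chart A0, atlas_chart Ac).
have [T' [_ _ dT XT]] := transition_derivative A0 Ac d0 dz.
have dT' : \forall t' \near nbhs t, cdiff (cmap c \o cinv c0) (cmap c0 (z t')) (T' (cmap c0 (z t'))).
  by have /(chart_near_map h0 _ d0) dT1 := dT; exact: (cvg_preimage cz dT1).
have XT' := cvg_preimage cz (nearI XT (near_regular Sz)).
have D0 := good_z_dom gz d0 A0.
apply: filterS2 (nearI H0 (near_near D0)) (nearI dT' XT').
move=> t' [H1 D1] [H2 [H3 S1]]; have := cdiff_comp H1 H2; rewrite H3 //.
by apply: cdiff_near; apply: filterS D1 => t2 d2; rewrite /= (chartK h0).
Qed.

Lemma cont_of_chart z t c : A c -> (\forall t' \near nbhs t, cdom c (z t')) ->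
  (cmap c \o z) @ nbhs t --> cmap c (z t) -> z @ nbhs t --> z t.
Proof.
move=> Ac D H P HP; have hc := atlas_chart Ac; have dz := nbhs_singleton D.
move/(chart_near hc _ dz) : HP => /H H1.
by apply: filterS2 D H1 => t' d' /=; rewrite (chartK hc).
Qed.

Lemma good_z_near z t : good_z z t -> \forall t' \near nbhs t, good_z z t'.
Proof.
move=> gz; have [Sz cz [c [Ac dz H]]] := gz.
have D := near_near (good_z_dom gz dz Ac).
apply: filterS2 (nearI D (cvg_preimage cz (near_regular Sz))) (near_near H).
move=> t' [D' S'] H'; split => //; last by exists c; split => //; exact: nbhs_singleton D'.
apply: (cont_of_chart Ac D'); exact: cdiff_cont (nbhs_singleton H').
Qed.

Lemma good_z_analytic_chart z t c : good_z z t -> A c -> cdom c (z t) ->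
  analytic_at (cmap c \o z) t.
Proof.
move=> gz Ac dz; have hc := atlas_chart Ac; have [Sz cz _] := gz.
have H := good_z_chart gz Ac dz.
apply: (analytic_of_cdiff H); have cu := near_near H.
have /(chart_near_map hc _ dz) X1 := field_neq0_near Ac dz Sz.
apply: filterS2 H (cvg_preimage cz X1) => t' /cdiff_cont c1 [_ _ _ _ /analytic_cont c2].
exact: (cvg_comp _ _ c1 c2).
Qed.

Lemma good_z_analytic z t : good_z z t -> analytic_map (@plane_atlas R) A z t.
Proof.
move=> gz; split; first by case: gz.
by move=> c1 c2 -> A2 _ d2; exact: good_z_analytic_chart.
Qed.

(** The derivative of [psi (z t') - t'] is 1/X times X minus 1, which is 0. *)
Lemma good_psi_z psi z t : good_psi psi (z t) -> good_z z t -> psi (z t) = t ->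
  \forall t' \near nbhs t, psi (z t') = t'.
Proof.
move=> gp gz E; have [Sz cz [c [Ac dz _]]] := gz; have hc := atlas_chart Ac.
have H := good_z_chart gz Ac dz; have H2 := good_psi_chart gp Ac dz.
have H2' : \forall t' \near nbhs t, cdiff (psi \o cinv c) (cmap c (z t')) (X c (cmap c (z t')))^-1.
  by have /(chart_near_map hc _ dz) H3 := H2; exact: (cvg_preimage cz H3).
have /(chart_near_map hc _ dz) X1 := field_neq0_near Ac dz Sz.
have D := near_near (good_z_dom gz dz Ac).
have : \forall t' \near nbhs t, cdiff (fun t' => psi (z t') - t') t' 0.
  apply: filterS2 (nearI H D) (nearI H2' (cvg_preimage cz X1)).
  move=> t' [H1 D1] [H3 [_ _ _ x0 _]]; have := cdiff_comp H1 H3; rewrite mulVf //.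
  rewrite -(subrr 1) => H4; apply: cdiffB; last exact: cdiff_id.
  by apply: cdiff_near H4; apply: filterS D1 => t2 d2; rewrite /= (chartK hc).
move=> /cdiff0_const; apply: filterS => t'; rewrite E subrr => /eqP.
by rewrite subr_eq0 => /eqP.
Qed.

(** The derivative 1/X of [psi] does not vanish, and its local inverse has derivative X, hence
    solves the equation. *)
Lemma good_z_exists psi p : good_psi psi p -> exists z,
  [/\ z (psi p) = p, good_z z (psi p) & \forall q \near nbhs p, z (psi q) = q].
Proof.
move=> gp; have [Sp _] := gp; have [c Ac dp] := atlas_at p; have hc := atlas_chart Ac.
have x0 : (X c (cmap c p))^-1 != 0.
  by rewrite invr_neq0 //; exact: svf_nonzero hX _ _ Ac dp Sp.
have [g [ag ga gP gf]] := analytic_inverse (good_psi_analytic_chart gp Ac dp)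
  (good_psi_chart gp Ac dp) x0.
have E : (psi \o cinv c) (cmap c p) = psi p by rewrite /= (chartK hc).
rewrite E in ag ga gP.
have cg : g @ nbhs (psi p) --> cmap c p by rewrite -ga; exact: analytic_cont.
have N1 : \forall t \near nbhs (psi p), cdom c (cinv c (g t)) /\ cmap c (cinv c (g t)) = g t.
  have H := chart_inv_near hc dp; rewrite -ga in H.
  exact: (cvg_preimage (analytic_cont ag) H).
have zp : cinv c (g (psi p)) = p by rewrite ga (chartK hc).
exists (cinv c \o g); split => //=.
- split; rewrite /= ?zp //.
    exact: (cvg_comp _ _ cg (chart_inv_cont hc dp)).
  exists c; split => //.
  apply: filterS2 gP (near_near N1) => t [_ dg] N2.
  have [_ E2] := nbhs_singleton N2.
  rewrite /= E2 -(invrK (X c (g t))); apply: cdiff_near dg.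
  by apply: filterS N2 => t' [_ /= ->].
- apply/(chart_near hc _ dp); apply: filterS2 gf (chart_inv_near hc dp) => w /= -> [_ _].
  by [].
Qed.

(** A common time function [psi] satisfies [psi (z1 t') = t' = psi (z2 t')] and is injective near
    the common position. *)
Lemma good_z_uniq z1 z2 t : good_z z1 t -> good_z z2 t -> z1 t = z2 t ->
  \forall t' \near nbhs t, z1 t' = z2 t'.
Proof.
move=> g1 g2 E; have [S1 c1 _] := g1; have [psi gp pt] := good_psi_exists t S1.
have [z [_ _ zE]] := good_z_exists gp.
have H1 := good_psi_z gp g1 pt.
have gp2 := gp; rewrite E in gp2; have pt2 := pt; rewrite E in pt2.
have H2 := good_psi_z gp2 g2 pt2.
have Z1 := cvg_preimage c1 zE; rewrite E in zE.
have [_ c2 _] := g2; have Z2 := cvg_preimage c2 zE.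
apply: filterS2 (nearI H1 H2) (nearI Z1 Z2) => t' [h1 h2] [e1 e2].
by rewrite -e1 -e2 h1 h2.
Qed.

Lemma good_z_psi psi z t : good_psi psi (z t) -> good_z z t -> psi (z t) = t ->
  \forall q \near nbhs (z t), z (psi q) = q.
Proof.
move=> gp gz E; have [z' [zp gz' zE]] := good_z_exists gp; rewrite E in zp gz'.
have H := good_z_uniq gz gz' (esym zp); rewrite -E in H.
apply: filterS2 zE (good_psi_cont gp H) => q H1 /= ->.
exact: H1.
Qed.

End Trajectories.

(** * Trajectories do not reach the singular set *)

Section Singular.
Variables (R : realType) (M : topologicalType) (A : set (chart R M)).
Hypothesis hM : riemann_surface A [set: M].
Variables (S : set M) (X : vfield R M).
Hypothesis hX : singular_vector_field A S X.
Local Notation C := (cplx R).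
Let hN := complete_cabs R.
Implicit Types (c : chart R M) (p q : M).

Lemma within01P (T : topologicalType) (f : R -> T) :
  {within `[0, 1], continuous f} <-> forall s : R, 0 <= s <= 1 -> forall P : T -> Prop,
    (\forall y \near nbhs (f s), P y) -> \forall x \near nbhs s, 0 <= x <= 1 -> P (f x).
Proof.
split=> [/subspace_continuousP H s s01 P HP|H].
  have s01' : (`[0, 1]%classic : set R) s by rewrite /= in_itv.
  have H2 : \forall x \near nbhs s, (`[0, 1]%classic : set R) x -> P (f x) := H s s01' P HP.
  by apply: filterS H2 => x Hx x01; apply: Hx; rewrite /= in_itv.
apply/subspace_continuousP => s; rewrite /= in_itv /= => s01 P HP.
by apply: filterS (H s s01 P HP) => x; rewrite /= in_itv.
Qed.

Lemma near_left1 (T : topologicalType) (f : R -> T) (P : T -> Prop) :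
  {within `[0, 1], continuous f} -> (\forall y \near nbhs (f 1), P y) ->
  \forall s \near (1 : R)^'-, 0 <= s < 1 /\ P (f s).
Proof.
move=> /within01P H HP; have h01 : 0 <= (1 : R) <= 1 by rewrite ler01 lexx.
have [e /= e0 He] := H 1 h01 P HP.
exists (Num.min e 1); first by rewrite /= lt_min e0 ltr01.
move=> s /=; rewrite lt_min => /andP[se s1] sl.
have s0 : 0 <= s by move: s1; rewrite ltr_norml => /andP[_]; lra.
by split; [rewrite s0|apply: He => //; rewrite s0 ltW].
Qed.

Lemma dnbhs_near (a : C) (P : C -> Prop) : (\forall w \near a^', P w) ->
  \forall z \near nbhs a, z != a -> \forall w \near nbhs z, P w.
Proof.
move=> H; have H' : \forall w \near nbhs a, w != a -> P w by [].
apply: filterS (near_near H') => z Hz za.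
by apply: filterS2 Hz (near_neq za) => w; apply.
Qed.

Lemma near_translate (a x : C) (P : C -> Prop) :
  (\forall w \near nbhs (a + x), P w) <-> \forall y \near nbhs x, P (a + y).
Proof.
split=> /(near_close hN)[e e0 He]; apply/(abs_near hN); exists e => // w wx.
  by apply: He; rewrite (_ : a + w - (a + x) = w - x) //; ring.
rewrite (_ : w = a + (w - a)); last by ring.
by apply: He; rewrite (_ : w - a - x = w - (a + x)) //; ring.
Qed.

Lemma near_punctured (r : R) (x : C) : punctured r x -> \forall y \near nbhs x, punctured r y.
Proof.
move=> /andP[x0 xr]; apply/(abs_near hN); exists (Num.min (cabs x) (r - cabs x)).
  by rewrite lt_min x0 subr_gt0.
move=> w; rewrite lt_min => /andP[w1 w2].
have := absD hN (w - x) x; rewrite subrK => H1.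
have := absB hN w (w - x); rewrite (_ : w - (w - x) = x); last by ring.
by move=> H2; apply/andP; split; lra.
Qed.

Lemma punctured_identity (F G : C -> C) (a : C) (r : R) : 0 < r ->
  (forall x, punctured r x -> analytic_at F (a + x) /\ analytic_at G (a + x)) ->
  (exists2 x, punctured r x & \forall w \near nbhs (a + x), F w = G w) ->
  forall x, punctured r x -> \forall w \near nbhs (a + x), F w = G w.
Proof.
move=> r0 HFG Hx; apply: connected_forall (punctured_connected r0) Hx _ _.
- move=> x Hx /near_near /near_translate; apply: filterS => y Hy _; exact: Hy.
- move=> x Hx H; have [aF aG] := HFG x Hx.
  apply: (analytic_identity aF aG) => P /near_translate HP.
  by have [y [Py _ Hy]] := H _ HP; exists (a + y).
Qed.

(** A continuation [g] of X along a path is given in one chart, the type of the singularity in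
    another. The transported function stays nonzero and agrees with X on open sets accumulating at
    [p], but perhaps not on a full punctured neighbourhood. *)
Lemma continuation_chart c c' p (g : C -> C) (beta : R -> M) :
  A c -> A c' -> cdom c p -> cdom c' p ->
  analytic_at g (cmap c p) -> g (cmap c p) != 0 ->
  {within `[0, 1], continuous beta} -> beta 1 = p -> S p ->
  (forall s, 0 <= s < 1 -> ~ S (beta s)) ->
  (\forall s \near (1 : R)^'-, \forall w \near nbhs (cmap c (beta s)), X c w = g w) ->
  exists g', [/\ analytic_at g' (cmap c' p), g' (cmap c' p) != 0 &
    forall P : C -> Prop, (\forall w \near nbhs (cmap c' p), P w) -> exists w,
      [/\ P w, w != cmap c' p & \forall w' \near nbhs w, X c' w' = g' w']].
Proof.
move=> Ac Ac' dp dp' ag g0 cb b1 Sp Sb Hb.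
have [hc hc'] := (atlas_chart hM Ac, atlas_chart hM Ac').
have [T' [aT T0 _ XT]] := transition_derivative hM hX Ac Ac' dp dp'.
have atr := transition_analytic hM Ac' Ac dp' dp.
have E : (cmap c \o cinv c') (cmap c' p) = cmap c p by rewrite /= (chartK hc').
exists (fun w => T' ((cmap c \o cinv c') w) * g ((cmap c \o cinv c') w)); split.
- by apply: analyticM; apply: (analytic_comp atr); rewrite E.
- by rewrite E mulf_neq0.
move=> P /(chart_near_map hc' _ dp') HP.
have HQ := nearI (near_join XT) (nearI HP (nearI (chart_dom_near hc dp) (chart_dom_near hc' dp'))).
rewrite -b1 in HQ; have HQ' := near_left1 cb HQ.
have [s [[s01 [XTs [Ps [ds ds']]]] Hs]] := filter_ex (filterI HQ' Hb).
have Ss := Sb s s01; exists (cmap c' (beta s)); split => //.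
  apply/negP => /eqP Ebp; apply: Ss.
  by rewrite -(chartK hc' ds') Ebp (chartK hc').
have R1 := near_regular hX Ss.
have /(chart_near_map hc _ ds) Hs' := Hs.
have /(chart_near hc' _ ds') := nearI XTs (nearI R1 Hs').
apply: filterS2 (chart_inv_near hc' ds') => w [dw Ew] [X1 [S1 H1]].
by rewrite -{1}Ew X1 // H1 /=.
Qed.

(** Each kind of singularity contradicts a nonvanishing continuation [g']. At a zero the identity
    theorem gives [g' = g1], which vanishes; at a pole it makes the numerator [g1] vanish at [p]; at
    an isolated essential point X would extend analytically; the nonisolated kind excludes it by
    definition. *)
Lemma regular_endpoint c p (g : C -> C) (beta : R -> M) :
  A c -> cdom c p -> analytic_at g (cmap c p) -> g (cmap c p) != 0 ->
  {within `[0, 1], continuous beta} -> beta 1 = p ->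
  (forall s, 0 <= s < 1 -> ~ S (beta s)) ->
  (\forall s \near (1 : R)^'-, \forall w \near nbhs (cmap c (beta s)), X c w = g w) ->
  ~ S p.
Proof.
move=> Ac dp ag g0 cb b1 Sb Hb Sp.
have [[iso [c' [Ac' dp' [g1 [ag1 g10 Hg1]]]]]|[iso [c' [Ac' dp' [k [g1 [k0 ag1 g10 Hg1]]]]]]
  |[iso [c' [Ac' dp' nex]]]|[_ _ _ ness]] := svf_singular hX Sp.
- have [g' [ag' g'0 acc]] := continuation_chart Ac Ac' dp dp' ag g0 cb b1 Sp Sb Hb.
  have /nbhs_singleton : \forall w \near nbhs (cmap c' p), g' w = g1 w.
    apply: (analytic_identity ag' ag1) => P HP.
    have [w [[Pw Hw] wp Xw]] := acc _ (nearI HP (dnbhs_near Hg1)).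
    exists w; first exact: Pw.
    by apply: filterS2 Xw (Hw wp) => w' -> ->.
  by move=> E; rewrite E g10 eqxx in g'0.
- have [g' [ag' g'0 acc]] := continuation_chart Ac Ac' dp dp' ag g0 cb b1 Sp Sb Hb.
  have /nbhs_singleton : \forall w \near nbhs (cmap c' p), (w - cmap c' p) ^+ k * g' w = g1 w.
    have ap : analytic_at (fun w => (w - cmap c' p) ^+ k * g' w) (cmap c' p).
      apply: analyticM ag'; apply: analyticX.
      by apply: analyticB; [exact: analytic_id|exact: analytic_cst].
    apply: (analytic_identity ap ag1) => P HP.
    have [w [[Pw Hw] wp Xw]] := acc _ (nearI HP (dnbhs_near Hg1)).
    exists w; first exact: Pw.
    apply: filterS2 Xw (nearI (Hw wp) (near_neq wp)) => w' -> [-> wp'].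
    by rewrite mulrC divfK // expf_neq0 // subr_eq0.
  by rewrite subrr expr0n gtn_eqF // mul0r => E; rewrite -E eqxx in g10.
(* Here there is no second analytic function defined at [p] to compare with. As [p] is isolated in
   S, X is analytic on a punctured disc, whose connectedness spreads the equality with [g']; this is
   the excluded presentation with exponent [k = 0]. *)
- have [g' [ag' g'0 acc]] := continuation_chart Ac Ac' dp dp' ag g0 cb b1 Sp Sb Hb.
  apply: nex; exists 0%N, g'; split => //.
  have hc' := atlas_chart hM Ac'.
  have iso' : \forall q \near nbhs p, q <> p -> ~ S q.
    case: iso => _ [V nV VS]; apply: filterS nV => q Vq qp Sq; apply: qp.
    by have : (V `&` S) q by []; rewrite VS.
  have /(chart_near hc' _ dp') H1 := nearI iso' (chart_dom_near hc' dp').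
  have [e e0 He] := near_close hN (nearI (nearI H1 (chart_inv_near hc' dp')) (analytic_near ag')).
  have Hx (x : C) : punctured e x -> analytic_at (X c') (cmap c' p + x) /\ analytic_at g' (cmap c' p + x).
    move=> /andP[x0 xe]; have := He (cmap c' p + x); rewrite addrC addKr => /(_ xe)[[[iS dx] [_ Ex]] ax].
    split; last exact: ax.
    rewrite -Ex; apply: svf_analytic hX _ _ Ac' dx _; apply: iS => Eq.
    move: Ex; rewrite Eq => /esym/eqP; rewrite addrC -subr_eq0 addrK => /eqP x00.
    by move: x0; rewrite x00 (abs0 hN) ltxx.
  have Hall := punctured_identity e0 Hx.
  have Ball : \forall w \near nbhs (cmap c' p), cabs (w - cmap c' p) < e by apply/(abs_near hN); exists e.
  have {}Hall := Hall _.
  have : \forall w \near nbhs (cmap c' p), w != cmap c' p -> X c' w = g' w / (w - cmap c' p) ^+ 0.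
    have pu w : w != cmap c' p -> cabs (w - cmap c' p) < e -> punctured e (w - cmap c' p).
      by move=> wp we; apply/andP; split => //; apply: (abs_gt0 hN); rewrite subr_eq0.
    have tr w : cmap c' p + (w - cmap c' p) = w by ring.
    apply: filterS (Ball) => w we wp; rewrite expr0 divr1.
    have /Hall/(_ _ (pu w wp we)) : exists2 x, punctured e x & \forall w \near nbhs (cmap c' p + x), X c' w = g' w.
      have [w1 [w1e w1p Xw1]] := acc _ Ball; exists (w1 - cmap c' p); first exact: pu.
      by rewrite tr.
    by rewrite tr => /nbhs_singleton.
  by [].
- apply: (ness beta cb b1 Sb); exists c; rewrite b1; split => //.
  by exists g; split.
Qed.

(* The trajectory equation in a coordinate x of time in which the trajectory is
   x |-> a + x ^+ k: with theta = dx/dt, its velocity is k x^(k-1) theta. *)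
Definition branch c (a : C) k (theta : C -> C) (x : C) :=
  ~ S (cinv c (a + x ^+ k)) /\
  \forall y \near nbhs x, X c (a + y ^+ k) = k%:R * y ^+ k.-1 * theta y.

Lemma power_cdiff (a x : C) k : cdiff (fun y => a + y ^+ k) x (k%:R * x ^+ k.-1).
Proof.
by have := cdiffD (cdiff_cst a x) (cdiffX k x); rewrite add0r.
Qed.

Lemma power_analytic (a x : C) k : analytic_at (fun y => a + y ^+ k) x.
Proof. by apply: analyticD; [exact: analytic_cst|apply: analyticX; exact: analytic_id]. Qed.

(** Where the derivative of x |-> a + x^k is nonzero, this map has a local inverse [eta], and [g],
    the velocity rewritten through [eta], continues X regularly along the image of the segment from
    [q] to [x]. This applies to [x] nonzero, and to [x = 0] when k = 1. *)
Lemma branch_endpoint c (a : C) k (theta : C -> C) (x q : C) : A c ->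
  k%:R * x ^+ k.-1 != 0 :> C -> analytic_at theta x -> theta x != 0 ->
  (forall s : R, 0 <= s <= 1 -> let w := a + (q + s%:C%C * (x - q)) ^+ k in
    cdom c (cinv c w) /\ cmap c (cinv c w) = w) ->
  (forall s : R, 0 <= s < 1 -> branch c a k theta (q + s%:C%C * (x - q))) ->
  ~ S (cinv c (a + x ^+ k)).
Proof.
move=> Ac d0 at_ t0 Hd HW; have hc := atlas_chart hM Ac.
pose xi (s : R) : C := q + s%:C%C * (x - q); pose Y (y : C) : C := a + y ^+ k.
have xi1 : xi 1 = x by rewrite /xi (rmorph1 (real_complex R)); ring.
have dY : \forall y \near nbhs x, cdiff Y y (k%:R * y ^+ k.-1).
  by apply: nearW => y; exact: power_cdiff.
have [eta [aeta eta0 Yeta etaY]] := analytic_inverse (power_analytic a x k) dY d0.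
rewrite -/(Y x) in aeta eta0 Yeta.
have [dx Ex] : cdom c (cinv c (Y x)) /\ cmap c (cinv c (Y x)) = Y x.
  by have := Hd 1; rewrite /= -/(xi 1) xi1; apply; rewrite ler01 lexx.
pose g (w : C) := k%:R * eta w ^+ k.-1 * theta (eta w).
have cxi s : xi @ nbhs s --> xi s by exact: rdiff_cont (rdiff_line q (x - q) s).
have cYxi s : (Y \o xi) @ nbhs s --> Y (xi s).
  exact: (cvg_comp _ _ (cxi s) (cdiff_cont (power_cdiff a (xi s) k))).
have cb (s : R) : 0 <= s <= 1 -> (cinv c \o (Y \o xi)) @ nbhs s --> cinv c (Y (xi s)).
  move=> s01; have [ds Es] := Hd s s01.
  have := chart_inv_cont hc ds; rewrite Es => ci.
  exact: (cvg_comp _ _ (cYxi s) ci).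
apply: (@regular_endpoint c _ g (cinv c \o (Y \o xi)) Ac).
- exact: dx.
- rewrite Ex /g; apply: analyticM.
    by apply: analyticM; [exact: analytic_cst|apply: analyticX].
  by apply: (analytic_comp aeta); rewrite eta0; exact: at_.
- by rewrite Ex /g eta0 mulf_neq0.
- apply/within01P => s s01 P HP.
  have H := @cvg_preimage _ _ (cinv c \o (Y \o xi)) s P (cb s s01) HP.
  by apply: filterS H => y Py _; exact: Py.
- by rewrite /= xi1.
- by move=> s s01; have [] := HW s s01.
have N1 := nearI etaY (cvg_preimage (analytic_cont (power_analytic a x k))
  (nearI (near_near Yeta) (analytic_near_cont aeta))).
have N2 : \forall y \near nbhs (xi 1), eta (Y y) = y /\ ((\forall w \near nbhs (Y y), Y (eta w) = w /\ cdiff eta w (k%:R * eta w ^+ k.-1)^-1) /\ eta @ nbhs (Y y) --> eta (Y y)).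
  by rewrite xi1.
have wxi : {within `[0, 1], continuous xi}.
  by apply: continuous_subspaceT => s; exact: cxi.
apply: filterS (near_left1 wxi N2) => s [s01 [e1 [e2 ce]]].
have s01' : 0 <= s <= 1 by move/andP: s01 => [-> /ltW].
have [ds Es] := Hd s s01'; rewrite Es.
have [_ Hs] := HW s s01; rewrite -/(xi s) -{1}e1 in Hs.
by apply: filterS2 e2 (cvg_preimage ce Hs) => w [Ew _] H; rewrite -{1}Ew.
Qed.

(** Openness holds because S is closed. For closedness, a failing limit point is joined to a good
    point by a segment; the first failing point on it is regular by [branch_endpoint], and the
    identity theorem then gives the velocity equation there, a contradiction. *)
Lemma branch_punctured c (a : C) k (theta : C -> C) (r : R) : A c -> (0 < k)%N -> 0 < r ->
  (forall x, cabs x < r -> [/\ cdom c (cinv c (a + x ^+ k)),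
    cmap c (cinv c (a + x ^+ k)) = a + x ^+ k, analytic_at theta x & theta x != 0]) ->
  (exists2 x, punctured r x & branch c a k theta x) ->
  forall x, punctured r x -> branch c a k theta x.
Proof.
have st_lt (s t : R) : 0 <= s -> s < 1 -> 0 < t -> 0 <= s * t < t.
  by move=> s0 s1 t0; rewrite mulr_ge0 ?(ltW t0) //= gtr_pMl.
have lt_near (t e : R) : 0 < t -> 0 < e -> exists2 s : R, 0 <= s < t & `|t - s| < e.
  move=> t0 e0; exists (t - Num.min t e / 2); have m0 : 0 < Num.min t e by rewrite lt_min t0.
    have mt : Num.min t e <= t by rewrite ge_min lexx.
    by apply/andP; split; lra.
  have me : Num.min t e <= e by rewrite ge_min lexx orbT.
  by rewrite ger0_norm; lra.
have st_le (s t : R) : 0 <= s -> s <= 1 -> 0 < t -> t <= 1 -> 0 <= s * t <= 1.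
  by move=> s0 s1 t0 t1; rewrite mulr_ge0 ?(ltW t0) //= mulr_ile1 // ltW.
move=> Ac k0 r0 Hr Hx; have hc := atlas_chart hM Ac.
have kn0 : k%:R != 0 :> C by rewrite pnatr_eq0 -lt0n.
have openB x : cabs x < r -> branch c a k theta x ->
    \forall y \near nbhs x, branch c a k theta y.
  move=> xr [Sx Hx1]; have [dx Ex _ _] := Hr x xr.
  have /(chart_near hc _ dx) := near_regular hX Sx; rewrite Ex => NS.
  have NS' := cvg_preimage (analytic_cont (power_analytic a x k)) NS.
  by apply: filterS2 NS' (near_near Hx1) => y Sy Hy; split.
apply: connected_forall (punctured_connected r0) Hx _ _.
- by move=> x /andP[_ xr] /(openB x xr); apply: filterS.
move=> x1 /[dup] px1 /andP[x10 x1r] acc; apply: contrapT => nB.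
(* A point [q] closer to [x1] than both 0 and the outer circle are: the whole segment from [q] to
   [x1] stays in the punctured disc. *)
pose rho := Num.min (cabs x1) (r - cabs x1).
have rho0 : 0 < rho by rewrite lt_min x10 subr_gt0.
have [q [qrho pq Bq]] : exists y, [/\ cabs (y - x1) < rho, punctured r y & branch c a k theta y].
  by apply: acc; apply/(abs_near hN); exists rho.
pose xi (s : R) : C := q + s%:C%C * (x1 - q).
have xiin (s : R) : 0 <= s <= 1 -> punctured r (xi s).
  move=> /andP[s0 s1]; have Es : xi s - x1 = (1 - s)%:C%C * (q - x1).
    by rewrite /xi (rmorphB (real_complex R)) (rmorph1 (real_complex R)); ring.
  have H1 : cabs (xi s - x1) < rho.
    have s1' : 0 <= 1 - s by rewrite subr_ge0; exact: s1.
    rewrite Es (absM hN) cabs_rc (ger0_norm s1'); apply: le_lt_trans qrho.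
    by apply: ler_piMl; [exact: abs_ge0|lra].
  move: H1; rewrite lt_min => /andP[H1 H2].
  have := absD hN (xi s - x1) x1; rewrite subrK => H3.
  have := absB hN (xi s) (xi s - x1); rewrite (_ : xi s - (xi s - x1) = x1); last by ring.
  by move=> H4; apply/andP; split; lra.
have cxi (s : R) : xi @ nbhs s --> xi s by exact: rdiff_cont (rdiff_line q (x1 - q) s).
have xi0 : xi 0 = q by rewrite /xi (rmorph0 (real_complex R)) mul0r addr0.
have xi1 : xi 1 = x1 by rewrite /xi (rmorph1 (real_complex R)); ring.
have [|||t [/andP[t0 t1] nBt HBt]] := @first_exit R (fun s => branch c a k theta (xi s)).
- by rewrite xi0.
- by rewrite xi1.
- move=> s s01 Bs; have /andP[_ xr] := xiin s s01.
  by apply: filterS (cvg_preimage (cxi s) (openB _ xr Bs)) => y Py _.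
have t01 : 0 <= t <= 1 by rewrite ltW.
have /andP[xt0 xtr] := xiin t t01; have [dt Et at_ tt] := Hr _ xtr.
have Ext (s : R) : xi (s * t) = q + s%:C%C * (xi t - q).
  by rewrite /xi (rmorphM (real_complex R)); ring.
have HW (s : R) : 0 <= s < 1 -> branch c a k theta (q + s%:C%C * (xi t - q)).
  move=> /andP[s0 s1]; rewrite -Ext; apply: HBt.
  exact: st_lt s0 s1 t0.
have xtn0 : xi t != 0.
  by apply/negP => /eqP E; move: xt0; rewrite E (abs0 hN) ltxx.
have d0 : k%:R * xi t ^+ k.-1 != 0 :> C.
  exact: mulf_neq0 kn0 (expf_neq0 k.-1 xtn0).
have St : ~ S (cinv c (a + xi t ^+ k)).
  apply: (@branch_endpoint c a k theta (xi t) q Ac d0 at_ tt _ HW) => s /andP[s0 s1] w.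
  rewrite /w -Ext.
  have /xiin/andP[_ xr] := st_le s t s0 s1 t0 t1.
  by have [dw Ew _ _] := Hr _ xr; split; [exact: dw|exact: Ew].
apply: nBt; split; first exact: St.
have [_ _ _ _ aX] := nbhs_singleton (field_neq0_near hM hX Ac dt St).
rewrite Et in aX.
have aF := analytic_comp (power_analytic a (xi t) k) aX.
have aH : analytic_at (fun y => k%:R * y ^+ k.-1 * theta y) (xi t).
  apply: analyticM at_; apply: analyticM; first exact: analytic_cst.
  by apply: analyticX; exact: analytic_id.
apply: (analytic_identity aF aH) => P HP.
have [e /= e0 He] := cvg_preimage (cxi t) HP.
have [s st se] := lt_near t e t0 e0.
by exists (xi s); [exact: He|have [_ H] := HBt s st; exact: H].
Qed.

(** In a chart about [z t] the map is [a + v ^+ k] for a local coordinate [v] of time, so that near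
    [t] the trajectory takes the form treated by [branch]. Good times accumulating at [t] provide
    one point of the punctured disc at which the velocity equation holds. *)
Lemma no_hit z (t : C) : analytic_map (@plane_atlas R) A z t ->
  (forall P : C -> Prop, (\forall t' \near nbhs t, P t') ->
    exists2 t', P t' & good_z A S X z t') -> ~ S (z t).
Proof.
move=> [cz az] acc Szt; have [c Ac dz] := atlas_at hM (z t).
have hc := atlas_chart hM Ac; set a := cmap c (z t).
have au : analytic_at (cmap c \o z) t by exact: (az _ c erefl Ac).
have D : \forall t' \near nbhs t, cdom c (z t') := cvg_preimage cz (chart_dom_near hc dz).
have au0 : analytic_at (fun t' => (cmap c \o z) t' - a) t.
  by apply: analyticB au _; exact: analytic_cst.
(* If the coordinate were constant near [t], its velocity would be 0 at a good time, where X does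
   not vanish. *)
have [u0|[k [v0 [av0 v00 Hv0]]]] := analytic_order au0.
  have [t' [dt' Ht'] gt'] := acc _ (nearI D (near_near u0)).
  have [St' _ _] := gt'; have [_ _ _ x0 _] := nbhs_singleton (field_neq0_near hM hX Ac dt' St').
  have d1 := nbhs_singleton (good_z_chart hM hX gt' Ac dt').
  have d2 : cdiff (cmap c \o z) t' 0.
    apply: cdiff_near (cdiff_cst a t'); apply: filterS Ht' => t2 /eqP.
    by rewrite subr_eq0 => /eqP.
  by rewrite (cdiff_uniq d1 d2) eqxx in x0.
have k0 : (0 < k)%N.
  rewrite lt0n; apply/negP => /eqP kE; have := nbhs_singleton Hv0.
  rewrite /= -/a subrr kE expr0 mul1r => E; by rewrite -E eqxx in v00.
have [v1 [av1 v10 Hv1]] := analytic_root k0 av0 v00.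
(* A k-th root of the coordinate minus [a]. It has a simple zero at [t], hence an inverse [tau], and
   [theta = v' \o tau] is dx/dt as a function of x. *)
pose v t' := (t' - t) * v1 t'.
have av : analytic_at v t.
  by apply: analyticM av1; apply: analyticB; [exact: analytic_id|exact: analytic_cst].
have [v' av' dv'] := analytic_cdiff av.
have v'0 : v' t != 0.
  have [w' _ dw'] := analytic_cdiff av1.
  have := cdiffM (cdiffB (cdiff_id t) (cdiff_cst t t)) (nbhs_singleton dw').
  rewrite subrr mul0r subr0 mul1r addr0 => /(cdiff_uniq (nbhs_singleton dv')) ->.
  exact: v10.
have [tau [atau tau0 vtau tauv]] := analytic_inverse av dv' v'0.
have vt : v t = 0 by rewrite /v subrr mul0r.
rewrite vt in atau tau0 vtau.
pose theta x := v' (tau x).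
have ath : analytic_at theta 0 by apply: (analytic_comp atau); rewrite tau0; exact: av'.
have th0 : theta 0 != 0 by rewrite /theta tau0.
have uE : \forall t' \near nbhs t, (cmap c \o z) t' = a + v t' ^+ k.
  apply: filterS2 Hv0 Hv1 => t' E1 E2.
  by rewrite /v exprMn E2 -E1 addrC subrK.
have HB : \forall t' \near nbhs t, good_z A S X z t' -> branch c a k theta (v t').
  have N1 := nearI D (nearI (near_near uE) (near_near (nearI tauv dv'))).
  have N2 : \forall t' \near nbhs t, \forall x \near nbhs (v t'), v (tau x) = x /\ analytic_at tau x.
    have N7 : \forall x \near nbhs (v t), \forall y \near nbhs x, v (tau y) = y /\ analytic_at tau y.
      rewrite vt; apply: near_near.
      by apply: filterS2 vtau (analytic_near atau) => x [].
    exact: (cvg_preimage (analytic_cont av) N7).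
  apply: filterS2 N1 N2 => t' [dt' [uE' tv]] N2' gt'.
  have [St' _ _] := gt'; have E0 := nbhs_singleton uE'.
  split; first by rewrite -E0 /= (chartK hc).
  have [tv0 _] := nbhs_singleton tv.
  have [vt0 atau'] := nbhs_singleton N2'.
  have ctau := analytic_cont atau'; rewrite tv0 in ctau.
  have G := good_z_chart hM hX gt' Ac dt'.
  have N3 : \forall t2 \near nbhs t', X c (a + v t2 ^+ k) = k%:R * v t2 ^+ k.-1 * v' t2.
    apply: filterS2 (nearI G (near_near uE')) tv => t2 [G1 E1] [_ dv2].
    have d2 : cdiff (cmap c \o z) t2 (k%:R * v t2 ^+ k.-1 * v' t2).
      apply: cdiff_near (cdiff_comp dv2 (power_cdiff a (v t2) k)).
      by apply: filterS E1 => t3 ->.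
    by rewrite -(cdiff_uniq G1 d2) /=; have /= -> := nbhs_singleton E1.
  have N4 : \forall x \near nbhs (v t'), X c (a + v (tau x) ^+ k) = k%:R * v (tau x) ^+ k.-1 * v' (tau x).
    exact: ctau N3.
  by apply: filterS2 N4 N2' => x; rewrite /theta => E2 [E3 _]; rewrite E3 in E2.
have N0 : \forall x \near nbhs (0 : C), [/\ cdom c (cinv c (a + x ^+ k)),
    cmap c (cinv c (a + x ^+ k)) = a + x ^+ k, analytic_at theta x & theta x != 0].
  have H0 : a + 0 ^+ k = a by rewrite expr0n gtn_eqF // addr0.
  have N5 := chart_inv_near hc dz; rewrite -/a -H0 in N5.
  have N6 := cvg_preimage (analytic_cont (power_analytic a 0 k)) N5.
  by apply: filterS2 N6 (nearI (analytic_near ath) (analytic_near_neq ath th0)) => x [? ?] [].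
have [r r0 Hr] := near_close hN N0.
have {}Hr x : cabs x < r -> [/\ cdom c (cinv c (a + x ^+ k)),
    cmap c (cinv c (a + x ^+ k)) = a + x ^+ k, analytic_at theta x & theta x != 0].
  by move=> xr; apply: Hr; rewrite subr0.
have [x0 px0 Bx0] : exists2 x, punctured r x & branch c a k theta x.
  have Nv : \forall t' \near nbhs t, cabs (v t') < r.
    have N8 : \forall x \near nbhs (v t), cabs x < r.
      by rewrite vt; apply/(abs_near hN); exists r => // w; rewrite subr0.
    exact: (cvg_preimage (analytic_cont av) N8).
  have [t' [vr Bt'] gt'] := acc _ (nearI Nv HB); have Bv := Bt' gt'.
  (* A zero of [v] would place the trajectory at [z t], in S, at a good time. *)
  exists (v t') => //; apply/andP; split => //; apply: (abs_gt0 hN).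
  apply/negP => /eqP v0E; case: Bv => + _; rewrite v0E expr0n gtn_eqF // addr0.
  by rewrite /a (chartK hc).
have Ball := branch_punctured Ac k0 r0 Hr (ex_intro2 _ _ x0 px0 Bx0).
have z0E : cinv c (a + 0 ^+ k) = z t by rewrite expr0n gtn_eqF // addr0 /a (chartK hc).
(* Ball says that every point a + x ^+ k with x != 0 small is regular, with
   velocity k x^(k-1) theta x.  If k = 1 this is a path to z t along which X
   continues regularly.  If k > 1, rotating x by a k-th root of unity fixes the
   point but not the velocity. *)
have [k1|k2] := leqP k 1.
  have kE : k = 1%N by apply/eqP; rewrite eqn_leq k1.
  move: Szt; rewrite -z0E; move: (px0) => /andP[x00 x0r].
  have cl (s : R) : 0 <= s <= 1 -> cabs (x0 + s%:C%C * (0 - x0)) = (1 - s) * cabs x0.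
    move=> /andP[s0 s1]; have -> : x0 + s%:C%C * (0 - x0) = (1 - s)%:C%C * x0.
      by rewrite (rmorphB (real_complex R)) (rmorph1 (real_complex R)); ring.
    by rewrite (absM hN) cabs_rc ger0_norm // subr_ge0.
  have d0 : k%:R * 0 ^+ k.-1 != 0 :> C by rewrite kE /= expr0 mulr1 oner_eq0.
  apply: (@branch_endpoint c a k theta 0 x0 Ac d0 ath th0) => s s01.
    have /Hr[] // : cabs (x0 + s%:C%C * (0 - x0)) < r.
    by rewrite cl //; move/andP: s01 => [s0 s1]; nra.
  have [s0 s1] := andP s01; apply: Ball; apply/andP; rewrite cl ?s0 ?ltW //.
  by split; nra.
have [zeta zk z1] := @nontrivial_unity_root R k k2.
have zn : cabs zeta = 1.
  have := congr1 (@cabs R) zk; rewrite (absX hN) (abs1 hN) => /eqP.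
  by rewrite pexpr_eq1 ?(abs_ge0 hN) // => /eqP.
have pz x : punctured r x -> punctured r (zeta * x).
  by rewrite /punctured /= (absM hN) zn mul1r.
have E x : punctured r x -> theta x = zeta ^+ k.-1 * theta (zeta * x).
  move=> px; have [_ /nbhs_singleton H1] := Ball x px.
  have [_ /nbhs_singleton] := Ball _ (pz x px).
  rewrite exprMn zk mul1r H1 exprMn => H2.
  have kx : k%:R * x ^+ k.-1 != 0 :> C.
    rewrite mulf_neq0 ?pnatr_eq0 -?lt0n // expf_neq0 //.
    by apply/negP => /eqP x00; move/andP: px => [+ _]; rewrite x00 (abs0 hN) ltxx.
  by apply: (mulfI kx); rewrite H2; ring.
have aR : analytic_at (fun x => zeta ^+ k.-1 * theta (zeta * x)) 0.
  apply: analyticM; first exact: analytic_cst.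
  have aZ : analytic_at (fun x : C => zeta * x) 0.
    by apply: analyticM; [exact: analytic_cst|exact: analytic_id].
  by apply: (analytic_comp aZ); rewrite mulr0; exact: ath.
have /nbhs_singleton : \forall x \near nbhs (0 : C), theta x = zeta ^+ k.-1 * theta (zeta * x).
  apply: (analytic_identity ath aR) => P HP.
  have Nr : \forall x \near nbhs (0 : C), cabs x < r.
    by apply/(abs_near hN); exists r => // w; rewrite subr0.
  have [x xn0 [Px xr]] := exists_near_neq (nearI HP Nr).
  exists x => //; have px : punctured r x by apply/andP; split => //; exact: (abs_gt0 hN).
  by apply: filterS (near_punctured px) => y; exact: E.
(* At 0 the relation says [theta 0 = zeta ^+ k.-1 * theta 0], so [zeta ^+ k.-1 = 1]; with
   [zeta ^+ k = 1] this gives [zeta = 1]. *)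
rewrite mulr0 => H; move/negP: z1; apply; apply/eqP.
have zk1 : zeta ^+ k.-1 = 1 by apply: (mulIf th0); rewrite mul1r -H.
by rewrite -zk -(prednK k0) exprS zk1 mulr1.
Qed.

End Singular.

(** * Germs and their continuation *)

Section Germs.
Variables (X : topologicalType) (Y : Type).
Implicit Types (f g : X -> Y) (p q : X) (e : etale X Y).

Lemma etale_eq e e' : base e = base e' -> germ e = germ e' -> e = e'.
Proof.
case: e e' => b G H [b' G' H'] /= bb GG; move: H H'; rewrite -bb -GG => H H'.
by rewrite (Prop_irrelevance H H').
Qed.

Lemma germ_at_eq f g p : (\forall q \near nbhs p, f q = g q) -> germ_at f p = germ_at g p.
Proof.
move=> fg; apply: etale_eq => //=; apply/seteqP; split=> h /= H.
  by apply: filterS2 fg H => q -> ->.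
by apply: filterS2 fg H => q -> ->.
Qed.

Lemma germ_at_inj f g p q : germ_at f p = germ_at g q ->
  p = q /\ \forall x \near nbhs p, f x = g x.
Proof.
move=> E; have pq : p = q by have := congr1 (@base _ _) E.
split=> //; have GE : germ_class f p = germ_class g q by have := congr1 (@germ _ _) E.
have : germ_class f p f by exact: filterE.
by rewrite GE -pq.
Qed.

Lemma germ_repE e : germ_at (germ_rep e) (base e) = e.
Proof.
by apply: etale_eq => //=; rewrite /germ_rep; case: (cid (germP e)) => f /= ->.
Qed.

Lemma germ_rep_near f p : \forall q \near nbhs p, germ_rep (germ_at f p) q = f q.
Proof. by have [_] := germ_at_inj (germ_repE (germ_at f p)). Qed.

Definition germ_val e := germ_rep e (base e).

Lemma germ_val_at f p : germ_val (germ_at f p) = f p.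
Proof. by rewrite /germ_val /=; exact: nbhs_singleton (germ_rep_near f p). Qed.

(** The germs of one function over an open set form an open set, because functions with equal germs
    at a point have equal germs nearby; these sets are a basis at [germ_at f p]. *)
Lemma etale_near f p (P : etale X Y -> Prop) :
  (\forall e \near nbhs (germ_at f p), P e) <-> \forall q \near nbhs p, P (germ_at f q).
Proof.
split=> [H|H].
  rewrite nbhsE in H; case: H => W [oW Wp] WP.
  have : \forall q \near nbhs p, W (germ_at f q) by exact: oW.
  by apply: filterS => q; exact: WP.
rewrite nbhsE in H; case: H => U [oU Up] UP.
rewrite nbhsE; exists [set germ_at f q | q in U]; last by move=> _ [q Uq <-]; exact: UP.
split; last by exists p.
move=> g q [q' Uq' E]; have [qq fg] := germ_at_inj E; rewrite qq in fg Uq'.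
have nU : \forall x \near nbhs q, U x by apply: open_nbhs_nbhs.
apply: filterS2 nU (near_join fg) => x Ux fgx.
by exists x => //; apply: germ_at_eq.
Qed.

Lemma base_cont e : @base X Y @ nbhs e --> base e.
Proof.
move=> P HP; rewrite -(germ_repE e).
by apply/(etale_near _ _ (fun e => P (base e))).
Qed.

End Germs.

(** * Continuation along paths as an equivalence relation *)

Section Continuation.
Variable R : realType.
Variables (X : topologicalType) (Y : Type).
Implicit Types (e : etale X Y) (O : set (etale X Y)).

Lemma comp_within01 (T : topologicalType) (sigma : R -> T) (h : R -> R) :
  {within `[0, 1], continuous sigma} -> (forall s, 0 <= s <= 1 -> 0 <= h s <= 1) ->
  continuous h -> {within `[0, 1], continuous (sigma \o h)}.
Proof.
move=> /within01P cs h01 ch; apply/within01P => s s01 P HP.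
have H := cs (h s) (h01 s s01) P HP.
have := @cvg_preimage _ _ h s _ (ch s) H.
by apply: filterS => x Hx x01; apply: Hx; exact: h01.
Qed.

Lemma continuation_refl O e : O e -> @continuation R _ _ O e e.
Proof.
move=> Oe; exists (fun=> e); split => //.
by apply: continuous_subspaceT => x; exact: cvg_cst.
Qed.

Lemma continuation_in O e e' : @continuation R _ _ O e e' -> O e'.
Proof. by move=> [s [_ _ <- H]]; apply: H; rewrite ler01 lexx. Qed.

Lemma continuation_in0 O e e' : @continuation R _ _ O e e' -> O e.
Proof. by move=> [s [_ <- _ H]]; apply: H; rewrite ler01 lexx. Qed.

Lemma continuation_sym O e e' : @continuation R _ _ O e e' -> @continuation R _ _ O e' e.
Proof.
move=> [s [cs s0 s1 Os]]; exists (s \o (fun x => 1 - x)).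
have h01 (x : R) : 0 <= x <= 1 -> 0 <= 1 - x <= 1 by move=> /andP[? ?]; apply/andP; split; lra.
split; rewrite /= ?subr0 ?subrr //.
- apply: comp_within01 => // x; apply: cvgB; [exact: cvg_cst|exact: cvg_id].
- by move=> x /h01; exact: Os.
Qed.

Lemma continuation_path O e (sigma : R -> etale X Y) (s : R) :
  {within `[0, 1], continuous sigma} -> sigma 0 = e ->
  (forall s, 0 <= s <= 1 -> O (sigma s)) -> 0 <= s <= 1 ->
  @continuation R _ _ O e (sigma s).
Proof.
move=> cs s0 Os /andP[t0 t1]; exists (sigma \o (fun x => s * x)).
have h01 (x : R) : 0 <= x <= 1 -> 0 <= s * x <= 1.
  by move=> /andP[x0 x1]; rewrite mulr_ge0 //= mulr_ile1.
split; rewrite /= ?mulr0 ?mulr1 //.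
- apply: comp_within01 => // x; apply: cvgM; [exact: cvg_cst|exact: cvg_id].
- by move=> x /h01; exact: Os.
Qed.

Lemma continuation_trans O e1 e2 e3 : @continuation R _ _ O e1 e2 ->
  @continuation R _ _ O e2 e3 -> @continuation R _ _ O e1 e3.
Proof.
move=> [s [/within01P cs s0 s1 Os]] [u [/within01P cu u0 u1 Ou]].
pose v (x : R) := if x <= 2^-1 then s (2 * x) else u (2 * x - 1).
have v0 : v 0 = e1 by rewrite /v invr_ge0 ler0n mulr0.
have v1 : v 1 = e3.
  rewrite /v ifF; last by apply/negbTE; rewrite -ltNge invf_lt1 // ltr1n.
  by rewrite mulr1 (_ : 2 - 1 = 1) //; ring.
have vr x : 2^-1 <= x -> v x = u (2 * x - 1).
  rewrite le_eqVlt => /orP[/eqP <-|h].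
    by rewrite /v lexx mulfV // subrr s1 u0.
  by rewrite /v leNgt h.
have vl x : x <= 2^-1 -> v x = s (2 * x) by rewrite /v => ->.
exists v; split => //; last first.
  move=> x /andP[x0 x1]; have [h|/ltW h] := leP x 2^-1.
    by rewrite vl //; apply: Os; apply/andP; split; lra.
  by rewrite vr //; apply: Ou; apply/andP; split; lra.
have cl (x : R) : (fun x : R => 2 * x) @ nbhs x --> 2 * x.
  by apply: cvgM; [exact: cvg_cst|exact: cvg_id].
have cr (x : R) : (fun x : R => 2 * x - 1) @ nbhs x --> 2 * x - 1.
  by apply: cvgB; [exact: cl|exact: cvg_cst].
apply/within01P => x /andP[x0 x1] P HP.
have HL : x <= 2^-1 -> \forall y \near nbhs x, 0 <= y <= 2^-1 -> P (v y).
  move=> h; have x2 : 0 <= 2 * x <= 1 by apply/andP; split; lra.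
  have HP' : \forall e \near nbhs (s (2 * x)), P e by rewrite -vl.
  have := cvg_preimage (cl x) (cs _ x2 _ HP').
  apply: filterS => y Hy /andP[y0 yh]; rewrite vl //; apply: Hy.
  by apply/andP; split; lra.
have HR : 2^-1 <= x -> \forall y \near nbhs x, 2^-1 <= y <= 1 -> P (v y).
  move=> h; have x2 : 0 <= 2 * x - 1 <= 1 by apply/andP; split; lra.
  have HP' : \forall e \near nbhs (u (2 * x - 1)), P e by rewrite -vr.
  have := cvg_preimage (cr x) (cu _ x2 _ HP').
  apply: filterS => y Hy /andP[y0 yh]; rewrite vr //; apply: Hy.
  by apply/andP; split; lra.
have [h|h|h] := ltgtP x 2^-1.
- have N : \forall y \near nbhs x, y < 2^-1 by exact: lt_nbhsl.
  by apply: filterS2 N (HL (ltW h)) => y yh Hy /andP[y0 y1]; apply: Hy; rewrite y0 ltW.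
- have N : \forall y \near nbhs x, 2^-1 < y by exact: lt_nbhsr.
  by apply: filterS2 N (HR (ltW h)) => y yh Hy /andP[y0 y1]; apply: Hy; rewrite y1 ltW.
- have hx : x <= 2^-1 by rewrite h.
  have hx' : 2^-1 <= x by rewrite h.
  apply: filterS2 (HL hx) (HR hx') => y H1 H2 /andP[y0 y1].
  have [yh|/ltW yh] := leP y 2^-1; first by apply: H1; rewrite y0.
  by apply: H2; rewrite yh.
Qed.

(** The image of the path is connected, so a property of germs that is open and closed at the points
    of [O] propagates along it. *)
Lemma continuation_ind O (P : etale X Y -> Prop) e : P e ->
  (forall x, O x -> P x -> \forall y \near nbhs x, P y) ->
  (forall x, O x -> (forall U, nbhs x U -> exists y, U y /\ P y) -> P x) ->
  forall e', @continuation R _ _ O e e' -> P e'.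
Proof.
move=> Pe oP cP e' [s [cs s0 <- Os]].
have cA := connected_continuous_connected (@unit_interval_connected R) cs.
have mem (x : R) : 0 <= x <= 1 -> (s @` `[0, 1]%classic) (s x).
  by move=> x01; exists x => //=; rewrite in_itv.
have OA x : (s @` `[0, 1]%classic) x -> O x.
  by move=> [y /=]; rewrite in_itv /= => y01 <-; exact: Os.
apply: (connected_forall cA) => [|x Ax Px|x Ax H|].
- by exists e => //; rewrite -s0; apply: mem; rewrite lexx ler01.
- by apply: filterS (oP x (OA x Ax) Px) => y Py _.
- by apply: cP => [|U /H[y [Uy _ Py]]]; [exact: OA|exists y].
- by apply: mem; rewrite lexx ler01.
Qed.

(** Every germ on a path is the end of an initial piece of it; controlling endpoints controls the
    whole path. *)
Lemma continuation_shrink O O' e e' : (forall x, @continuation R _ _ O e x -> O' x) ->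
  @continuation R _ _ O e e' -> @continuation R _ _ O' e e'.
Proof.
move=> OO' [s [cs s0 s1 Os]]; exists s; split => // x x01.
by apply: OO'; exact: continuation_path.
Qed.

Lemma continuation_connected O e : connected (@continuation R _ _ O e).
Proof.
have [Oe|nO] := pselect (O e); last first.
  rewrite (_ : @continuation R X Y O e = set0); first exact: connected0.
  by apply/seteqP; split=> // x /continuation_in0.
pose I := [set s : R -> etale X Y | [/\ {within `[0, 1], continuous s}, s 0 = e &
  forall x, 0 <= x <= 1 -> O (s x)]].
have -> : @continuation R _ _ O e = \bigcup_(s in I) (s @` `[0, 1]%classic).
  apply/seteqP; split=> [x [s [cs s0 s1 Os]]|x [s [cs s0 Os] [y /=]]].
    by exists s => //; exists 1; rewrite /= ?in_itv /= ?ler01 ?lexx.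
  by rewrite in_itv /= => y01 <-; exact: continuation_path.
apply: bigcup_connected.
  by exists e => s [cs s0 Os]; exists 0; rewrite /= ?in_itv /= ?ler01 ?lexx.
move=> s [cs _ _]; apply: connected_continuous_connected cs.
exact: unit_interval_connected.
Qed.

End Continuation.

Lemma continuation_map (R : realType) (X Y X' Y' : topologicalType)
    (O : set (etale X Y)) (O' : set (etale X' Y')) (F : etale X Y -> etale X' Y') e e' :
  (forall x, O x -> F @ nbhs x --> F x) -> (forall x, O x -> O' (F x)) ->
  @continuation R _ _ O e e' -> @continuation R _ _ O' (F e) (F e').
Proof.
move=> cF OF [s [/within01P cs s0 s1 Os]]; exists (F \o s); split => /=.
- apply/within01P => x x01 P HP.
  exact: (cs x x01 _ (cvg_preimage (cF _ (Os x x01)) HP)).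
- by rewrite s0.
- by rewrite s1.
- by move=> x x01; apply/OF/Os.
Qed.

Lemma continuation_germ_path (R : realType) (X : topologicalType) (Y : Type)
    (O : set (etale X Y)) f (gamma : R -> X) :
  {within `[0, 1], continuous gamma} ->
  (forall s, 0 <= s <= 1 -> O (germ_at f (gamma s))) ->
  @continuation R _ _ O (germ_at f (gamma 0)) (germ_at f (gamma 1)).
Proof.
move=> /within01P cg Og; exists (fun s => germ_at f (gamma s)); split => //.
by apply/within01P => s s01 P /etale_near HP; exact: cg HP.
Qed.

(** * Continuation preserves solutions and time functions *)

Section Region.
Variables (R : realType) (M : topologicalType) (A : set (chart R M)).
Hypothesis hM : riemann_surface A [set: M].
Variables (S : set M) (X : vfield R M).
Hypothesis hX : singular_vector_field A S X.
Local Notation C := (cplx R).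
Local Notation plane := (@plane_atlas R).
Let hN := complete_cabs R.
Implicit Types (c : chart R M) (p q : M) (psi : M -> C) (z : C -> M) (t : C).

Lemma good_z_ext z1 z2 t : (\forall t' \near nbhs t, z1 t' = z2 t') ->
  good_z A S X z1 t -> good_z A S X z2 t.
Proof.
move=> E g1; have E0 := nbhs_singleton E; have [S1 c1 [c [Ac d1 H]]] := g1.
rewrite E0 in S1 c1 d1; split => //.
  move=> P HP; have c1' : z1 @ nbhs t --> z2 t := c1.
  have H1 : \forall t' \near nbhs t, P (z1 t') := c1' P HP.
  have H2 : \forall t' \near nbhs t, P (z2 t') by apply: filterS2 E H1 => t' <-.
  exact: H2.
exists c; split => //; apply: filterS2 (near_near E) H => t' E' H'.
rewrite -(nbhs_singleton E'); apply: cdiff_near H'; apply: filterS E' => t2 /= ->.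
by [].
Qed.

Lemma good_psi_ext psi1 psi2 p : (\forall q \near nbhs p, psi1 q = psi2 q) ->
  good_psi A S X psi1 p -> good_psi A S X psi2 p.
Proof.
move=> E [Sp [c [Ac dp H]]]; split => //; exists c; split => //.
have /(chart_near (atlas_chart hM Ac) _ dp) E' := E.
apply: filterS2 (near_near E') H => w Ew; exact: cdiff_near.
Qed.

(** [no_hit] keeps the limit position out of S; then X is analytic there and the identity theorem
    carries the differential equation to [t]. *)
Lemma good_z_closed z t : analytic_map plane A z t ->
  (forall P : C -> Prop, (\forall t' \near nbhs t, P t') ->
    exists2 t', P t' & good_z A S X z t') -> good_z A S X z t.
Proof.
move=> az acc; have Sz := no_hit hM hX az acc; have [cz az'] := az.
have [c Ac dz] := atlas_at hM (z t); have hc := atlas_chart hM Ac.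
split => //; exists c; split => //.
have au : analytic_at (cmap c \o z) t by exact: (az' _ c erefl Ac).
have [u' au' du'] := analytic_cdiff au.
have [_ _ _ _ aX] := nbhs_singleton (field_neq0_near hM hX Ac dz Sz).
have aXu : analytic_at (fun t' => X c ((cmap c \o z) t')) t by exact: (analytic_comp au).
have D := cvg_preimage cz (chart_dom_near hc dz).
have E : \forall t' \near nbhs t, u' t' = X c ((cmap c \o z) t').
  apply: (analytic_identity au' aXu) => P HP.
  have [t' [Pt' [dt' du]] gt'] := acc _ (nearI HP (nearI D (near_near du'))).
  exists t'; first exact: Pt'.
  by apply: filterS2 du (good_z_chart hM hX gt' Ac dt') => t2; exact: cdiff_uniq.
by apply: filterS2 du' E => t' + E'; rewrite E'.
Qed.

(** Here regularity of [p] is assumed, since branches of Psi_X are by definition continued over M \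
    S only. *)
Lemma good_psi_closed psi p : analytic_map A plane psi p -> ~ S p ->
  (forall P : M -> Prop, (\forall q \near nbhs p, P q) ->
    exists2 q, P q & good_psi A S X psi q) -> good_psi A S X psi p.
Proof.
move=> [cpsi apsi] Sp acc; have [c Ac dp] := atlas_at hM p; have hc := atlas_chart hM Ac.
split => //; exists c; split => //.
have af : analytic_at (psi \o cinv c) (cmap c p).
  exact: (apsi c (Chart [set: cplx R] id id) Ac erefl dp I).
have [f' af' df'] := analytic_cdiff af.
have [_ _ _ x0 aX] := nbhs_singleton (field_neq0_near hM hX Ac dp Sp).
have aV := analyticV aX x0.
have E : \forall w \near nbhs (cmap c p), f' w = (X c w)^-1.
  apply: (analytic_identity af' aV) => P HP.
  have /(chart_near_map hc _ dp) HP' := nearI HP (near_near df').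
  have [q [[Pq dq] ddq] gq] := acc _ (nearI HP' (chart_dom_near hc dp)).
  exists (cmap c q); first exact: Pq.
  by apply: filterS2 dq (good_psi_chart hM hX gq Ac ddq) => w; exact: cdiff_uniq.
by apply: filterS2 df' E => w + E'; rewrite E'.
Qed.

Definition z_germs : set (etale C M) :=
  [set e | good_z A S X (germ_rep e) (base e)].

Definition psi_germs : set (etale M C) :=
  [set e | good_psi A S X (germ_rep e) (base e)].

Lemma z_germsP z t : z_germs (germ_at z t) <-> good_z A S X z t.
Proof.
split; apply: good_z_ext; first exact: germ_rep_near.
by apply: filterS (germ_rep_near z t) => q ->.
Qed.

Lemma psi_germsP psi p : psi_germs (germ_at psi p) <-> good_psi A S X psi p.
Proof.
split; apply: good_psi_ext; first exact: germ_rep_near.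
by apply: filterS (germ_rep_near psi p) => q ->.
Qed.

Lemma z_germs_open e : z_germs e -> \forall e' \near nbhs e, z_germs e'.
Proof.
rewrite -(germ_repE e) => /z_germsP g; apply/etale_near.
by apply: filterS (good_z_near hM hX g) => t ?; apply/z_germsP.
Qed.

Lemma psi_germs_open e : psi_germs e -> \forall e' \near nbhs e, psi_germs e'.
Proof.
rewrite -(germ_repE e) => /psi_germsP g; apply/etale_near.
by apply: filterS (good_psi_near hM hX g) => t ?; apply/psi_germsP.
Qed.

Lemma z_germs_analytic e : z_germs e -> analytic_germs plane A setT e.
Proof.
rewrite -(germ_repE e) => /z_germsP g; exists (germ_rep e), (base e); split => //.
exact: (good_z_analytic hM hX g).
Qed.

Lemma psi_germs_analytic e : psi_germs e -> analytic_germs A plane (~` S) e.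
Proof.
rewrite -(germ_repE e) => /psi_germsP g; exists (germ_rep e), (base e); split => //.
  by case: g.
exact: (good_psi_analytic hM hX g).
Qed.

Lemma z_continuation e : z_germs e ->
  @continuation R _ _ (analytic_germs plane A setT) e = @continuation R _ _ z_germs e.
Proof.
move=> He; apply/seteqP; split=> e'; apply: continuation_shrink => x; last first.
  by move=> /continuation_in /z_germs_analytic.
apply: continuation_ind He _ _ x => [x _|x [f [p [-> _ af]]] acc]; first exact: z_germs_open.
apply/z_germsP; apply: good_z_closed => // P HP.
have /acc[y [[t' Pt' <-] /z_germsP gt']] : nbhs (germ_at f p) [set germ_at f t' | t' in P].
  by apply/etale_near; apply: filterS HP => t' Pt'; exists t'.
by exists t'.
Qed.

Lemma psi_continuation e : psi_germs e ->
  @continuation R _ _ (analytic_germs A plane (~` S)) e = @continuation R _ _ psi_germs e.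
Proof.
move=> He; apply/seteqP; split=> e'; apply: continuation_shrink => x; last first.
  by move=> /continuation_in /psi_germs_analytic.
apply: continuation_ind He _ _ x => [x _|x [f [p [-> Sp af]]] acc]; first exact: psi_germs_open.
apply/psi_germsP; apply: good_psi_closed => // P HP.
have /acc[y [[t' Pt' <-] /psi_germsP gt']] : nbhs (germ_at f p) [set germ_at f t' | t' in P].
  by apply/etale_near; apply: filterS HP => t' Pt'; exists t'.
by exists t'.
Qed.

(** A time function and a solution are fixed for every position and time, so that inversion becomes
    a function on germs; by the uniqueness lemmas the choice does not affect the germs. *)
Lemma germ_choice : exists (Psi : M -> C -> M -> C) (Z : M -> C -> C -> M),
  forall p t, ~ S p -> [/\ good_psi A S X (Psi p t) p, Psi p t p = t,
    good_z A S X (Z p t) t & Z p t t = p].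
Proof.
have H : forall pt : M * C, exists F : (M -> C) * (C -> M), ~ S pt.1 ->
    [/\ good_psi A S X F.1 pt.1, F.1 pt.1 = pt.2, good_z A S X F.2 pt.2 & F.2 pt.2 = pt.1].
  move=> [p t] /=; have [Sp|nS] := pselect (S p); first by exists (fun=> 0, fun=> p).
  have [psi gpsi pt] := good_psi_exists hM hX t nS.
  have [z [zp gz _]] := good_z_exists hM hX gpsi.
  by exists (psi, z); rewrite /= -pt.
have [F HF] := choice H.
by exists (fun p t => (F (p, t)).1), (fun p t => (F (p, t)).2) => p t Sp; exact: (HF (p, t)).
Qed.

Lemma time_branch_good psi p : ~ S p -> time_branch A X p psi ->
  good_psi A S X psi p /\ psi p = 0.
Proof.
move=> Sp tb; have [c Ac dp] := atlas_at hM p; have hc := atlas_chart hM Ac.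
have N := field_neq0_near hM hX Ac dp Sp.
have [_ _ _ x0 aX] := nbhs_singleton N.
have [F aF dF] := analytic_prim (analyticV aX x0).
have /(chart_near hc _ dp) E := tb c Ac dp.
have E2 : \forall w \near nbhs (cmap c p), psi (cinv c w) = F w - F (cmap c p).
  have [e e0 He] := near_close hN (nearI dF N).
  have B : \forall w \near nbhs (cmap c p), cabs (w - cmap c p) < e by apply/(abs_near hN); exists e.
  apply: filterS2 (nearI E (chart_inv_near hc dp)) B => w [Ew [_ cw]] we.
  rewrite Ew cw.
  have := @line_FTC R F (fun w => (X c w)^-1) (cmap c p) (w - cmap c p) _ _.
  rewrite (_ : cmap c p + (w - cmap c p) = w); last by ring.
  apply=> s s01.
  - by have [dFw _] := He _ (segment_in we s01).
  - have [_ [_ _ _ n0 aXs]] := He _ (segment_in we s01).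
    exact: cvgV n0 (analytic_cont aXs).
split.
  split => //; exists c; split => //.
  apply: filterS2 dF (near_near E2) => w dFw Ew.
  have := cdiffB dFw (cdiff_cst (F (cmap c p)) w); rewrite subr0.
  by apply: cdiff_near; apply: filterS Ew => w' /= ->.
by have := nbhs_singleton E2; rewrite (chartK hc) // subrr.
Qed.

(** A local solution is given only as a right inverse of [psi], continuous at 0. As [psi] is locally
    injective, [z] has the germ of the solution obtained by inverting [psi]. *)
Lemma local_solution_good p z : ~ S p -> local_solution A X p z ->
  [/\ good_z A S X z 0, z 0 = p & exists psi,
    [/\ time_branch A X p psi, good_psi A S X psi p & psi p = 0]].
Proof.
move=> Sp [z0 cz [psi tb H]]; have [gp p0] := time_branch_good Sp tb.
split => //; last by exists psi.
have [z' [zp gz' zE]] := good_z_exists hM hX gp; rewrite p0 in zp gz'.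
apply: good_z_ext gz'; rewrite -z0 in zE.
have cz' : z @ nbhs (0 : C) --> z 0 := cz.
apply: filterS2 H (cvg_preimage cz' zE) => t ->.
by [].
Qed.

Lemma time_branches_E p psi : ~ S p -> time_branch A X p psi ->
  time_branches A S X p = @continuation R _ _ psi_germs (germ_at psi p).
Proof.
move=> Sp tb; have [gp p0] := time_branch_good Sp tb.
rewrite -psi_continuation; last exact/psi_germsP.
apply/seteqP; split=> e; last by exists psi.
move=> [psi' tb']; have [gp' p0'] := time_branch_good Sp tb'.
rewrite (@germ_at_eq _ _ psi' psi) //.
by apply: (good_psi_uniq hM hX gp' gp); rewrite p0 p0'.
Qed.

End Region.

Lemma open_of_nbhs (T : topologicalType) (W : set T) : (forall x, W x -> nbhs x W) -> open W.
Proof. by move=> H; rewrite openE. Qed.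

Lemma separate_map (T Y : topologicalType) (f : T -> Y) x y :
  f @ nbhs x --> f x -> f @ nbhs y --> f y ->
  (exists U V : set Y, [/\ open U, open V, U (f x), V (f y) & U `&` V = set0]) ->
  exists U V : set T, [/\ open U, open V, U x, V y & U `&` V = set0].
Proof.
move=> cx cy [U [V [oU oV Ux Vy UV]]].
exists (interior (f @^-1` U)), (interior (f @^-1` V)).
split; [exact: open_interior|exact: open_interior| | |].
- exact: (cx _ (open_nbhs_nbhs (conj oU Ux))).
- exact: (cy _ (open_nbhs_nbhs (conj oV Vy))).
- apply/seteqP; split; last exact: sub0set.
  move=> e [/interior_subset Ue /interior_subset Ve].
  have : (U `&` V) (f e) by split; [exact: Ue|exact: Ve].
  by rewrite UV.
Qed.

(** * The region of univalence and the graph *)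

Section Surfaces.
Variables (R : realType) (M : topologicalType) (A : set (chart R M)).
Hypothesis hM : riemann_surface A [set: M].
Variables (S : set M) (X : vfield R M).
Hypothesis hX : singular_vector_field A S X.
Local Notation C := (cplx R).
Local Notation plane := (@plane_atlas R).
Let hN := complete_cabs R.
Implicit Types (c : chart R M) (p q : M) (psi : M -> C) (z : C -> M) (t : C).
Local Notation zgerms := (z_germs A S X).
Local Notation pgerms := (psi_germs A S X).

Lemma z_path z t : good_z A S X z t ->
  \forall t' \near nbhs t, @continuation R _ _ zgerms (germ_at z t) (germ_at z t').
Proof.
move=> gz; have [e e0 He] := near_close hN (good_z_near hM hX gz).
apply/(abs_near hN); exists e => // t' te.
have := @continuation_germ_path R C M zgerms z (fun s : R => t + s%:C%C * (t' - t)).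
rewrite (rmorph0 (real_complex R)) (rmorph1 (real_complex R)) mul0r addr0 mul1r.
rewrite (_ : t + (t' - t) = t'); last by ring.
apply=> [|s s01]; last by apply/z_germsP; apply: He; exact: segment_in.
by apply: continuous_subspaceT => s; exact: rdiff_cont (rdiff_line t (t' - t) s).
Qed.

Lemma good_psiD psi p (k : C) : good_psi A S X psi p ->
  good_psi A S X (fun q => psi q + k) p.
Proof.
move=> [Sp [c [Ac dp H]]]; split => //; exists c; split => //.
apply: filterS H => w dw.
by have := cdiffD dw (cdiff_cst k w); rewrite addr0.
Qed.

(** The neighbourhood of [p] does not depend on the constant [k]. In [graph_base] the constant is
    known only after the nearby point [q] has been chosen. *)
Lemma psi_path psi p : good_psi A S X psi p -> \forall q \near nbhs p, forall k : C,
  @continuation R _ _ pgerms (germ_at (fun x => psi x + k) p) (germ_at (fun x => psi x + k) q).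
Proof.
move=> gp; have [c Ac dp] := atlas_at hM p; have hc := atlas_chart hM Ac.
have /(chart_near hc _ dp) N := good_psi_near hM hX gp.
have [e e0 He] := near_close hN (nearI N (chart_inv_near hc dp)).
have /(chart_near_map hc _ dp) B : \forall w \near nbhs (cmap c p), cabs (w - cmap c p) < e.
  by apply/(abs_near hN); exists e.
apply: filterS2 B (chart_dom_near hc dp) => q qe dq k.
pose g (s : R) : C := cmap c p + s%:C%C * (cmap c q - cmap c p).
have gin (s : R) : 0 <= s <= 1 -> cabs (g s - cmap c p) < e by move=> s01; exact: segment_in.
have g0 : cinv c (g 0) = p.
  by rewrite /g (rmorph0 (real_complex R)) mul0r addr0 (chartK hc).
have g1 : cinv c (g 1) = q.
  rewrite /g (rmorph1 (real_complex R)) mul1r -[RHS](chartK hc dq).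
  by congr (cinv c _); ring.
have := @continuation_germ_path R M C pgerms (fun x => psi x + k) (cinv c \o g).
rewrite /= g0 g1; apply=> [|s /gin /He[Hs _]]; last first.
  by apply/(psi_germsP hM); exact: good_psiD.
apply/within01P => s s01 P HP; have [_ [ds Es]] := He _ (gin s s01).
have ci := chart_inv_cont hc ds; rewrite Es in ci.
have cg : g @ nbhs s --> g s by exact: rdiff_cont (rdiff_line _ _ s).
have H1 : \forall w \near nbhs (g s), P (cinv c w) := ci P HP.
by apply: filterS (cvg_preimage cg H1) => y Py _.
Qed.

Lemma z_region_open e0 e : @continuation R _ _ zgerms e0 e ->
  \forall e' \near nbhs e, @continuation R _ _ zgerms e0 e'.
Proof.
move=> He; have := continuation_in He; move: He; rewrite -(germ_repE e) => He /z_germsP g.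
apply/etale_near; apply: filterS (z_path g) => t' H.
exact: continuation_trans He H.
Qed.

Lemma psi_region_open e0 e : @continuation R _ _ pgerms e0 e ->
  \forall e' \near nbhs e, @continuation R _ _ pgerms e0 e'.
Proof.
move=> He; have := continuation_in He; move: He; rewrite -(germ_repE e) => He /(psi_germsP hM) g.
apply/etale_near; apply: filterS (psi_path g) => q /(_ 0) H.
have E x : germ_at (fun x => germ_rep e x + 0) x = germ_at (germ_rep e) x.
  by apply: germ_at_eq; apply: nearW => y; rewrite addr0.
by rewrite !E in H; exact: continuation_trans He H.
Qed.

Lemma hausdorffM p q : p <> q -> exists U V : set M,
  [/\ open U, open V, U p, V q & U `&` V = set0].
Proof. by case: hM => _ _ _ H _; exact: H. Qed.

Lemma hausdorffC (s t : C) : s != t -> exists U V : set C,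
  [/\ open U, open V, U s, V t & U `&` V = set0].
Proof.
move=> st; pose r := cabs (s - t) / 2.
have r0 : 0 < r by rewrite divr_gt0 // (abs_gt0 hN) // subr_eq0.
have ob (x : C) : open [set w : C | cabs (w - x) < r].
  apply: open_of_nbhs => w /= wr.
  have H : \forall y \near nbhs w, cabs (y - x) < r; last exact: H.
  apply/(abs_near hN); exists (r - cabs (w - x)); first by rewrite subr_gt0.
  move=> y yw; have := absD hN (y - w) (w - x).
  rewrite (_ : y - w + (w - x) = y - x); last by ring.
  lra.
exists [set w | cabs (w - s) < r], [set w | cabs (w - t) < r]; split => //=.
- by rewrite subrr (abs0 hN).
- by rewrite subrr (abs0 hN).
- apply/seteqP; split=> // w /= [ws wt].
  have := absB hN (w - t) (w - s); rewrite (_ : w - t - (w - s) = s - t); last by ring.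
  rewrite /r in ws wt; lra.
Qed.

(** The chart is the inverse of the local section [t |-> germ_at f t], restricted to an open set of
    times whose germs remain in [D]. *)
Lemma etale_chart (D : set (etale C M)) e :
  (forall e, D e -> \forall e' \near nbhs e, D e') -> D e ->
  exists2 c, pullback_atlas plane D (@base _ _) c & cdom c e.
Proof.
move=> oD De; have := oD e De; rewrite -(germ_repE e) => /etale_near.
set f := germ_rep e => Hf.
pose U := interior [set t | D (germ_at f t)].
have oU : open U by exact: open_interior.
have UD t : U t -> D (germ_at f t) by move/interior_subset.
pose W := [set germ_at f t | t in U].
exists (Chart W (@base _ _) (germ_at f)); last by exists (base e).
split; last 2 first.
- by move=> _ [t Ut <-]; exact: UD.
- by exists (Chart [set: C] id id).
split => /=.
- apply: open_of_nbhs => _ [t Ut <-].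
  have nU : \forall t' \near nbhs t, U t' by exact: (open_nbhs_nbhs (conj oU Ut)).
  have H : \forall e \near nbhs (germ_at f t), W e; last exact: H.
  by apply/etale_near; apply: filterS nU => t' Ut'; exists t'.
- by move=> x /set_mem[t Ut <-].
- move=> V VW; split=> oV.
    apply: open_of_nbhs => _ [x Vx <-]; have [t Ut xE] := VW x Vx.
    have nV : \forall e \near nbhs x, V e by exact: (open_nbhs_nbhs (conj oV Vx)).
    rewrite -xE /= in nV *; move/etale_near in nV.
    have H : \forall t' \near nbhs t, (@base _ _ @` V) t'; last exact: H.
    by apply: filterS nV => t' Vt'; exists (germ_at f t').
  apply: open_of_nbhs => x Vx; have [t Ut xE] := VW x Vx.
  have bt : (@base _ _ @` V) t by exists x => //; rewrite -xE.
  have nV : \forall t' \near nbhs t, (@base _ _ @` V) t' by exact: (open_nbhs_nbhs (conj oV bt)).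
  have H : \forall e \near nbhs x, V e; last exact: H.
  rewrite -xE; apply/etale_near; apply: filterS nV => t' [y Vy yt].
  by have [t2 Ut2 yE] := VW y Vy; rewrite -yt -yE /= yE.
Qed.

Lemma plane_pullback (D : set (etale C M)) (c : chart R (etale C M)) :
  pullback_atlas plane D (@base _ _) c -> [/\ is_chart c, cdom c `<=` D & cmap c = @base _ _].
Proof. by move=> [ic cD [c0 -> [_ ->]]]. Qed.

Lemma plane_chart_inv (D : set (etale C M)) (c : chart R (etale C M)) z t :
  pullback_atlas plane D (@base _ _) c -> cdom c (germ_at z t) ->
  \forall t' \near nbhs t, cinv c t' = germ_at z t'.
Proof.
move=> /plane_pullback[ic _ cE] dc; have /etale_near := chart_dom_near ic dc.
by apply: filterS => t' dt'; rewrite -{1}[t']/(base (germ_at z t')) -cE (chartK ic).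
Qed.

Lemma germ_val_cont z t : z @ nbhs t --> z t ->
  @germ_val C M @ nbhs (germ_at z t) --> z t.
Proof.
move=> cz P HP.
have H1 : \forall t' \near nbhs t, P (z t') := cz P HP.
have H : \forall e \near nbhs (germ_at z t), P (germ_val e); last exact: H.
apply/etale_near; apply: filterS H1 => t'.
by rewrite germ_val_at.
Qed.

(** Distinct germs of solutions at one time occupy distinct positions, so the Hausdorff property of
    M separates them. *)
Lemma z_separate z1 z2 t : good_z A S X z1 t -> good_z A S X z2 t ->
  germ_at z1 t <> germ_at z2 t -> exists U V : set (etale C M),
  [/\ open U, open V, U (germ_at z1 t), V (germ_at z2 t) & U `&` V = set0].
Proof.
move=> g1 g2 ne; have [_ c1 _] := g1; have [_ c2 _] := g2.
have zz : z1 t <> z2 t.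
  by move=> zz; apply: ne; apply: germ_at_eq; exact: (good_z_uniq hM hX g1 g2 zz).
have := germ_val_cont c1; have := germ_val_cont c2.
have := @separate_map _ _ (@germ_val C M) (germ_at z1 t) (germ_at z2 t).
have -> : germ_val (germ_at z1 t) = z1 t by exact: germ_val_at.
have -> : germ_val (germ_at z2 t) = z2 t by exact: germ_val_at.
move=> H h2 h1; exact: (H h1 h2 (hausdorffM zz)).
Qed.

Lemma z_region_surface e0 : riemann_surface
  (pullback_atlas plane (@continuation R _ _ zgerms e0) (@base _ _))
  (@continuation R _ _ zgerms e0).
Proof.
set D := continuation _ _ _; split.
- by move=> c [].
- apply/seteqP; split=> [e [c [_ cD _] /cD //]|e De].
  have [c Hc dc] := etale_chart (@z_region_open e0) De.
  by exists c.
(* Every chart of the pulled back atlas has [base] as coordinate, so transitions are the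
   identity. *)
- move=> c1 c2 e h1 h2 d1 d2; have [i1 _ E1] := plane_pullback h1.
  have [_ _ E2] := plane_pullback h2.
  apply: analytic_ext (analytic_id _); apply: filterS (chart_inv_near i1 d1) => w [_].
  by rewrite /= E2 E1.
- move=> e1 e2 /continuation_in; rewrite -(germ_repE e1) => /z_germsP.
  set z1 := germ_rep e1; set t1 := base e1 => g1.
  move=> /continuation_in; rewrite -(germ_repE e2) => /z_germsP.
  set z2 := germ_rep e2; set t2 := base e2 => g2 ne.
  have [tt|/hausdorffC UV] := eqVneq t1 t2; last first.
    exact: (@separate_map _ _ (@base C M) (germ_at z1 t1) (germ_at z2 t2) (@base_cont _ _ _) (@base_cont _ _ _) UV).
  rewrite -tt in g2 ne *.
  exact: (z_separate g1 g2 ne).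
- exact: continuation_connected.
Qed.

End Surfaces.

(** * The graph of Psi_X as a Riemann surface *)

Section Sheets.
Variables (R : realType) (M : topologicalType) (A : set (chart R M)).
Hypothesis hM : riemann_surface A [set: M].
Variables (S : set M) (X : vfield R M).
Hypothesis hX : singular_vector_field A S X.
Local Notation C := (cplx R).
Local Notation pgerms := (psi_germs A S X).
Variables (B : set (etale M C)) (e0 : etale M C).
Hypothesis hB : B = @continuation R _ _ pgerms e0.
Implicit Types (c : chart R M) (p q : M) (psi : M -> C) (z : C -> M) (t : C).
Local Notation graph := (graph_of B : set (sheets B)).

Lemma branch_good psi p : B (germ_at psi p) -> good_psi A S X psi p.
Proof. by rewrite hB => /continuation_in /(psi_germsP hM). Qed.

Lemma branch_near psi p : B (germ_at psi p) -> \forall q \near nbhs p, B (germ_at psi q).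
Proof. by rewrite hB => /(psi_region_open hM hX) /etale_near. Qed.

Lemma branch_uniq psi1 psi2 p : B (germ_at psi1 p) -> B (germ_at psi2 p) ->
  psi1 p = psi2 p -> \forall q \near nbhs p, psi1 q = psi2 q.
Proof. by move=> /branch_good g1 /branch_good g2 E; exact: (good_psi_uniq hM hX g1 g2 E). Qed.

(** The graph of one branch over an open set is open: another branch taking the same value at one of
    its points coincides with it nearby. *)
Lemma sheets_near psi p (P : sheets B -> Prop) : B (germ_at psi p) ->
  (\forall x \near nbhs ((p, psi p) : sheets B), P x) <-> \forall q \near nbhs p, P (q, psi q).
Proof.
move=> Bp; split=> [H|H].
  rewrite nbhsE in H; case: H => W [oW Wp] WP.
  have : \forall q \near nbhs p, W (q, psi q) by exact: oW Wp.
  by apply: filterS => q; exact: WP.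
have H' := nearI H (branch_near Bp).
rewrite nbhsE in H'; case: H' => U [oU Up] UP.
rewrite nbhsE; exists [set (q, psi q) | q in U]; last first.
  by move=> _ [q Uq <-]; have [Pq _] := UP q Uq.
split; last by exists p.
move=> psi2 q B2 [q' Uq' [qq E]]; rewrite qq in Uq' E.
have [_ B1] := UP q Uq'.
have nU : \forall x \near nbhs q, U x by apply: open_nbhs_nbhs.
apply: filterS2 nU (branch_uniq B1 B2 E) => x Ux Ex.
by exists x => //; rewrite Ex.
Qed.

Lemma fst_cont psi p : B (germ_at psi p) ->
  (fst : sheets B -> M) @ nbhs ((p, psi p) : sheets B) --> p.
Proof.
move=> Bp P HP.
have H : \forall x \near nbhs ((p, psi p) : sheets B), P x.1; last exact: H.
by apply/(sheets_near (fun x => P x.1) Bp).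
Qed.

Lemma snd_cont psi p : B (germ_at psi p) ->
  (snd : sheets B -> C) @ nbhs ((p, psi p) : sheets B) --> psi p.
Proof.
move=> Bp P HP.
have H : \forall x \near nbhs ((p, psi p) : sheets B), P x.2; last exact: H.
apply/(sheets_near (fun x => P x.2) Bp).
exact: (good_psi_cont hM hX (branch_good Bp) HP).
Qed.

Lemma sheets_chart psi p : B (germ_at psi p) ->
  exists2 c, pullback_atlas A graph fst c & cdom c (p, psi p).
Proof.
move=> Bp; have [c Ac dp] := atlas_at hM p; have hc := atlas_chart hM Ac.
pose U := interior [set q | B (germ_at psi q)] `&` cdom c.
have oU : open U by apply: openI; [exact: open_interior|exact: (chart_open hc)].
have UB q : U q -> B (germ_at psi q) by move=> [/interior_subset].
have Ud q : U q -> cdom c q by case.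
pose W : set (sheets B) := [set (q, psi q) | q in U].
exists (Chart W (fun x => cmap c x.1) (fun w => (cinv c w, psi (cinv c w)))); last first.
  by exists p => //; split => //; exact: branch_near Bp.
have nW q : U q -> \forall x \near nbhs ((q, psi q) : sheets B), W x.
  move=> Uq; apply/(sheets_near _ (UB q Uq)).
  have nU : \forall q' \near nbhs q, U q' by exact: (open_nbhs_nbhs (conj oU Uq)).
  by apply: filterS nU => q' Uq'; exists q'.
split; last 2 first.
- by move=> _ [q Uq <-]; exists psi => //=; exact: UB.
- by exists c => //; split => //; move=> _ [_ [q Uq <-] <-] /=; exact: Ud.
split => /=.
- by apply: open_of_nbhs => _ [q Uq <-]; exact: nW.
- by move=> x /set_mem[q Uq <-] /=; rewrite (chartK hc (Ud q Uq)).
- move=> V VW.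
  have -> : [set cmap c x.1 | x in V] = cmap c @` (fst @` V).
    by rewrite -image_comp.
  have FV : fst @` V `<=` cdom c.
    by move=> _ [x /VW[q Uq <-] <-]; exact: Ud.
  apply: (iff_trans _ (iff_sym (chart_image_open hc FV))).
  split=> oV; apply: open_of_nbhs.
    move=> _ [x Vx <-]; have [q Uq xE] := VW x Vx.
    have nV : \forall y \near nbhs (x : sheets B), V y by exact: (open_nbhs_nbhs (conj oV Vx)).
    rewrite -xE /= in nV *; move/(sheets_near _ (UB q Uq)) in nV.
    have H : \forall t' \near nbhs q, (fst @` V) t'; last exact: H.
    by apply: filterS nV => t' Vt'; exists (t', psi t').
  move=> x Vx; have [q Uq xE] := VW x Vx.
  have bt : (fst @` V) q by exists x => //; rewrite -xE.
  have nV : \forall t' \near nbhs q, (fst @` V) t' by exact: (open_nbhs_nbhs (conj oV bt)).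
  have H : \forall y \near nbhs (x : sheets B), V y; last exact: H.
  rewrite -xE; apply/(sheets_near _ (UB q Uq)); apply: filterS nV => t' [y Vy yt].
  by have [t2 Ut2 yE] := VW y Vy; rewrite -yt -yE /= yE.
Qed.

Lemma sheets_pullback (c : chart R (sheets B)) : pullback_atlas A graph fst c ->
  [/\ is_chart c, cdom c `<=` graph &
     exists2 c0, A c0 & (forall x, cdom c x -> cdom c0 x.1) /\ cmap c = cmap c0 \o fst].
Proof.
move=> [ic cD [c0 Ac [dc E]]]; split => //; exists c0 => //; split => // x cx.
by apply: dc; exists x.
Qed.

(** A chart of the pulled back atlas is prescribed only through its domain and coordinate; near a
    point of its domain its inverse has to follow the branch [psi]. *)
Lemma sheets_chart_inv (c : chart R (sheets B)) c0 psi p :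
  pullback_atlas A graph fst c -> A c0 -> (forall x, cdom c x -> cdom c0 x.1) ->
  cmap c = cmap c0 \o fst -> B (germ_at psi p) -> cdom c (p, psi p) ->
  \forall w \near nbhs (cmap c0 p), cinv c w = (cinv c0 w, psi (cinv c0 w)).
Proof.
move=> /sheets_pullback[ic _ _] Ac0 dc E Bp dp; have h0 := atlas_chart hM Ac0.
have /(sheets_near _ Bp) H := chart_dom_near ic dp.
have d0 : cdom c0 p := dc _ dp.
have /(chart_near h0 _ d0) H' := H.
apply: filterS2 H' (chart_inv_near h0 d0) => w dw [_ cw].
by rewrite -[RHS](chartK ic dw) E /= cw.
Qed.

Lemma continuous_image_connected (T Y : topologicalType) (D : set T) (f : T -> Y) :
  connected D -> (forall x, D x -> f @ nbhs x --> f x) -> connected (f @` D).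
Proof.
move=> cD cf; apply: connected_continuous_connected cD _.
by apply: continuous_in_subspaceT => x /set_mem; exact: cf.
Qed.

Lemma graph_connected : connected graph.
Proof.
pose F (e : etale M C) : sheets B := (base e, germ_val e).
have -> : graph = F @` B.
  apply/seteqP; split=> [[p t] [psi /= Bp ->]|_ [e Be <-]].
    by exists (germ_at psi p) => //; rewrite /F germ_val_at.
  by exists (germ_rep e) => //=; rewrite germ_repE.
apply: continuous_image_connected.
  by rewrite hB; exact: continuation_connected.
move=> e; rewrite -(germ_repE e); set psi := germ_rep e; set p := base e => Bp.
rewrite /F germ_val_at /= => P /(sheets_near _ Bp) HP.
have H : \forall e' \near nbhs (germ_at psi p), P (base e', germ_val e'); last exact: H.
by apply/etale_near; apply: filterS HP => q; rewrite germ_val_at.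
Qed.

Lemma graph_surface : riemann_surface (pullback_atlas A graph fst) graph.
Proof.
split.
- by move=> c [].
- apply/seteqP; split=> [x [c [_ cD _] /cD //]|[p t] [psi /= Bp ->]].
  have [c Hc dc] := sheets_chart Bp.
  by exists c.
- move=> c1 c2 x h1 h2 d1 d2.
  have [_ cD1 [c10 A1 [dc1 E1]]] := sheets_pullback h1.
  have [_ _ [c20 A2 [dc2 E2]]] := sheets_pullback h2.
  case: x d1 d2 (cD1 _ d1) => [p t] d1 d2 [psi /= Bp te]; rewrite te in d1 d2 *.
  have H := sheets_chart_inv h1 A1 dc1 E1 Bp d1.
  have a := transition_analytic hM A1 A2 (dc1 _ d1) (dc2 _ d2).
  rewrite E1 /=; apply: analytic_ext a; apply: filterS H => w Hw.
  by rewrite /= Hw E2.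
- move=> [p t] [q u] [psi1 /= B1 t1] [psi2 /= B2 u2] ne; rewrite t1 u2 in ne *.
  have [pq|/eqP pq] := eqVneq (p : M) q; last first.
    apply: (@separate_map _ _ (fst : sheets B -> M) (p, psi1 p) (q, psi2 q)).
    + exact: (fst_cont B1).
    + exact: (fst_cont B2).
    + exact: (hausdorffM hM pq).
  rewrite -pq in B2 ne *.
  apply: (@separate_map _ _ (snd : sheets B -> C) (p, psi1 p) (p, psi2 p)).
  + exact: (snd_cont B1).
  + exact: (snd_cont B2).
  + by apply: hausdorffC; apply/eqP => E; apply: ne; congr pair; exact: E.
- exact: graph_connected.
Qed.

(** The points covered by branches are closed in M \ S: near a limit point take a local time
    function [psi]. A branch at a nearby [q] equals [psi + k], and [psi + k] continues it back to
    the limit point. *)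
Lemma graph_base : B e0 -> fst @` graph = ~` S.
Proof.
move=> B0; apply/seteqP; split=> [_ [[p t] [psi /= Bp _] <-]|].
  by have [] := branch_good Bp.
have H : forall p, (~` S) p -> exists psi, B (germ_at psi p).
  have Be0 : B (germ_at (germ_rep e0) (base e0)) by rewrite germ_repE.
  apply: (connected_forall (svf_connected hX)).
  - exists (base e0); last by exists (germ_rep e0).
    by have [] := branch_good Be0.
  - move=> p _ [psi Bp]; apply: filterS (branch_near Bp) => q Bq _.
    by exists psi.
  - move=> p Sp acc; have [psi gp _] := good_psi_exists hM hX 0 Sp.
    have [q [[Hq gq] _ [psi2 Bq]]] := acc _ (nearI (psi_path hM hX gp) (good_psi_near hM hX gp)).
    pose k := psi2 q - psi q.
    have E : germ_at psi2 q = germ_at (fun x => psi x + k) q.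
      apply: germ_at_eq; apply: (good_psi_uniq hM hX (branch_good Bq) (good_psiD _ gq)).
      by rewrite /k; ring.
    exists (fun x => psi x + k); move: Bq; rewrite E hB => Bq.
    exact: (continuation_trans Bq (continuation_sym (Hq k))).
by move=> p /H[psi Bp]; exists (p, psi p) => //; exists psi.
Qed.

End Sheets.

(** * Inversion between germs of solutions and germs of time functions *)

Section Correspondence.
Variables (R : realType) (M : topologicalType) (A : set (chart R M)).
Hypothesis hM : riemann_surface A [set: M].
Variables (S : set M) (X : vfield R M).
Hypothesis hX : singular_vector_field A S X.
Local Notation C := (cplx R).
Local Notation plane := (@plane_atlas R).
Local Notation zgerms := (z_germs A S X).
Local Notation pgerms := (psi_germs A S X).
Implicit Types (c : chart R M) (p q : M) (psi : M -> C) (z : C -> M) (t : C).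
Variables (Psi : M -> C -> M -> C) (Z : M -> C -> C -> M).
Hypothesis PsiZ : forall p t, ~ S p -> [/\ good_psi A S X (Psi p t) p, Psi p t p = t,
    good_z A S X (Z p t) t & Z p t t = p].

Definition invert_z (e : etale C M) : etale M C :=
  germ_at (Psi (germ_val e) (base e)) (germ_val e).

Definition invert_psi (e : etale M C) : etale C M :=
  germ_at (Z (base e) (germ_val e)) (germ_val e).

Lemma invert_zE z psi t : good_z A S X z t -> good_psi A S X psi (z t) ->
  psi (z t) = t -> invert_z (germ_at z t) = germ_at psi (z t).
Proof.
move=> gz gp E; rewrite /invert_z germ_val_at /=.
have [Sz _ _] := gz; have [g1 E1 _ _] := PsiZ t Sz.
apply: germ_at_eq; apply: (good_psi_uniq hM hX g1 gp).
by rewrite E1 E.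
Qed.

Lemma invert_psiE psi z p : good_psi A S X psi p -> good_z A S X z (psi p) ->
  z (psi p) = p -> invert_psi (germ_at psi p) = germ_at z (psi p).
Proof.
move=> gp gz E; rewrite /invert_psi germ_val_at /=.
have [Sp _] := gp; have [_ _ g1 E1] := PsiZ (psi p) Sp.
apply: germ_at_eq; apply: (good_z_uniq hM hX g1 gz).
by rewrite E1 E.
Qed.

Lemma invert_z_near z psi t : good_z A S X z t -> good_psi A S X psi (z t) ->
  psi (z t) = t -> \forall t' \near nbhs t,
  [/\ good_z A S X z t', good_psi A S X psi (z t') & psi (z t') = t'].
Proof.
move=> gz gp E; have [_ cz _] := gz.
have H := cvg_preimage cz (good_psi_near hM hX gp).
apply: filterS2 (good_psi_z hM hX gp gz E) (nearI H (good_z_near hM hX gz)) => t' h [h1 h2].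
split; [exact: h2|exact: h1|exact: h].
Qed.

Lemma invert_psi_near psi z p : good_psi A S X psi p -> good_z A S X z (psi p) ->
  z (psi p) = p -> \forall q \near nbhs p,
  [/\ good_psi A S X psi q, good_z A S X z (psi q) & z (psi q) = q].
Proof.
move=> gp gz E.
have H := cvg_preimage (good_psi_cont hM hX gp) (good_z_near hM hX gz).
have gp' : good_psi A S X psi (z (psi p)) by rewrite E.
have E' : psi (z (psi p)) = psi p by rewrite E.
have K := good_z_psi hM hX gp' gz E'; rewrite E in K.
apply: filterS2 K (nearI H (good_psi_near hM hX gp)) => q h [h1 h2].
split; [exact: h2|exact: h1|exact: h].
Qed.

Lemma z_germs_invert e : zgerms e -> exists z psi t,
  [/\ e = germ_at z t, good_z A S X z t, good_psi A S X psi (z t) & psi (z t) = t].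
Proof.
rewrite -(germ_repE e) => /z_germsP g; have [Sz _ _] := g.
have [gp E _ _] := PsiZ (base e) Sz.
by exists (germ_rep e), (Psi (germ_rep e (base e)) (base e)), (base e).
Qed.

Lemma psi_germs_invert e : pgerms e -> exists psi z p,
  [/\ e = germ_at psi p, good_psi A S X psi p, good_z A S X z (psi p) & z (psi p) = p].
Proof.
rewrite -(germ_repE e) => /(psi_germsP hM) g; have [Sp _] := g.
have [_ _ gz E] := PsiZ (germ_rep e (base e)) Sp.
by exists (germ_rep e), (Z (base e) (germ_rep e (base e))), (base e).
Qed.

Lemma invert_z_cont e : zgerms e -> invert_z @ nbhs e --> invert_z e.
Proof.
move=> /z_germs_invert[z [psi [t [-> gz gp E]]]]; rewrite (invert_zE gz gp E).
move=> P /etale_near HP; have [_ cz _] := gz.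
have H : \forall e \near nbhs (germ_at z t), P (invert_z e); last exact: H.
apply/etale_near; have HP' := cvg_preimage cz HP.
apply: filterS2 HP' (invert_z_near gz gp E) => t' Pt' [g1 g2 E'].
by rewrite (invert_zE g1 g2 E').
Qed.

Lemma invert_psi_cont e : pgerms e -> invert_psi @ nbhs e --> invert_psi e.
Proof.
move=> /psi_germs_invert[psi [z [p [-> gp gz E]]]]; rewrite (invert_psiE gp gz E).
move=> P /etale_near HP.
have H : \forall e \near nbhs (germ_at psi p), P (invert_psi e); last exact: H.
apply/etale_near; have HP' := cvg_preimage (good_psi_cont hM hX gp) HP.
apply: filterS2 HP' (invert_psi_near gp gz E) => t' Pt' [g1 g2 E'].
by rewrite (invert_psiE g1 g2 E').
Qed.

Lemma invert_z_germs e : zgerms e -> pgerms (invert_z e).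
Proof.
move=> /z_germs_invert[z [psi [t [-> gz gp E]]]]; rewrite (invert_zE gz gp E).
exact/(psi_germsP hM).
Qed.

Lemma invert_psi_germs e : pgerms e -> zgerms (invert_psi e).
Proof.
move=> /psi_germs_invert[psi [z [p [-> gp gz E]]]]; rewrite (invert_psiE gp gz E).
exact/z_germsP.
Qed.

Variables (z0 : C -> M) (t0 : C) (psi0 : M -> C).
Hypothesis gz0 : good_z A S X z0 t0.
Hypothesis gp0 : good_psi A S X psi0 (z0 t0).
Hypothesis E0 : psi0 (z0 t0) = t0.
Variable B : set (etale M C).
Hypothesis hB : B = @continuation R _ _ pgerms (germ_at psi0 (z0 t0)).
Local Notation D := (@continuation R _ _ zgerms (germ_at z0 t0)).
Local Notation graph := (graph_of B : set (sheets B)).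

Lemma region_branch z psi t : good_z A S X z t -> good_psi A S X psi (z t) ->
  psi (z t) = t -> D (germ_at z t) <-> B (germ_at psi (z t)).
Proof.
move=> gz gp E; rewrite hB; split=> [H|H].
  have := continuation_map invert_z_cont invert_z_germs H.
  by rewrite (invert_zE gz0 gp0 E0) (invert_zE gz gp E).
have gz0' := gz0; have gz' := gz; rewrite -{1}E0 in gz0'; rewrite -{1}E in gz'.
have E0' : z0 (psi0 (z0 t0)) = z0 t0 by rewrite E0.
have E' : z (psi (z t)) = z t by rewrite E.
have := continuation_map invert_psi_cont invert_psi_germs H.
by rewrite (invert_psiE gp0 gz0' E0') (invert_psiE gp gz' E') E0 E.
Qed.

(** [space_time] for an arbitrary set of branches [B]; the two agree by conversion when [B] is
    [time_branches]. *)
Definition event (e : etale C M) : sheets B := (germ_val e, base e).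

Lemma event_at z t : event (germ_at z t) = (z t, t).
Proof. by rewrite /event germ_val_at. Qed.

Lemma region_invert e : D e -> exists z psi t, [/\ e = germ_at z t, good_z A S X z t,
  good_psi A S X psi (z t) /\ psi (z t) = t & B (germ_at psi (z t))].
Proof.
move=> De; have [z [psi [t [E gz gp pt]]]] := z_germs_invert (continuation_in De).
exists z, psi, t; split => //.
by apply/(region_branch gz gp pt); rewrite -E.
Qed.

Lemma graph_invert x : graph x -> exists psi z p, [/\ x = (p, psi p), B (germ_at psi p),
  good_psi A S X psi p, good_z A S X z (psi p) /\ z (psi p) = p & D (germ_at z (psi p))].
Proof.
case: x => p t [psi /= Bp ->]; have gp := branch_good hM hB Bp.
have [Sp _] := gp; have [_ _ gz zp] := PsiZ (psi p) Sp.
set z := Z p (psi p) in gz zp; exists psi, z, p; split => //.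
have gp' : good_psi A S X psi (z (psi p)) by rewrite zp.
have E' : psi (z (psi p)) = psi p by rewrite zp.
by apply/(region_branch gz gp' E'); rewrite zp.
Qed.

Definition solution_germ (x : sheets B) : etale C M := germ_at (Z x.1 x.2) x.2.

Lemma solution_germE z psi p : good_psi A S X psi p -> good_z A S X z (psi p) ->
  z (psi p) = p -> solution_germ (p, psi p) = germ_at z (psi p).
Proof.
move=> [Sp _] gz E; rewrite /solution_germ /=.
have [_ _ g1 E1] := PsiZ (psi p) Sp.
apply: germ_at_eq; apply: (good_z_uniq hM hX g1 gz).
by rewrite E1 E.
Qed.

(** In the coordinates [base] and [cmap c \o fst] the map reads [cmap c \o z]; its inverse
    [solution_germ] reads [psi \o cinv c]. *)
Lemma event_analytic e : D e ->
  analytic_map (pullback_atlas plane D (@base _ _)) (pullback_atlas A graph fst) event e.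
Proof.
move=> /region_invert[z [psi [t [-> gz [gp E] Bp]]]].
have [_ cz _] := gz; split.
  suff : event @ nbhs (germ_at z t) --> event (germ_at z t) by [].
  rewrite event_at -{3}E => P /(sheets_near hM hX hB _ Bp) HP.
  have H : \forall e \near nbhs (germ_at z t), P (event e); last exact: H.
  apply/etale_near; apply: filterS2 (cvg_preimage cz HP) (invert_z_near gz gp E).
  by move=> t' Pt' [_ _ E']; rewrite event_at -{2}E'.
move=> c1 c2 h1 h2 d1; rewrite event_at => d2.
have [_ _ E1] := plane_pullback h1.
have [_ _ [c A2 [dc E2]]] := sheets_pullback h2.
have a := good_z_analytic_chart hM hX gz A2 (dc _ d2).
rewrite E1 /=; apply: analytic_ext a; apply: filterS (plane_chart_inv h1 d1) => t' Ht'.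
by rewrite /= Ht' event_at E2.
Qed.

Lemma solution_germ_analytic x : graph x ->
  analytic_map (pullback_atlas A graph fst) (pullback_atlas plane D (@base _ _)) solution_germ x.
Proof.
move=> /graph_invert[psi [z [p [-> Bp gp [gz E] _]]]].
split.
  suff : solution_germ @ nbhs ((p, psi p) : sheets B) --> solution_germ (p, psi p) by [].
  rewrite (solution_germE gp gz E) => P /etale_near HP.
  have H : \forall x \near nbhs ((p, psi p) : sheets B), P (solution_germ x); last exact: H.
  apply/(sheets_near hM hX hB _ Bp).
  apply: filterS2 (cvg_preimage (good_psi_cont hM hX gp) HP) (invert_psi_near gp gz E).
  by move=> q Pq [g1 g2 E']; rewrite (solution_germE g1 g2 E').
move=> c1 c2 h1 h2 d1 d2.
have [_ _ E2] := plane_pullback h2.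
have [_ _ [c A1 [dc E1]]] := sheets_pullback h1.
have a := good_psi_analytic_chart hM hX gp A1 (dc _ d1).
rewrite E1 /=; apply: analytic_ext a.
apply: filterS (sheets_chart_inv hM hX hB h1 A1 dc E1 Bp d1) => w Hw.
by rewrite /= Hw E2.
Qed.

Lemma event_biholomorphic :
  biholomorphic (pullback_atlas plane D (@base _ _)) D (pullback_atlas A graph fst) graph event.
Proof.
split.
- split.
  + move=> _ /region_invert[z [psi [t [-> gz [gp E] Bp]]]].
    by rewrite event_at; exists psi.
  + move=> e1 e2 /set_mem/region_invert[z1 [_ [t1 [-> g1 _ _]]]].
    move=> /set_mem/region_invert[z2 [_ [t2 [-> g2 _ _]]]].
    rewrite !event_at => -[zz tt]; rewrite -tt in g2 zz *.
    exact: (germ_at_eq (good_z_uniq hM hX g1 g2 zz)).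
  + move=> _ /graph_invert[psi [z [p [-> Bp gp [gz E] Dz]]]].
    by exists (germ_at z (psi p)); rewrite ?event_at ?E.
- exact: event_analytic.
- exists solution_germ; last exact: solution_germ_analytic.
  move=> _ /set_mem/region_invert[z [psi [t [-> gz [gp E] _]]]].
  have gz' := gz; rewrite -{1}E in gz'.
  have E' : z (psi (z t)) = z t by rewrite E.
  by have := solution_germE gp gz' E'; rewrite E event_at.
Qed.

End Correspondence.

(** * Translation of time *)

Section Shift.
Variables (R : realType) (M : topologicalType) (A : set (chart R M)).
Variables (S : set M) (X : vfield R M).
Local Notation C := (cplx R).
Local Notation plane := (@plane_atlas R).
Local Notation zgerms := (z_germs A S X).
Implicit Types (z w : C -> M) (t b : C) (e : etale C M).

Lemma near_shift t b (P : C -> Prop) : (\forall s \near nbhs t, P s) ->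
  \forall s \near nbhs (t + b), P (s - b).
Proof.
move=> H; rewrite addrC; apply/(near_translate b t (fun s => P (s - b))).
by apply: filterS H => s; rewrite addrAC subrr add0r.
Qed.

Lemma good_z_shift z t b : good_z A S X z t -> good_z A S X (fun s => z (s - b)) (t + b).
Proof.
have tb : t + b - b = t by rewrite addrK.
move=> [Sz cz [c [Ac dz H]]]; split; first by rewrite tb.
  rewrite tb => P HP; have HP' : \forall s \near nbhs t, P (z s) := cz P HP.
  exact: (near_shift b HP').
exists c; split; [exact: Ac|by rewrite tb|].
apply: filterS (near_shift b H) => s /= ds.
have ds2 := cdiffB (cdiff_id s) (cdiff_cst b s).
by have := cdiff_comp ds2 ds; rewrite subr0 mulr1.
Qed.

Lemma time_shift_at b z t : time_shift b (germ_at z t) = germ_at (fun s => z (s - b)) (t + b).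
Proof.
apply: germ_at_eq; exact: (near_shift b (germ_rep_near z t)).
Qed.

Lemma time_shift_cont b e : @time_shift R M b @ nbhs e --> time_shift b e.
Proof.
rewrite -(germ_repE e) time_shift_at => P /etale_near HP.
have H : \forall e' \near nbhs (germ_at (germ_rep e) (base e)), P (time_shift b e'); last exact: H.
apply/etale_near; have := near_shift (- b) HP; rewrite addrK.
by apply: filterS => s; rewrite opprK time_shift_at.
Qed.

Lemma time_shiftK b : cancel (@time_shift R M b) (time_shift (- b)).
Proof.
move=> e; rewrite -(germ_repE e); set z := germ_rep e; set t := base e.
rewrite (time_shift_at b z t) time_shift_at addrK; apply: germ_at_eq.
by apply: nearW => s; rewrite opprK addrK.
Qed.

Lemma time_shift_germs b e : zgerms e -> zgerms (time_shift b e).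
Proof.
rewrite -(germ_repE e) => /z_germsP g; rewrite time_shift_at.
by apply/z_germsP; exact: good_z_shift.
Qed.

Lemma time_shift_analytic b (D1 D2 : set (etale C M)) e :
  analytic_map (pullback_atlas plane D1 (@base _ _)) (pullback_atlas plane D2 (@base _ _))
    (@time_shift R M b) e.
Proof.
split; first exact: time_shift_cont.
move=> c1 c2 h1 h2; rewrite -(germ_repE e) => d1 _.
have [_ _ E1] := plane_pullback h1; have [_ _ E2] := plane_pullback h2.
have a := analyticD (analytic_id (base e)) (analytic_cst b (base e)).
rewrite E1 /=; apply: analytic_ext a; apply: filterS (plane_chart_inv h1 d1) => t' Ht'.
by rewrite /= Ht' time_shift_at E2.
Qed.

Lemma time_shift_region b e1 e2 : @continuation R _ _ zgerms e1 e2 ->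
  @continuation R _ _ zgerms (time_shift b e1) (time_shift b e2).
Proof.
by apply: continuation_map => x; [move=> _; exact: time_shift_cont|exact: time_shift_germs].
Qed.

(** Translation commutes with continuation, so it suffices that one germ [e] of the first region is
    sent to the initial germ of the second. *)
Lemma time_shift_biholomorphic b e1 e2 e : @continuation R _ _ zgerms e1 e ->
  time_shift b e = e2 ->
  let D1 := @continuation R _ _ zgerms e1 in
  let D2 := @continuation R _ _ zgerms e2 in
  biholomorphic (pullback_atlas plane D1 (@base _ _)) D1
    (pullback_atlas plane D2 (@base _ _)) D2 (time_shift b).
Proof.
move=> He E2 D1 D2.
have He2 : time_shift (- b) e2 = e by rewrite -E2 time_shiftK.
have bK : cancel (@time_shift R M (- b)) (time_shift b).
  by move=> x; rewrite -{1}[b]opprK time_shiftK.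
split.
- split.
  + move=> x Dx; rewrite /D2 -E2; apply: time_shift_region.
    exact: continuation_trans (continuation_sym He) Dx.
  + by move=> x y _ _ E; rewrite -[x](time_shiftK b) E time_shiftK.
  + move=> y Dy; exists (time_shift (- b) y); last exact: bK.
    apply: continuation_trans He _; rewrite -He2; exact: time_shift_region.
- by move=> x _; exact: time_shift_analytic.
- exists (time_shift (- b)) => [x _|y _]; first exact: time_shiftK.
  exact: time_shift_analytic.
Qed.

End Shift.

(** * The region is the graph, and initial conditions differ by a translation *)

Section Main.
Variables (R : realType) (M : topologicalType) (A : set (chart R M)).
Hypothesis hM : riemann_surface A [set: M].
Variables (S : set M) (X : vfield R M).
Hypothesis hX : singular_vector_field A S X.
Local Notation C := (cplx R).
Local Notation zgerms := (z_germs A S X).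

Lemma univalence_regionE z : good_z A S X z 0 ->
  univalence_region A z = @continuation R _ _ zgerms (germ_at z 0).
Proof.
by move=> gz; apply: (z_continuation hM hX); apply/z_germsP.
Qed.

Lemma univalence_region_graph z0 z : ~ S z0 -> local_solution A X z0 z ->
  [/\ riemann_surface (univalence_atlas A z) (univalence_region A z),
      riemann_surface (time_graph_atlas A S X z0) (time_graph A S X z0),
      fst @` time_graph A S X z0 = ~` S &
      biholomorphic (univalence_atlas A z) (univalence_region A z)
        (time_graph_atlas A S X z0) (time_graph A S X z0)
        (space_time A S X z0)].
Proof.
move=> S0 lz; have [gz zz0 [psi [tb gp p0]]] := local_solution_good hM hX S0 lz.
have hB := time_branches_E hM hX S0 tb.
have [Psi [Z PZ]] := germ_choice hM hX.
have E0 : psi (z 0) = 0 by rewrite zz0.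
have gp0 := gp; have hB0 := hB; rewrite -zz0 in gp0 hB0.
rewrite /univalence_atlas (univalence_regionE gz); split.
- exact: z_region_surface.
- exact: (graph_surface hM hX hB).
- apply: (graph_base hM hX hB); rewrite hB; apply: continuation_refl.
  exact/(psi_germsP hM).
- rewrite zz0 in hB0.
  have hB1 : time_branches A S X z0 = @continuation R _ _ (psi_germs A S X) (germ_at psi (z 0)).
    by rewrite zz0.
  exact: (event_biholomorphic hM hX PZ gz gp0 E0 hB1).
Qed.

(** The graph over [z0] covers [z1], so some branch [psi1] started at [z0] is defined there; the
    region of [z] therefore passes through [z1] at time [psi1 z1]. *)
Lemma univalence_region_shift z0 z1 z w : ~ S z0 -> ~ S z1 ->
  local_solution A X z0 z -> local_solution A X z1 w ->
  exists b : C,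
    biholomorphic (univalence_atlas A z) (univalence_region A z)
      (univalence_atlas A w) (univalence_region A w) (time_shift b).
Proof.
move=> S0 S1 lz lw; have [gz zz0 [psi [tb gp p0]]] := local_solution_good hM hX S0 lz.
have [gw ww1 _] := local_solution_good hM hX S1 lw.
have hB := time_branches_E hM hX S0 tb.
have [Psi [Z PZ]] := germ_choice hM hX.
have E0 : psi (z 0) = 0 by rewrite zz0.
have gp0 := gp; rewrite -zz0 in gp0.
have hB1 : time_branches A S X z0 = @continuation R _ _ (psi_germs A S X) (germ_at psi (z 0)).
  by rewrite zz0.
have [_ _ G _] := univalence_region_graph S0 lz.
have : (~` S) z1 by [].
rewrite -G => -[[p t] [psi1 /= Bp _] pz1]; rewrite pz1 in Bp.
have gp1 := branch_good hM hB Bp.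
have [_ _ g1 E1] := PZ z1 (psi1 z1) S1.
set y := Z z1 (psi1 z1) in g1 E1.
have gp1' : good_psi A S X psi1 (y (psi1 z1)) by rewrite E1.
have E1' : psi1 (y (psi1 z1)) = psi1 z1 by rewrite E1.
have Dy : @continuation R _ _ zgerms (germ_at z 0) (germ_at y (psi1 z1)).
  by apply/(region_branch hM hX PZ gz gp0 E0 hB1 g1 gp1' E1'); rewrite E1.
(* Translating by minus this time places the passage through [z1] at time 0, where uniqueness of
   solutions identifies its germ with that of [w]. *)
exists (- psi1 z1); rewrite /univalence_atlas (univalence_regionE gz) (univalence_regionE gw).
apply: (time_shift_biholomorphic Dy).
rewrite time_shift_at subrr; apply: germ_at_eq.
have g2 := good_z_shift (- psi1 z1) g1; rewrite subrr in g2.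
apply: (good_z_uniq hM hX g2 gw).
by rewrite opprK add0r E1 ww1.
Qed.

End Main.

Theorem theorem6 (R : realType) (M : topologicalType) (A : set (chart R M))
    (hM : riemann_surface A [set: M]) (S : set M) (X : vfield R M)
    (hX : singular_vector_field A S X) :
  (forall (z0 : M) (z : cplx R -> M),
     ~ S z0 -> local_solution A X z0 z ->
     [/\ riemann_surface (univalence_atlas A z) (univalence_region A z),
         riemann_surface (time_graph_atlas A S X z0) (time_graph A S X z0),
         fst @` time_graph A S X z0 = ~` S &
         biholomorphic (univalence_atlas A z) (univalence_region A z)
           (time_graph_atlas A S X z0) (time_graph A S X z0)
           (space_time A S X z0)]) /\
  (forall (z0 z1 : M) (z w : cplx R -> M),
     ~ S z0 -> ~ S z1 -> local_solution A X z0 z -> local_solution A X z1 w ->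
     exists b : cplx R,
       biholomorphic (univalence_atlas A z) (univalence_region A z)
         (univalence_atlas A w) (univalence_region A w) (time_shift b)).
Proof.
split; [exact: univalence_region_graph|exact: univalence_region_shift].
Qed.
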